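(* Let $N\ge 1$, $0<s<1$, and let $h:[0,\infty)\to[0,\infty)$ be continuous and $f:[0,\infty)\to[0,\infty)$ be continuous and locally Lipschitz with $f(0)=0$. Consider the problem $u_t+\mathcal{L}u=h(t)f(u)$ in $\mathbb{R}^N\times(0,T)$, $u(0)=u_0$ in $\mathbb{R}^N$, where $\mathcal{L}=-\Delta+(-\Delta)^s$. \begin{itemize} \item[(i)] Suppose there is $m>0$ such that $f$ and $\sigma\mapsto f(\sigma)/\sigma$ are nondecreasing on $(0,m]$, and suppose there exists $0\le v_0\in\mathcal{X}$, $v_0\neq 0$, with $\|v_0\|_\infty\le m$ and $$\int_0^{\infty} h(\sigma)\,\frac{f(\|e^{-\sigma\mathcal{L}}v_0\|_\infty)}{\|e^{-\sigma\mathcal{L}}v_0\|_\infty}\,d\sigma<1.$$ Then there exists $\delta>0$ such that, for $u_0=\delta v_0$, the problem has a nontrivial global mild solution. \item[(ii)] Let $0\le u_0\in\mathcal{X}$, $u_0\neq0$, and suppose that $f$ is nondecreasing, $f(\sigma)>0$ for all $\sigma>0$, $\int_{z_0}^\infty \frac{d\sigma}{f(\sigma)}<\infty$ for all $z_0>0$, and $f(e^{-t\mathcal{L}}w_0)\le e^{-t\mathcal{L}}f(w_0)$ for all $t>0$ and all $0\le w_0\in\mathcal{X}$. If there exists $\kappa>0$ such that $$\int_{\|e^{-\kappa\mathcal{L}}u_0\|_\infty}^{\infty}\frac{d\sigma}{f(\sigma)}\le\int_0^{\kappa}h(\sigma)\,d\sigma,$$ then the mild solution $u$ of the problem with initial condition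 $u_0$ is not global (i.e. there is no global mild solution with initial datum $u_0$). \end{itemize}
   Context: $\mathcal{X}:=L^\infty(\mathbb{R}^N)\cap L^1(\mathbb{R}^N)$. For $t>0$ let $\mathfrak{h}^{(s)}_t$ be the heat kernel of $-(-\Delta)^s$ on $\mathbb{R}^N$ (the fractional heat kernel), and define $\mathfrak{p}_t(z)=(4\pi t)^{-N/2}\int_{\mathbb{R}^N}e^{-|z-\xi|^2/(4t)}\mathfrak{h}^{(s)}_t(\xi)\,d\xi$, the heat kernel of $-\mathcal{L}$. The semigroup is $[e^{-t\mathcal{L}}u_0](x)=\int_{\mathbb{R}^N}\mathfrak{p}_t(x-y)u_0(y)\,dy$. A mild solution on $[0,T)$ with initial datum $0\le u_0\in\mathcal{X}$ is a function $u:\mathbb{R}^N\times[0,T)\to[0,\infty)$ with $u\in L^\infty((0,T);\mathcal{X})$ such that $u(t)=e^{-t\mathcal{L}}u_0+\int_0^t e^{-(t-\sigma)\mathcal{L}}h(\sigma)f(u(\sigma))\,d\sigma$ for $0<t<T$; it is global if $T=+\infty$. Nontrivial means not identically zero. *)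

(* Defs.v *)
From HB Require Import structures.
From mathcomp Require Import all_boot all_order all_algebra.
From mathcomp Require Import all_classical all_reals all_analysis.
From mathcomp Require Import ess_sup_inf.
Set Implicit Arguments. Unset Strict Implicit. Unset Printing Implicit Defensive.
Import Order.TTheory GRing.Theory Num.Def Num.Theory.
Import numFieldNormedType.Exports.
Local Open Scope classical_set_scope.
Local Open Scope ring_scope.

(* Euclidean space R^N, N = n.+1 >= 1, modelled as the iterated product       *)

Section Euclid.
Variable R : realType.

Fixpoint RNd (n : nat) : {d : measure_display & measurableType d} :=
  match n with
  | 0 => existT (fun d => measurableType d) _ (measurableTypeR R : measurableType _)
  | S n => existT (fun d => measurableType d) _
             (((projT2 (RNd n)) * measurableTypeR R)%type : measurableType _)
  end.

Definition RN (n : nat) : measurableType (projT1 (RNd n)) := projT2 (RNd n).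

Fixpoint lebN (n : nat) : {measure set (RN n) -> \bar R} :=
  match n return {measure set (RN n) -> \bar R} with
  | 0 => @lebesgue_measure R
  | S n => ((lebN n) \x (@lebesgue_measure R))%E
  end.

Fixpoint vsub (n : nat) : RN n -> RN n -> RN n :=
  match n return RN n -> RN n -> RN n with
  | 0 => fun x y => (x : R) - (y : R)
  | S n => fun x y => (vsub x.1 y.1, (x.2 : R) - (y.2 : R))
  end.

Fixpoint vdot (n : nat) : RN n -> RN n -> R :=
  match n return RN n -> RN n -> R with
  | 0 => fun x y => (x : R) * (y : R)
  | S n => fun x y => vdot x.1 y.1 + (x.2 : R) * (y.2 : R)
  end.

End Euclid.

Section Problem.
Variables (R : realType) (n : nat).
Local Notation N := (n.+1).
Local Notation RN := (RN R n).
Local Notation leb := (lebN R n).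

(* fractional heat kernel h^(s)_t of -(-Delta)^s on R^N, defined by Fourier
   inversion of exp(-t |xi|^(2s)) (the integrand is even, so only the cosine
   part survives):
   h^(s)_t(x) = (2 pi)^(-N) \int_{R^N} cos(x.xi) exp(-t |xi|^(2s)) dxi       *)
Definition frac_heat_kernel (s t : R) (x : RN) : R :=
  (2 * pi) ^- N *
  Rintegral leb setT (fun xi => cos (vdot x xi) * expR (- t * powR (vdot xi xi) s)).

(* heat kernel p_t of -L, L = -Delta + (-Delta)^s :
   p_t(z) = (4 pi t)^(-N/2) \int e^{-|z-xi|^2/(4t)} h^(s)_t(xi) dxi           *)
Definition heat_kernel (s t : R) (z : RN) : R :=
  powR (4 * pi * t) (- (N%:R / 2)) *
  Rintegral leb setT (fun xi =>
    expR (- vdot (vsub z xi) (vsub z xi) / (4 * t)) * frac_heat_kernel s t xi).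

Definition semigroup (s t : R) (u0 : RN -> R) (x : RN) : R :=
  Rintegral leb setT (fun y => heat_kernel s t (vsub x y) * u0 y).

Definition Linf_norm (g : RN -> R) : \bar R :=
  ess_sup leb (fun x => (`|g x|)%:E).

Definition L1_norm (g : RN -> R) : \bar R :=
  (\int[leb]_x (`|g x|)%:E)%E.

Definition in_X (g : RN -> R) : Prop :=
  measurable_fun setT g /\ (L1_norm g < +oo)%E /\ (Linf_norm g < +oo)%E.

Definition mild_solution (s : R) (h f : R -> R) (T : \bar R)
    (u0 : RN -> R) (u : RN -> R -> R) : Prop :=
  (forall x t, 0 <= t -> (t%:E < T)%E -> 0 <= u x t) /\
  (* u in L^infty((0,T); X) *)
  measurable_fun setT (fun z : RN * measurableTypeR R => u z.1 z.2) /\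
  (exists C : R, \forall t \ae (@lebesgue_measure R),
      0 < t -> (t%:E < T)%E ->
      (L1_norm (fun x => u x t) <= C%:E)%E /\
      (Linf_norm (fun x => u x t) <= C%:E)%E) /\
  (* the Duhamel formula, for 0 < t < T, as an identity in X (a.e. in x) *)
  (forall t, 0 < t -> (t%:E < T)%E ->
     \forall x \ae leb,
       ((u x t)%:E =
        (semigroup s t u0 x)%:E +
        \int[@lebesgue_measure R]_(sigma in `]0%R, t%R[%classic)
          \int[leb]_y (heat_kernel s (t - sigma) (vsub x y) *
                       (h sigma * f (u y sigma)))%:E)%E).

Definition nontrivial (u : RN -> R -> R) : Prop :=
  ~ (\forall z \ae ((leb \x (@lebesgue_measure R))%E), u z.1 z.2 = 0).

End Problem.

(* Main.v *)
(* The kernel p_t has the absolutely convergent Fourier representation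
   (2 pi)^-N \int cos(z.x) exp(-t|x|^2 - t|x|^(2s)) dx.
   It is nonnegative because exp(-t|x|^(2s)) is a limit of nonnegative
   combinations of products of Gaussians: with u = exp(-e(l + e)) the binomial
   series 1 - (1 - u)^s = \sum c_k u^(k+1) has nonnegative coefficients, and
   ((1 - u)/e)^s tends to l^s.  Fourier inversion by Gaussian regularisation then
   gives mass one and p_t * p_r = p_(t+r).

   (i) Let V t = e^{-tL} v0, let A < 1 be the given integral, and delta = 1 - A.
   Monotonicity of f(a)/a shows that the Duhamel map sends functions between 0
   and V into functions below (1 - A) V + A V = V, so that the monotone iteration
   from 0 converges to a global solution.

   (ii) Given a global solution u, fix x and put psi(t) = e^{-(kappa-t)L} u(t) (x).
   Duhamel's formula and the Jensen-type hypothesis give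
   psi(t) >= a + \int_0^t h f(psi) with a = e^{-kappa L} u0 (x), hence
   \int_0^kappa h <= \int_a^K 1/f with K independent of x.  As a comes arbitrarily
   close to the essential supremum of e^{-kappa L} u0, this contradicts the
   assumption, because \int_K^oo 1/f > 0. *)

Require Import Defs.
From HB Require Import structures.
From mathcomp Require Import all_boot all_order all_algebra.
From mathcomp Require Import all_classical all_reals all_analysis.
From mathcomp Require Import ess_sup_inf measurable_realfun ring lra.
Set Implicit Arguments. Unset Strict Implicit. Unset Printing Implicit Defensive.
Import Order.TTheory GRing.Theory Num.Def Num.Theory.
Import numFieldNormedType.Exports.
Local Open Scope classical_set_scope.
Local Open Scope ring_scope.

(** * Integration on R^N *)

(** Neither the sign nor the integrability of p_t can be read off its definition, and this dictates
    the order of the proof. Functions met on the way to positivity, such as 1 or the exponential of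
    a combination of Gaussians, need not be integrable, so they are tested after damping by a
    Gaussian; and positivity is asked of a multiplier rather than of a function, which turns
    stability under products into composition. Positivity precedes the mass, because integrability
    of p_t comes from monotone convergence of Gaussian-damped kernels. Only cosines occur: a free
    phase replaces complex exponentials in the induction on the dimension. In (i) the ratio f(N)/N
    is not shown to be measurable in time, so the Duhamel term is compared with the given integral
    by a monotonicity of integrals valid for arbitrary nonnegative functions. In (ii) the solution
    is bounded at almost every time only and psi is merely measurable, so the scalar comparison is
    run on a continuous minorant of psi, the primitive of a truncated integrand. *)

Section EuclidTheory.
Variable R : realType.
Local Notation mu := (@lebesgue_measure R).

Section sigma_finite_measure_of.
Context d (T : measurableType d) (m : {measure set T -> \bar R}).
Hypothesis sf : sigma_finite setT m.

(** [lebN] is a fixpoint into plain measures, which carry no sigma-finite structure. Taking the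
    proof as an argument gives the same measure a head symbol to which the instance can be
    attached. *)
Definition sigma_finite_measure_of (_ : sigma_finite setT m) : set T -> \bar R := m.
HB.instance Definition _ := Measure.copy (sigma_finite_measure_of sf) m.
HB.instance Definition _ := Measure_isSigmaFinite.Build _ _ _ (sigma_finite_measure_of sf) sf.
Definition toSF : {sigma_finite_measure set T -> \bar R} := sigma_finite_measure_of sf.
End sigma_finite_measure_of.

Lemma product_measure_sigma_finite d1 d2 (T1 : measurableType d1) (T2 : measurableType d2)
    (m1 : {sigma_finite_measure set T1 -> \bar R})
    (m2 : {sigma_finite_measure set T2 -> \bar R}) :
  sigma_finite setT (m1 \x m2)%E.
Proof.
have /sigma_finiteP[F [TF ndF Foo]] := sigma_finiteT m1.
have /sigma_finiteP[G [TG ndG Goo]] := sigma_finiteT m2.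
exists (fun k => F k `*` G k) => [|k].
  rewrite -setXTT TF TG predeqE => -[x y]; split; last by move=> [k _ []]; split; exists k.
  move=> [/= [i _ Fx] [j _ Gy]]; exists (maxn i j) => //; split.
  - by move: x Fx; exact/subsetPset/ndF/leq_maxl.
  - by move: y Gy; exact/subsetPset/ndG/leq_maxr.
have [mF Fy] := Foo k; have [mG Gy] := Goo k.
by split; [exact: measurableX|rewrite product_measure1E// lte_mul_pinfty// ge0_fin_numE].
Qed.

Lemma lebN_sigma_finite n : sigma_finite setT (lebN R n).
Proof.
elim: n => [|n IH]; first exact: sigma_finiteT.
exact: (product_measure_sigma_finite (toSF IH) mu).
Qed.

Canonical lebSF n := @SigmaFiniteMeasure.Pack _ (RN R n) R (lebN R n) (SigmaFiniteMeasure.class (toSF (@lebN_sigma_finite n))).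

Lemma measurable_fst_fst n :
  measurable_fun setT (fun z : RN R n.+1 * RN R n.+1 => (z.1.1, z.2.1) : RN R n * RN R n).
Proof.
apply/measurable_fun_pairP; split => /=.
  exact: (measurableT_comp (@measurable_fst _ _ _ _) (@measurable_fst _ _ _ _)).
exact: (measurableT_comp (@measurable_fst _ _ _ _) (@measurable_snd _ _ _ _)).
Qed.

Lemma measurable_snd_snd n :
  measurable_fun setT (fun z : RN R n.+1 * RN R n.+1 => (z.1.2, z.2.2) : measurableTypeR R * measurableTypeR R).
Proof.
apply/measurable_fun_pairP; split => /=.
  exact: (measurableT_comp (@measurable_snd _ _ _ _) (@measurable_fst _ _ _ _)).
exact: (measurableT_comp (@measurable_snd _ _ _ _) (@measurable_snd _ _ _ _)).
Qed.

Lemma measurable_vsub n :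
  measurable_fun setT (fun z : RN R n * RN R n => vsub z.1 z.2).
Proof.
have m0 : measurable_fun setT (fun z : measurableTypeR R * measurableTypeR R => (z.1 : R) - (z.2 : R)).
  by apply: measurable_funB; [exact: measurable_fst|exact: measurable_snd].
elim: n => [//|n IH].
apply/measurable_fun_pairP; split => /=.
  exact: (measurableT_comp IH (@measurable_fst_fst n)).
exact: (measurableT_comp m0 (@measurable_snd_snd n)).
Qed.

Lemma measurable_vdot n :
  measurable_fun setT (fun z : RN R n * RN R n => vdot z.1 z.2).
Proof.
have m0 : measurable_fun setT (fun z : measurableTypeR R * measurableTypeR R => (z.1 : R) * (z.2 : R)).
  by apply: measurable_funM; [exact: measurable_fst|exact: measurable_snd].
elim: n => [//|n IH].
apply: measurable_funD.
  exact: (measurableT_comp IH (@measurable_fst_fst n)).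
exact: (measurableT_comp m0 (@measurable_snd_snd n)).
Qed.

Section measurable_comp.
Context d (T : measurableType d) (n : nat).
Implicit Types f g : T -> RN R n.

Lemma measurable_fun_vsub f g : measurable_fun setT f -> measurable_fun setT g ->
  measurable_fun setT (fun x => vsub (f x) (g x)).
Proof.
move=> mf mg; apply: (measurableT_comp (@measurable_vsub n) (g := fun x => (f x, g x))).
exact: measurable_fun_pair.
Qed.

Lemma measurable_fun_vdot f g : measurable_fun setT f -> measurable_fun setT g ->
  measurable_fun setT (fun x => vdot (f x) (g x)).
Proof.
move=> mf mg; apply: (measurableT_comp (@measurable_vdot n) (g := fun x => (f x, g x))).
exact: measurable_fun_pair.
Qed.
End measurable_comp.

(** The image of Lebesgue measure under y -> x - y agrees with it on the intervals ]a, b], whose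
    preimages are [x - b, x - a[, hence everywhere by uniqueness. *)
Lemma ge0_integral_reflect1 (x : R) (F : measurableTypeR R -> \bar R) :
  measurable_fun setT F -> (forall y, 0 <= F y)%E ->
  (\int[mu]_y F (x - y)%R = \int[mu]_y F y)%E.
Proof.
move=> mF F0.
have mphi : measurable_fun setT (fun y : measurableTypeR R => (x - y)%R : measurableTypeR R).
  by apply: measurable_funB => //; exact: measurable_id.
rewrite -[LHS](@ge0_integral_pushforward _ _ _ _ _ (fun y : measurableTypeR R => (x - y)%R : measurableTypeR R) mphi mu setT F)//.
apply: eq_measure_integral => A mA _.
apply/esym/lebesgue_measure_unique => // _ [[a b] _ <-].
rewrite /= /pushforward.
rewrite (_ : _ @^-1` _ = `[x - b, x - a[%classic); last first.
  by apply/seteqP; split => y /=; rewrite !in_itv/=; lra.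
rewrite !lebesgue_measure_itv/= !lte_fin -!EFinD ltrD2l ltrN2.
by case: ifPn => // _; congr (_%:E); ring.
Qed.

(** Coordinatewise, by Tonelli. This is the one spatial change of variables of the proof: it serves
    in convolutions and, with [x] the origin, as the reflection that removes odd parts. *)
Lemma ge0_integral_reflect n (x : RN R n) (F : RN R n -> \bar R) :
  measurable_fun setT F -> (forall y, 0 <= F y)%E ->
  (\int[lebN R n]_y F (vsub x y) = \int[lebN R n]_y F y)%E.
Proof.
elim: n x F => [|n IH] x F mF F0; first exact: (ge0_integral_reflect1 x mF F0).
have mv : measurable_fun setT (fun y : RN R n.+1 => vsub x y).
  by apply: measurable_fun_vsub => //; exact: measurable_id.
rewrite [LHS](@fubini_tonelli1 _ _ _ _ _ (lebSF n) mu)//; last exact: measurableT_comp.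
rewrite [RHS](@fubini_tonelli1 _ _ _ _ _ (lebSF n) mu)//.
have mG : measurable_fun setT (fun y => \int[mu]_z F (y, z))%E.
  exact: (@measurable_fun_fubini_tonelli_F _ _ _ _ _ mu F).
rewrite /fubini_F -[RHS](IH x.1)//; last by move=> y; exact: integral_ge0.
apply: eq_integral => y _ /=.
apply: (ge0_integral_reflect1 x.2 (F := fun z => F (vsub x.1 y, z))) => //.
by apply: measurableT_comp => //; exact: measurable_fun_pair.
Qed.

Lemma Rintegral_reflect n (x : RN R n) (F : RN R n -> R) : measurable_fun setT F ->
  Rintegral (lebN R n) setT (fun y => F (vsub x y)) = Rintegral (lebN R n) setT F.
Proof.
move=> /measurable_EFinP mF.
rewrite /Rintegral [in LHS]integralE [in RHS]integralE.
rewrite -/(EFin \o F) -[X in (X^\+)%E]/((EFin \o F) \o vsub x) -[X in (X^\-)%E]/((EFin \o F) \o vsub x).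
rewrite funepos_comp funeneg_comp /=.
rewrite (@ge0_integral_reflect n x ((EFin \o F)^\+)%E)//; last exact: measurable_funepos.
by rewrite (@ge0_integral_reflect n x ((EFin \o F)^\-)%E)//; exact: measurable_funeneg.
Qed.

End EuclidTheory.

(** * Fourier transform of the Gaussian *)

Section Gauss1.
Variable R : realType.

Lemma cvg_EFinT (u : nat -> R) (l : R) : u @ \oo --> l -> (u k)%:E @[k --> \oo] --> l%:E.
Proof. by move=> ul; apply: cvg_EFin; [exact: nearW|exact: ul]. Qed.

Local Notation mu := (@lebesgue_measure R).
Implicit Types b z x : R.

(** The fundamental theorem on [-(k+1), k+1], then dominated convergence with |f| as the bound. *)
Lemma integral_derive0 (f F : R -> R) :
  continuous f -> (forall x, is_derive x 1 F (f x)) ->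
  mu.-integrable setT (EFin \o f) ->
  F k.+1%:R @[k --> \oo] --> (0 : R) -> F (- k.+1%:R) @[k --> \oo] --> (0 : R) ->
  (\int[mu]_x (f x)%:E = 0)%E.
Proof.
move=> cf dF intf F1 F2.
have FTC k : (\int[mu]_(x in `[(- k.+1%:R)%R, k.+1%:R]) (f x)%:E = (F k.+1%:R - F (- k.+1%:R)%R)%:E)%E.
  rewrite (@continuous_FTC2 _ f F)//; first by rewrite ltrN2 || by rewrite gtrN.
  - exact: continuous_subspaceT.
  - have dFx x : derivable F x 1 by have [] := dF x.
    have cF : continuous F by move=> x; apply/differentiable_continuous/derivable1_diffP.
    by split=> [x _||]; [exact: dFx|apply: cvg_at_right_filter; exact: cF|apply: cvg_at_left_filter; exact: cF].
  - by move=> x _; rewrite derive1E; have [] := dF x.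
have lim0 : (\int[mu]_(x in `[(- k.+1%:R)%R, k.+1%:R]) (f x)%:E)%E @[k --> \oo] --> 0%E.
  under eq_fun do rewrite FTC.
  by apply: cvg_EFinT; rewrite -(subrr 0); exact: (cvgB F1 F2).
suff lim1 : (\int[mu]_(x in `[(- k.+1%:R)%R, k.+1%:R]) (f x)%:E)%E @[k --> \oo] --> (\int[mu]_x (f x)%:E)%E.
  exact: (cvg_unique _ lim1 lim0).
rewrite [X in X @ _ --> _](_ : _ = fun k => (\int[mu]_x (((fun x => (f x)%:E) \_ `[(- k.+1%:R)%R, k.+1%:R]) x))%E); last first.
  by apply/funext => k; rewrite integral_mkcond.
have mf : measurable_fun setT (EFin \o f) by exact: measurable_int intf.
apply: (@dominated_cvg _ _ _ mu setT measurableT _ _ (fun x => `|(f x)%:E|)%E) => //.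
- move=> k; apply/(measurable_restrictT _ _).1 => //.
  exact: measurable_funTS.
- move=> x _; apply: cvg_near_cst; near=> k.
  rewrite patchE mem_set//= in_itv/= -ler_norml.
  rewrite -nat1r; apply: ler_wpDl => //.
  near: k; exact: nbhs_infty_ger.
- exact: integrable_abse.
- move=> k x _; rewrite patchE; case: ifPn => //; rewrite abse0 //.
Unshelve. all: end_near. Qed.

(** Read off the normal density of mean 0 and variance 1/(2b), a constant multiple of this
    Gaussian. *)
Lemma gauss_integral1 b : 0 < b ->
  (\int[mu]_x (expR (- b * (x * x)))%:E = (Num.sqrt (pi / b))%:E)%E /\
  mu.-integrable setT (EFin \o (fun x => expR (- b * (x * x)))).
Proof.
move=> b0; pose sg := Num.sqrt (1 / (2 * b)).
have sg2 : sg ^+ 2 = 1 / (2 * b) by rewrite sqr_sqrtr// divr_ge0// mulr_ge0// ltW.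
have sg0 : sg != 0 by rewrite gt_eqF// sqrtr_gt0 divr_gt0// mulr_gt0.
have pk : normal_peak sg = (Num.sqrt (pi / b))^-1.
  by rewrite /normal_peak sg2; congr (Num.sqrt _)^-1; rewrite -mulr_natl; field; rewrite gt_eqF.
have nfE x : (Num.sqrt (pi / b)) * normal_pdf 0 sg x = expR (- b * (x * x)).
  rewrite normal_pdfE// pk mulrA divff ?mul1r; last by rewrite gt_eqF// sqrtr_gt0 divr_gt0// pi_gt0.
  by rewrite /normal_fun subr0 sg2; congr expR; rewrite -mulr_natl; field; rewrite gt_eqF.
have intn := integrable_normal_pdf 0 sg.
split.
  under eq_integral do rewrite -nfE EFinM.
  by rewrite integralZl// integral_normal_pdf mule1.
have := integrableZl measurableT (Num.sqrt (pi / b)) intn.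
by apply: eq_integrable => // x _; rewrite /= -EFinM nfE.
Qed.

Lemma integrable_ler d (T : measurableType d) (m : {measure set T -> \bar R}) (f g : T -> R) :
  measurable_fun setT f -> (forall y, `|f y| <= g y) ->
  m.-integrable setT (EFin \o g) -> m.-integrable setT (EFin \o f).
Proof.
move=> mf fg; apply: le_integrable => //; first exact/measurable_EFinP.
by move=> y _ /=; rewrite lee_fin (le_trans (fg y))// ler_norm.
Qed.

Lemma measurable_cos : measurable_fun [set: R] (@cos R).
Proof. by apply: continuous_measurable_fun; exact: continuous_cos. Qed.
Lemma measurable_sin : measurable_fun [set: R] (@sin R).
Proof. by apply: continuous_measurable_fun; exact: continuous_sin. Qed.

Let e b x := expR (- b * (x * x)).

Let me b : measurable_fun setT (e b).
Proof. by apply: measurableT_comp => //; apply: measurable_funM => //; exact: measurable_funM. Qed.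

Let ie b : 0 < b -> mu.-integrable setT (EFin \o e b).
Proof. by move=> /gauss_integral1[]. Qed.

Let ixe b : 0 < b -> mu.-integrable setT (EFin \o (fun x => `|x| * e b x)).
Proof.
move=> b0; have b20 : 0 < b / 2 by rewrite divr_gt0.
(* Half of the exponent is given up to absorb |x|: by 1 + y <= e^y it suffices that |x| <= (1 +
   2/b)(1 + (b/2) x^2), and the factor 1 + 2/b makes the right-hand side at least 1 + x^2. *)
refine (@integrable_ler _ _ mu (fun x => `|x| * e b x) (fun x => (1 + 2 / b) * e (b / 2) x) _ _ _).
- by apply: measurable_funM; [exact: normr_measurable|exact: me].
- move=> x; rewrite ger0_norm ?mulr_ge0 ?expR_ge0//.
  have -> : e b x = e (b / 2) x * e (b / 2) x by rewrite /e -expRD; congr expR; field.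
  rewrite mulrA ler_pM2r ?expR_gt0//.
  have : 1 + b / 2 * (x * x) <= expR (b / 2 * (x * x)) by exact: expR_ge1Dx.
  rewrite /e mulNr expRN => h.
  have h0 : 0 <= b / 2 * (x * x) by apply: mulr_ge0; [exact: ltW|rewrite -expr2 sqr_ge0].
  rewrite ler_pdivrMr ?expR_gt0//.
  apply: (@le_trans _ _ ((1 + 2 / b) * (1 + b / 2 * (x * x)))); last first.
    by rewrite ler_pM2l// ltr_pwDl// divr_ge0// ltW.
  have -> : (1 + 2 / b) * (1 + b / 2 * (x * x)) = 1 + 2 / b + b / 2 * (x * x) + `|x| * `|x|.
    by rewrite -normrM ger0_norm; [field; rewrite gt_eqF|rewrite -expr2 sqr_ge0].
  have : 0 <= (`|x| - 1) ^+ 2 by rewrite sqr_ge0.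
  have := normr_ge0 x.
  have : 0 <= 2 / b by rewrite divr_ge0// ltW.
  rewrite expr2; nra.
- have := integrableZl measurableT (1 + 2 / b) (ie b20).
  by apply: eq_integrable => // x _.
Qed.

Let icos b z : 0 < b -> mu.-integrable setT (EFin \o (fun x => cos (z * x) * e b x)).
Proof.
move=> b0; refine (@integrable_ler _ _ mu _ (e b) _ _ (ie b0)).
  by apply: measurable_funM; [apply: measurableT_comp => //; exact: measurable_cos|exact: me].
by move=> x; rewrite normrM (ger0_norm (expR_ge0 _)) ler_piMl ?expR_ge0 ?cos_max.
Qed.

Let ixsin b z : 0 < b -> mu.-integrable setT (EFin \o (fun x => - x * sin (z * x) * e b x)).
Proof.
move=> b0; refine (@integrable_ler _ _ mu _ (fun x => `|x| * e b x) _ _ (ixe b0)).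
  apply: measurable_funM; [apply: measurable_funM|exact: me] => //.
  by apply: measurableT_comp => //; exact: measurable_sin.
move=> x; rewrite !normrM (ger0_norm (expR_ge0 _)) normrN.
by rewrite ler_wpM2r ?expR_ge0// ler_piMr ?sin_max.
Qed.

Let dcos b x z : is_derive z 1 (fun z => cos (z * x) * e b x) (- x * sin (z * x) * e b x).
Proof.
apply: is_derive_eq.
rewrite /GRing.scale/=; ring.
Qed.

Let FT b z := (\int[mu]_x (cos (z * x) * e b x))%R.
Let FT' b z := (\int[mu]_x (- x * sin (z * x) * e b x))%R.

Let dFT b z : 0 < b -> is_derive z 1 (FT b) (FT' b z).
Proof.
move=> b0.
have P1 x : partial1of2 (fun z x => cos (z * x) * e b x) z x = - x * sin (z * x) * e b x.
  by rewrite partial1of2E; have [_] := dcos b x z.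
have Iz : `]z - 1, z + 1[%classic z by rewrite /= in_itv/=; apply/andP; split; lra.
have intf (w : R) : `]z - 1, z + 1[%classic w -> mu.-integrable setT (EFin \o (fun x => cos (w * x) * e b x)) by move=> _; exact: icos.
have D x (y : measurableTypeR R) : `]z - 1, z + 1[%classic x -> setT y -> derivable (fun w : R => cos (w * y) * e b y) x 1.
  by move=> _ _; have [] := dcos b y x.
have G0 y : 0 <= `|y| * e b y by rewrite mulr_ge0// expR_ge0.
have ub x (y : measurableTypeR R) : `]z - 1, z + 1[%classic x -> setT y -> `|partial1of2 (fun z x => cos (z * x) * e b x) x y| <= `|y| * e b y.
  move=> _ _; rewrite partial1of2E; have [_ ->] := dcos b y x.
  rewrite !normrM (ger0_norm (expR_ge0 _)) normrN.
  by rewrite ler_wpM2r ?expR_ge0// ler_piMr ?sin_max.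
split.
  exact: (derivable_under_integral measurableT Iz intf D G0 (ixe b0) ub).
rewrite -derive1E (differentiation_under_integral measurableT Iz intf D G0 (ixe b0) ub).
by apply: eq_Rintegral => y _; exact: P1.
Qed.

(** The function sin(z x) exp(-b x^2) vanishes at both ends, so its derivative has integral zero;
    this is the differential equation of the cosine transform. *)
Let FT'E b z : 0 < b -> FT' b z = - (z / (2 * b)) * FT b z.
Proof.
move=> b0.
pose f x := z * (cos (z * x) * e b x) + 2 * b * (- x * sin (z * x) * e b x).
pose F x := sin (z * x) * e b x.
have dF x : is_derive x 1 F (f x).
  rewrite /F /f /e; apply: is_derive_eq.
  rewrite /GRing.scale/=; ring.
have cf : continuous f.
  have ce : continuous (e b).
    move=> x; apply: continuous_comp; last exact: continuous_expR.
    apply: (@continuousM _ _ (fun=> - b) (fun x => x * x)); first exact: cst_continuous.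
    exact: (@continuousM _ _ id id).
  have cl : continuous (fun x => z * x) by move=> x; apply: continuousM; [exact: cst_continuous|].
  move=> x; apply: (@continuousD _ _ _ (fun x => z * (cos (z * x) * e b x)) (fun x => 2 * b * (- x * sin (z * x) * e b x))).
    apply: (@continuousM _ _ (fun=> z) (fun x => cos (z * x) * e b x)); first exact: cst_continuous.
    apply: (@continuousM _ _ (fun x => cos (z * x)) (e b)); last exact: ce.
    by apply: continuous_comp; [exact: cl|exact: continuous_cos].
  apply: (@continuousM _ _ (fun=> 2 * b) (fun x => - x * sin (z * x) * e b x)); first exact: cst_continuous.
  apply: (@continuousM _ _ (fun x => - x * sin (z * x)) (e b)); last exact: ce.
  apply: (@continuousM _ _ (fun x => - x) (fun x => sin (z * x))); first exact: continuousN.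
  by apply: continuous_comp; [exact: cl|exact: continuous_sin].
have I1 := icos z b0; have I2 := ixsin z b0.
have I1' : mu.-integrable setT (EFin \o (fun x => z * (cos (z * x) * e b x))).
  by have := integrableZl measurableT z I1; apply: eq_integrable.
have I2' : mu.-integrable setT (EFin \o (fun x => 2 * b * (- x * sin (z * x) * e b x))).
  by have := integrableZl measurableT (2 * b) I2; apply: eq_integrable.
have fE : \int[mu]_x f x = z * FT b z + 2 * b * FT' b z.
  by rewrite /f RintegralD// !RintegralZl.
have F_lim (s : R) : `|s| = 1 -> F (s * k.+1%:R) @[k --> \oo] --> (0 : R).
  move=> s1; apply/norm_cvg0P.
  apply: (@squeeze_cvgr _ _ _ _ (fun=> 0) (fun k => b^-1 * harmonic k)).
  - near=> k; rewrite normr_ge0/= /F normrM (ger0_norm (expR_ge0 _)).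
    apply: (@le_trans _ _ (e b (s * k.+1%:R))); first by rewrite ler_piMl ?expR_ge0 ?sin_max.
    rewrite /e; have -> : s * k.+1%:R * (s * k.+1%:R) = k.+1%:R ^+ 2 :> R.
      have : s ^+ 2 = 1 by rewrite -real_normK ?num_real// s1 expr1n.
      by move=> s2; rewrite -expr2 exprMn s2 mul1r.
    rewrite mulNr expRN -invfM lef_pV2 ?posrE ?expR_gt0 ?mulr_gt0//.
    apply: le_trans (expR_ge1Dx _).
    apply: ler_wpDl => //; rewrite ler_pM2l// expr2 ler_peMr// ler1n//.
  - exact: cvg_cst.
  - by rewrite -[X in _ --> X](mulr0 b^-1); apply: cvgM; [exact: cvg_cst|exact: cvg_harmonic].
have : (\int[mu]_x (f x)%:E = 0)%E.
  apply: (@integral_derive0 f F cf dF).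
  - by have := integrableD measurableT I1' I2'; apply: eq_integrable.
  - by rewrite (_ : (fun k => _) = fun k => F (1 * k.+1%:R)); [apply: F_lim; rewrite normr1|apply/funext => k; rewrite mul1r].
  - by rewrite (_ : (fun k => _) = fun k => F (-1 * k.+1%:R)); [apply: F_lim; rewrite normrN1|apply/funext => k; rewrite mulN1r].
move=> /(congr1 fine); rewrite -/(Rintegral mu setT f) fE /= => h.
have b20 : 2 * b != 0 by rewrite gt_eqF// mulr_gt0.
apply: (mulfI b20); rewrite (_ : 2 * b * FT' b z = - (z * FT b z)); last by lra.
by field; rewrite gt_eqF.
Unshelve. all: end_near. Qed.

(** By [FT'E] the product with exp(z^2/(4b)) has zero derivative in z, and at z = 0 it is the
    Gaussian integral. *)
Let FTE b z : 0 < b -> FT b z = Num.sqrt (pi / b) * expR (- (z * z) / (4 * b)).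
Proof.
move=> b0.
pose K z := FT b z * expR (z * z / (4 * b)).
have dK (w : R) : is_derive w 1 K 0.
  have d1 := dFT w b0; rewrite FT'E// in d1.
  have d2 : is_derive w 1 (fun z => expR (z * z / (4 * b))) (expR (w * w / (4 * b)) * (w / (2 * b))).
    apply: is_derive_eq; rewrite /GRing.scale/=; field; by rewrite gt_eqF.
  apply: is_derive_eq; rewrite /GRing.scale/=; ring.
have K0 : K z = K 0 by exact: is_derive_0_is_cst.
have : K 0 = Num.sqrt (pi / b).
  rewrite /K mulr0 mul0r expR0 mulr1 /FT /Rintegral.
  have [gi _] := gauss_integral1 b0.
  rewrite (_ : (fun x => _%:E) = (fun x => (expR (- b * (x * x)))%:E)) ?gi//.
  by apply/funext => x; rewrite mul0r cos0 mul1r.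
rewrite -K0 /K => <-.
by rewrite -[RHS]mulrA -expRD mulNr subrr expR0 mulr1.
Qed.

(** Adding the integral to its reflection cancels the sine part and leaves 2 cos th times the cosine
    transform. The phase [th] is what allows iteration over the coordinates. *)
Lemma gauss_fourier1 b z th : 0 < b ->
  (\int[mu]_x (cos (z * x + th) * expR (- b * (x * x))))%R =
  Num.sqrt (pi / b) * expR (- (z * z) / (4 * b)) * cos th.
Proof.
move=> b0.
have mc (w r : R) : measurable_fun setT (fun x : measurableTypeR R => cos (w * x + r) * e b x).
  apply: measurable_funM; last exact: me.
  by apply: measurableT_comp; [exact: measurable_cos|apply: measurable_funD].
have I r : mu.-integrable setT (EFin \o (fun x => cos (z * x + r) * e b x)).
  refine (@integrable_ler _ _ mu _ (e b) (mc _ _) _ (ie b0)).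
  by move=> x; rewrite normrM (ger0_norm (expR_ge0 _)) ler_piMl ?expR_ge0 ?cos_max.
have R1 := @Rintegral_reflect R 0 0 _ (mc z th).
rewrite -FTE// -/(e b).
apply: (mulfI (_ : 2 != 0 :> R)) => //.
rewrite mulr2n mulrDl mul1r -[X in X + _ = _]R1.
rewrite /= -RintegralD//; last first.
  refine (@integrable_ler _ _ mu _ (e b) _ _ (ie b0)).
    apply: (measurableT_comp (mc z th)).
    by apply: (@measurable_fun_vsub R _ _ 0 (cst (0 : R)) id).
  move=> x; rewrite (_ : e b (0 - x) = e b x); last by rewrite /e; congr expR; ring.
  by rewrite normrM (ger0_norm (expR_ge0 _)) ler_piMl ?expR_ge0 ?cos_max.
transitivity (\int[mu]_x ((2 * cos th) * (cos (z * x) * e b x)))%R; last first.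
  by rewrite RintegralZl//; [rewrite -/(FT b z); ring|exact: icos].
apply: eq_Rintegral => x _.
rewrite /e (_ : z * (0 - x) + th = th - z * x); last by ring.
rewrite (_ : (0 - x) * (0 - x) = x * x); last by ring.
rewrite cosB cosD; ring.
Qed.

End Gauss1.

(** * Fubini for integrands dominated by a product g1 x * g2 y *)

Section Fubini.
Variable R : realType.
Context d1 d2 (T1 : measurableType d1) (T2 : measurableType d2).
Variables (m1 : {measure set T1 -> \bar R}) (m2 : {measure set T2 -> \bar R}).
Hypotheses (s1 : sigma_finite setT m1) (s2 : sigma_finite setT m2).
Local Notation m1' := (toSF s1).
Local Notation m2' := (toSF s2).

Lemma ge0_fubini (f : T1 -> T2 -> \bar R) :
  measurable_fun setT (fun z : T1 * T2 => f z.1 z.2) -> (forall x y, 0 <= f x y)%E ->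
  (\int[m1]_x \int[m2]_y f x y = \int[m2]_y \int[m1]_x f x y)%E.
Proof.
by move=> mf f0; exact: (@fubini_tonelli _ _ _ _ _ m1' m2' (fun z => f z.1 z.2) mf (fun z => f0 z.1 z.2)).
Qed.

Lemma measurable_integral_snd (f : T1 -> T2 -> \bar R) :
  measurable_fun setT (fun z : T1 * T2 => f z.1 z.2) -> (forall x y, 0 <= f x y)%E ->
  measurable_fun setT (fun x => \int[m2]_y f x y)%E.
Proof.
by move=> mf f0; exact: (@measurable_fun_fubini_tonelli_F _ _ _ _ _ m2' (fun z => f z.1 z.2) mf (fun z => f0 z.1 z.2)).
Qed.

(** The partial integrals of the positive and negative parts are measurable, and so is [fine];
    divergent integrals just take a default value. *)
Lemma measurable_Rintegral_snd (f : T1 -> T2 -> R) :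
  measurable_fun setT (fun z : T1 * T2 => f z.1 z.2) ->
  measurable_fun setT (fun x => Rintegral m2 setT (f x)).
Proof.
move=> mf; apply: (measurableT_comp (fine_measurable measurableT)).
rewrite [X in measurable_fun _ X](_ : _ = fun x => (\int[m2]_y (fun z : T1 * T2 => (f z.1 z.2)%:E)^\+ (x, y) - \int[m2]_y (fun z : T1 * T2 => (f z.1 z.2)%:E)^\- (x, y))%E); last first.
  apply/funext => x; rewrite integralE; congr (_ - _)%E.
    rewrite (_ : (fun y => (f x y)%:E) = (fun z : T1 * T2 => (f z.1 z.2)%:E) \o pair x)//.
    by rewrite funepos_comp.
  rewrite (_ : (fun y => (f x y)%:E) = (fun z : T1 * T2 => (f z.1 z.2)%:E) \o pair x)//.
  by rewrite funeneg_comp.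
have mE : measurable_fun setT (fun z : T1 * T2 => (f z.1 z.2)%:E) by exact/measurable_EFinP.
apply: emeasurable_funB.
  apply: (@measurable_integral_snd (fun x y => ((fun z : T1 * T2 => (f z.1 z.2)%:E)^\+ (x, y))%E)) => //.
  rewrite (_ : (fun z => _) = ((fun z : T1 * T2 => (f z.1 z.2)%:E)^\+)%E); last by apply/funext => -[].
  exact: measurable_funepos.
apply: (@measurable_integral_snd (fun x y => ((fun z : T1 * T2 => (f z.1 z.2)%:E)^\- (x, y))%E)) => //.
rewrite (_ : (fun z => _) = ((fun z : T1 * T2 => (f z.1 z.2)%:E)^\-)%E); last by apply/funext => -[].
exact: measurable_funeneg.
Qed.

Variables (g1 : T1 -> R) (g2 : T2 -> R).
Hypotheses (g1i : m1.-integrable setT (EFin \o g1)) (g2i : m2.-integrable setT (EFin \o g2)).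

Let mg1 : measurable_fun setT g1. Proof. exact/measurable_EFinP/(measurable_int m1). Qed.
Let mg2 : measurable_fun setT g2. Proof. exact/measurable_EFinP/(measurable_int m2). Qed.

Lemma measurable_tensor : measurable_fun setT (fun z : T1 * T2 => g1 z.1 * g2 z.2).
Proof. by apply: measurable_funM; [exact: (measurableT_comp mg1)|exact: (measurableT_comp mg2)]. Qed.

Lemma integral_tensor_lty :
  (\int[m1]_x \int[m2]_y `|g1 x * g2 y|%:E < +oo)%E.
Proof.
have /integrableP[_ l1] := g1i; have /integrableP[_ l2] := g2i.
rewrite (eq_integral (fun x => `|g1 x|%:E * \int[m2]_y `|g2 y|%:E)%E); last first.
  move=> x _; rewrite -ge0_integralZl_EFin//; last by do 2 apply: measurableT_comp => //.
  by apply: eq_integral => y _; rewrite normrM EFinM.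
rewrite ge0_integralZr//; last 2 first.
  - by do 2 apply: measurableT_comp => //.
  - exact: integral_ge0.
by rewrite lte_mul_pinfty//; [exact: integral_ge0|rewrite ge0_fin_numE//; exact: integral_ge0].
Qed.

Variable f : T1 -> T2 -> R.
Hypothesis mf : measurable_fun setT (fun z : T1 * T2 => f z.1 z.2).
Hypothesis fg : forall x y, `|f x y| <= g1 x * g2 y.

Let g0 x y : 0 <= g1 x * g2 y. Proof. exact: le_trans (fg x y). Qed.

Lemma integrable_prod_le : (m1' \x m2')%E.-integrable setT (fun z => (f z.1 z.2)%:E).
Proof.
apply/integrable12ltyP; first exact/measurable_EFinP.
apply: le_lt_trans integral_tensor_lty.
have mt : measurable_fun setT (fun z : T1 * T2 => `|g1 z.1 * g2 z.2|%:E).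
  by apply/measurable_EFinP; apply: measurableT_comp => //; exact: measurable_tensor.
have mf' : measurable_fun setT (fun z : T1 * T2 => `|f z.1 z.2|%:E).
  by apply/measurable_EFinP; apply: measurableT_comp.
apply: ge0_le_integral => //.
- by move=> x _; exact: integral_ge0.
- exact: (@measurable_integral_snd (fun x y => `|f x y|%:E)).
- exact: (@measurable_integral_snd (fun x y => `|g1 x * g2 y|%:E)).
move=> x _; apply: ge0_le_integral => //.
- exact: (measurableT_comp mf' (measurable_pair1 x)).
- exact: (measurableT_comp mt (measurable_pair1 x)).
by move=> y _; rewrite lee_fin (ger0_norm (g0 _ _)).
Qed.

Lemma integrable_snd_le x : m2.-integrable setT (EFin \o f x).
Proof.
apply: (@integrable_ler R _ _ m2 _ (fun y => g1 x * g2 y)).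
- exact: (measurableT_comp mf (measurable_pair1 x)).
- exact: fg.
- by have := integrableZl measurableT (g1 x) g2i; apply: eq_integrable.
Qed.

Lemma integrable_fst_le y : m1.-integrable setT (EFin \o f^~ y).
Proof.
apply: (@integrable_ler R _ _ m1 _ (fun x => g1 x * g2 y)).
- exact: (measurableT_comp mf (measurable_pair2 y)).
- by move=> x; exact: fg.
- by have := integrableZr measurableT (g2 y) g1i; apply: eq_integrable.
Qed.

Lemma Rintegral_fubini :
  Rintegral m1 setT (fun x => Rintegral m2 setT (f x)) =
  Rintegral m2 setT (fun y => Rintegral m1 setT (f^~ y)).
Proof.
have := @Fubini _ _ _ _ _ m1' m2' _ integrable_prod_le => /= F.
rewrite /Rintegral; congr fine.
rewrite (eq_integral (fun x => \int[m2]_y (f x y)%:E)%E); last by move=> x _; rewrite fineK//; exact: (integrable_fin_num measurableT (integrable_snd_le _)).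
rewrite [RHS](eq_integral (fun y => \int[m1]_x (f x y)%:E)%E)// => y _.
by rewrite fineK//; exact: (integrable_fin_num measurableT (integrable_fst_le _)).
Qed.

Lemma Rintegral_prod :
  fine (\int[(m1 \x m2)%E]_z (f z.1 z.2)%:E) =
  Rintegral m1 setT (fun x => Rintegral m2 setT (f x)).
Proof.
have := @integral12_prod_meas1 _ _ _ _ _ m1' m2' _ integrable_prod_le => /= F.
rewrite /Rintegral; congr fine.
rewrite [RHS](eq_integral (fun x => \int[m2]_y (f x y)%:E)%E) => [|x _]; first by rewrite -F.
by rewrite fineK//; exact: (integrable_fin_num measurableT (integrable_snd_le _)).
Qed.

Lemma integrable_Rintegral_snd : m1.-integrable setT (EFin \o (fun x => Rintegral m2 setT (f x))).
Proof.
apply: (@integrable_ler R _ _ m1 _ (fun x => g1 x * Rintegral m2 setT g2)).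
- exact: measurable_Rintegral_snd.
- move=> x; apply: (le_trans (le_normr_Rintegral measurableT (integrable_snd_le x))) => //.
  rewrite -RintegralZl//; apply: le_Rintegral => //.
  + exact: (integrable_norm (integrable_snd_le x)).
  + by have := integrableZl measurableT (g1 x) g2i; apply: eq_integrable.
- by have := integrableZr measurableT (Rintegral m2 setT g2) g1i; apply: eq_integrable.
Qed.
End Fubini.

(** * Algebra of R^N and Gaussian integrals by induction on the dimension *)

Section EuclidAlgebra.
Variable R : realType.
Local Notation mu := (@lebesgue_measure R).
Local Notation leb n := (lebN R n).

Fixpoint vzero (n : nat) : RN R n :=
  match n return RN R n with 0%N => (0 : R) | m.+1 => (vzero m, 0 : R) end.

Lemma vdot_ge0 n (x : RN R n) : 0 <= vdot x x.
Proof.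
elim: n x => [x|n IH x]; first by rewrite /= -expr2 sqr_ge0.
by rewrite /= addr_ge0// -expr2 sqr_ge0.
Qed.

Lemma vdotC n (x y : RN R n) : vdot x y = vdot y x.
Proof. by elim: n x y => [x y|n IH x y] /=; [exact: mulrC|congr +%R; [exact: IH|exact: mulrC]]. Qed.

Lemma vdotBr n (x y z : RN R n) : vdot x (vsub y z) = vdot x y - vdot x z.
Proof. by elim: n x y z => [x y z|n IH x y z] /=; rewrite ?IH; ring. Qed.

Lemma vdotBl n (x y z : RN R n) : vdot (vsub y z) x = vdot y x - vdot z x.
Proof. by rewrite vdotC vdotBr !(vdotC x). Qed.

Lemma vdot0 n (x : RN R n) : vdot x (vzero n) = 0.
Proof. by elim: n x => [x|n IH x] /=; rewrite ?IH; ring. Qed.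

Lemma vdot0l n (x : RN R n) : vdot (vzero n) x = 0.
Proof. by rewrite vdotC vdot0. Qed.

Lemma vsub_subK n (x w : RN R n) : vsub x (vsub x w) = w.
Proof.
elim: n x w => [x w|n IH x [w1 w2]] /=; first by rewrite (_ : (x : R) - (x - w) = w)//; ring.
by rewrite IH; congr pair; rewrite opprB addrC subrK.
Qed.

Lemma vsub_subAC n (x w z : RN R n) : vsub (vsub x w) z = vsub (vsub x z) w.
Proof.
elim: n x w z => [x w z|n IH x w z] /=; first by rewrite (_ : (x : R) - w - z = x - z - w)//; ring.
by rewrite IH; congr pair; ring.
Qed.

Lemma vdot_vsub_sq n (x y : RN R n) :
  vdot (vsub x y) (vsub x y) = vdot x x - 2 * vdot x y + vdot y y.
Proof. rewrite !(vdotBl, vdotBr) (vdotC y x); ring. Qed.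

(** In each coordinate it follows from th (|a| - |b|/th)^2 >= 0; the coordinates are then added
    up. *)
Lemma vdot_young n (th : R) (x y : RN R n) : 0 < th ->
  2 * `|vdot x y| <= th * vdot x x + th^-1 * vdot y y.
Proof.
move=> th0; have H (a b : R) : 2 * `|a * b| <= th * (a * a) + th^-1 * (b * b).
  rewrite normrM -[a * a]/(a ^+ 2) -[b * b]/(b ^+ 2) -[a ^+ 2]real_normK ?num_real// -[b ^+ 2]real_normK ?num_real//.
  rewrite -subr_ge0 (_ : _ - _ = th * (`|a| - th^-1 * `|b|) ^+ 2); last by field; rewrite gt_eqF.
  by rewrite mulr_ge0 ?sqr_ge0// ltW.
elim: n x y => [x y|n IH x y]; first exact: H.
have h1 := IH x.1 y.1; have h2 := H x.2 y.2 => /=.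
have := ler_normD (vdot x.1 y.1) (x.2 * y.2); lra.
Qed.

Lemma measurable_vdotr n (z : RN R n) : measurable_fun setT (vdot z : RN R n -> R).
Proof. exact: (@measurable_fun_vdot R _ _ n (cst z) id). Qed.

Lemma measurable_sqn n : measurable_fun setT (fun x : RN R n => vdot x x).
Proof. exact: (@measurable_fun_vdot R _ _ n id id). Qed.

Section succ.
Variables (n : nat) (f : RN R n.+1 -> R) (g1 : RN R n -> R) (g2 : measurableTypeR R -> R).
Hypotheses (g1i : (leb n).-integrable setT (EFin \o g1)) (g2i : mu.-integrable setT (EFin \o g2)).
Hypothesis mf : measurable_fun setT f.
Hypothesis fg : forall z, `|f z| <= g1 z.1 * g2 z.2.

Let f2 (x : RN R n) (y : measurableTypeR R) := f (x, y).
Let mf2 : measurable_fun setT (fun z : RN R n * measurableTypeR R => f2 z.1 z.2).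
Proof. by rewrite (_ : (fun z => _) = f)//; apply/funext => -[]. Qed.
Let fg2 x y : `|f2 x y| <= g1 x * g2 y. Proof. exact: (fg (x, y)). Qed.
Let sfm := @sigma_finiteT _ _ _ mu.

Lemma integrable_lebNS : (leb n.+1).-integrable setT (EFin \o f).
Proof.
have := @integrable_prod_le R _ _ _ _ _ _ (@lebN_sigma_finite R n) sfm _ _ g1i g2i f2 mf2 fg2.
rewrite (_ : (fun z => _) = EFin \o f)//; last by apply/funext => -[].
Qed.

Lemma Rintegral_lebNS :
  Rintegral (leb n.+1) setT f = Rintegral (leb n) setT (fun x => Rintegral mu setT (fun y => f (x, y))).
Proof.
have <- := @Rintegral_prod R _ _ _ _ _ _ (@lebN_sigma_finite R n) sfm _ _ g1i g2i f2 mf2 fg2.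
by rewrite /Rintegral; congr fine; apply: eq_integral => -[].
Qed.
End succ.

Lemma gauss_integrable n (b : R) : 0 < b ->
  (leb n).-integrable setT (EFin \o (fun x => expR (- b * vdot x x))).
Proof.
move=> b0; have [_ h1] := gauss_integral1 b0.
elim: n => [//|n IH]; apply: (integrable_lebNS IH h1).
  by apply: measurableT_comp => //; apply: measurable_funM => //; exact: measurable_sqn.
by move=> z /=; rewrite ger0_norm ?expR_ge0// -expRD -mulrDr.
Qed.

Lemma measurable_gauss n b : measurable_fun setT (fun x : RN R n => expR (- b * vdot x x)).
Proof. by apply: measurableT_comp => //; apply: measurable_funM => //; exact: measurable_sqn. Qed.

Lemma measurable_cosd n (z : RN R n) th : measurable_fun setT (fun x : RN R n => cos (vdot z x + th)).
Proof.
apply: measurableT_comp; first exact: measurable_cos.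
by apply: measurable_funD => //; exact: measurable_vdotr.
Qed.

(** The integral over the last coordinate treats the remaining scalar product plus [th] as its phase
    and returns the cosine of that phase, which is the integrand one dimension lower. *)
Lemma gauss_fourier n (z : RN R n) (b th : R) : 0 < b ->
  Rintegral (leb n) setT (fun x => cos (vdot z x + th) * expR (- b * vdot x x)) =
  Num.sqrt (pi / b) ^+ n.+1 * expR (- vdot z z / (4 * b)) * cos th.
Proof.
move=> b0; elim: n z th => [|n IH] z th; first by rewrite expr1; exact: gauss_fourier1.
have [_ h1] := gauss_integral1 b0.
rewrite (Rintegral_lebNS (gauss_integrable n b0) h1); last 2 first.
- by apply: measurable_funM; [exact: measurable_cosd|exact: measurable_gauss].
- move=> x /=; rewrite normrM [X in _ * X]ger0_norm ?expR_ge0// -expRD -mulrDr.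
  by rewrite ler_piMl ?expR_ge0// cos_max.
transitivity (Rintegral (leb n) setT (fun x => (Num.sqrt (pi / b) * expR (- (z.2 * z.2) / (4 * b))) *
    (cos (vdot z.1 x + th) * expR (- b * vdot x x)))).
  apply: eq_Rintegral => x _ /=.
  transitivity (\int[mu]_y (expR (- b * vdot x x) * (cos (z.2 * y + (vdot z.1 x + th)) * expR (- b * (y * y)))))%R.
    apply: eq_Rintegral => y _; rewrite mulrDr expRD addrA (addrC (z.2 * y)); ring.
  rewrite RintegralZl// ?gauss_fourier1//; first ring.
  apply: (@integrable_ler R _ _ mu _ (fun y => expR (- b * (y * y)))) => //.
  - apply: measurable_funM; [exact: (@measurable_cosd 0 z.2)|exact: (@measurable_gauss 0 b)].
  - by move=> y; rewrite normrM (ger0_norm (expR_ge0 _)) ler_piMl ?expR_ge0 ?cos_max.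
rewrite RintegralZl//; last first.
  apply: (@integrable_ler R _ _ _ _ (fun x => expR (- b * vdot x x))).
  - by apply: measurable_funM; [exact: measurable_cosd|exact: measurable_gauss].
  - by move=> y; rewrite normrM (ger0_norm (expR_ge0 _)) ler_piMl ?expR_ge0 ?cos_max.
  - exact: gauss_integrable.
rewrite IH [in RHS]exprS.
rewrite (_ : - vdot z z / (4 * b) = - vdot z.1 z.1 / (4 * b) + - (z.2 * z.2) / (4 * b)); last first.
  by rewrite -mulrDl -opprD.
rewrite expRD; ring.
Qed.

Lemma gauss_integral n b : 0 < b ->
  Rintegral (leb n) setT (fun x => expR (- b * vdot x x)) = Num.sqrt (pi / b) ^+ n.+1.
Proof.
move=> b0; have := gauss_fourier (vzero n) 0 b0.
rewrite vdot0 oppr0 mul0r expR0 cos0 !mulr1 => <-.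
by apply: eq_Rintegral => x _; rewrite vdot0l addr0 cos0 mul1r.
Qed.

End EuclidAlgebra.

(** * Fourier representation of the heat kernel *)

Section StableSymbol.
Variable R : realType.
Local Notation mu := (@lebesgue_measure R).
Local Notation leb n := (lebN R n).
Variable s : R.
Hypothesis s01 : 0 < s < 1.

Let s0 : 0 < s. Proof. by case/andP: s01. Qed.

Lemma measurable_stable n t :
  measurable_fun setT (fun x : RN R n => expR (- t * powR (vdot x x) s)).
Proof.
apply: measurableT_comp => //; apply: measurable_funM => //.
by apply: (measurableT_comp (measurable_powR s)); exact: measurable_sqn.
Qed.

Lemma integrable_oneDsqrV : mu.-integrable setT (EFin \o (fun x : R => (1 + x ^+ 2)^-1)).
Proof.
have c1 : continuous (fun x : R => (1 + x ^+ 2)^-1) := @continuous_oneDsqrV R.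
have p1 (x : R) : 0 <= (1 + x ^+ 2)^-1 by rewrite invr_ge0 addr_ge0// sqr_ge0.
apply/integrableP; split; first by apply/measurable_EFinP; exact: continuous_measurable_fun.
under eq_integral do rewrite /= ger0_norm//.
rewrite ge0_symfun_integralT//; last by move=> x /=; rewrite sqrrN.
rewrite (_ : [set x | 0 <= x] = `[0, +oo[%classic); last first.
  by apply/seteqP; split => x /=; rewrite in_itv/= andbT.
by rewrite (@integral0y_oneDsqr R) -EFinM ltry.
Qed.

Lemma stable_integrable1 t : 0 < t -> mu.-integrable setT (EFin \o (fun x : R => expR (- t * powR (x * x) s))).
Proof.
move=> t0.
(* Since s (K+1) >= 1, the term of order K+1 of the exponential series is at least a w for w = x^2
   >= 1, so the integrand decays at least like 1/(1 + x^2). *)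
pose K := Num.truncn (s^-1).
have Ks : 1 <= s * K.+1%:R.
  by rewrite -ler_pdivrMl// mulr1; exact/ltW/truncnS_gt.
pose a := t ^+ K.+1 / K.+1`!%:R.
have a0 : 0 < a by rewrite divr_gt0 ?exprn_gt0// ltr0n fact_gt0.
apply: (@integrable_ler R _ _ mu _ (fun x => (2 + a^-1) * (1 + x ^+ 2)^-1)).
- exact: (@measurable_stable 0 t).
- move=> x; rewrite ger0_norm ?expR_ge0// mulNr expRN ler_pdivlMr ?ltr_pwDl ?sqr_ge0//.
  rewrite mulrC ler_pdivrMr ?expR_gt0//.
  have w0 : 0 <= x * x by rewrite -expr2 sqr_ge0.
  rewrite expr2; move: w0; set w := x * x => w0.
  have y0 : 0 <= t * powR w s by rewrite mulr_ge0 ?powR_ge0// ltW.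
  have E1 := expR_ge1Dxn K y0.
  have ai : a * a^-1 = 1 by rewrite divff// gt_eqF.
  have ai0 : 0 < a^-1 by rewrite invr_gt0.
  have [w1|w1] := leP w 1.
    have E2 : 1 <= expR (t * powR w s) by rewrite -expR0 ler_expR.
    nra.
  have E3 : a * w <= (t * powR w s) ^+ K.+1 / K.+1`!%:R.
    rewrite exprMn /a mulrAC ler_pM2r ?invr_gt0 ?ltr0n ?fact_gt0// ler_pM2l ?exprn_gt0//.
    rewrite -powR_mulrn ?powR_ge0// -powRrM -[leLHS]powRr1//.
    by apply: ler_powR => //; exact: ltW.
  have E4 : 1 + a * w <= expR (t * powR w s) by apply: le_trans E1; rewrite lerD2l.
  apply: (@le_trans _ _ ((2 + a^-1) * (1 + a * w))); first by nra.
  by rewrite ler_pM2l// addr_gt0.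
- by have := integrableZl measurableT (2 + a^-1) integrable_oneDsqrV; apply: eq_integrable.
Qed.

(** Powers are monotone, so (u + v)^s >= (u^s + v^s)/2 and half of [t] can be given to each factor
    of a product majorant. *)
Lemma stable_integrable n t : 0 < t ->
  (leb n).-integrable setT (EFin \o (fun x => expR (- t * powR (vdot x x) s))).
Proof.
elim: n t => [|n IH] t t0; first exact: stable_integrable1.
have t20 : 0 < t / 2 by rewrite divr_gt0.
apply: (integrable_lebNS (IH _ t20) (stable_integrable1 t20)); first exact: measurable_stable.
move=> z; rewrite ger0_norm ?expR_ge0// -expRD ler_expR /=.
have z1 := vdot_ge0 z.1; have z2 : 0 <= z.2 * z.2 by rewrite -expr2 sqr_ge0.
have H (u v : R) : 0 <= u -> 0 <= v -> powR u s <= powR (u + v) s.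
  by move=> u0 v0; apply: ge0_ler_powR; rewrite ?nnegrE ?addr_ge0 ?lerDl// ltW.
have h1 := H _ _ z1 z2; have := H _ _ z2 z1; rewrite addrC => h2.
rewrite -mulrDr mulNr mulNr lerN2 -mulrA ler_pM2l//; lra.
Qed.

End StableSymbol.

Section HeatKernel.
Variable R : realType.
Variables (n : nat) (s : R).
Hypothesis s01 : 0 < s < 1.
Local Notation leb := (lebN R n).
Local Notation RN := (RN R n).

(** The Fourier multiplier of e^{-tL}. Its Gaussian factor is kept apart because it later serves as
    the damping weight in the positivity test. *)
Definition symbol (t : R) (x : RN) : R := expR (- t * vdot x x) * expR (- t * powR (vdot x x) s).

Lemma measurable_symbol t : measurable_fun setT (symbol t).
Proof. by apply: measurable_funM; [exact: measurable_gauss|exact: measurable_stable]. Qed.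

Lemma symbol_ge0 t x : 0 <= symbol t x.
Proof. by rewrite mulr_ge0 ?expR_ge0. Qed.

Lemma symbol_le1 t x : 0 <= t -> symbol t x <= 1.
Proof.
move=> t0; rewrite /symbol -expRD -expR0 ler_expR -mulrDr mulNr oppr_le0.
by rewrite mulr_ge0// addr_ge0 ?powR_ge0 ?vdot_ge0.
Qed.

Lemma symbol_integrable t : 0 < t -> leb.-integrable setT (EFin \o symbol t).
Proof.
move=> t0; apply: (@integrable_ler R _ _ _ _ (fun x => expR (- t * vdot x x))).
- exact: measurable_symbol.
- move=> x; rewrite ger0_norm ?symbol_ge0// ler_piMr ?expR_ge0// -expR0 ler_expR mulNr oppr_le0.
  by rewrite mulr_ge0 ?powR_ge0// ltW.
- exact: gauss_integrable.
Qed.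

(** Insert the cosine integral for [frac_heat_kernel], exchange the integrals and reflect about z: a
    Gaussian cosine transform with phase -z.y remains. For b = 1/(4t) its factor sqrt(pi/b)^N
    cancels (4 pi t)^(-N/2), and its exponential is exp(-t|y|^2). *)
Lemma heat_kernelE t z : 0 < t -> heat_kernel s t z =
  (2 * pi) ^- n.+1 * Rintegral leb setT (fun x => cos (vdot z x) * symbol t x).
Proof.
move=> t0; have sf := @lebN_sigma_finite R n.
(* An opaque name for [pi], so that the algebra below treats it as an atom. *)
have [p piE] : exists p : R, p = pi by exists pi.
have p0 : 0 < p by rewrite piE pi_gt0.
rewrite /heat_kernel /frac_heat_kernel -piE.
pose b := (4 * t)^-1; have b0 : 0 < b by rewrite invr_gt0 mulr_gt0.
pose g1 (x : RN) := expR (- b * vdot (vsub z x) (vsub z x)).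
pose g2 (y : RN) := (2 * p) ^- n.+1 * expR (- t * powR (vdot y y) s).
pose F (x y : RN) := g1 x * (cos (vdot x y) * g2 y).
have mvz : measurable_fun setT (fun x : RN => vsub z x) by exact: (@measurable_fun_vsub R _ _ n (cst z) id).
have mg1 : measurable_fun setT g1 by exact: (measurableT_comp (@measurable_gauss R n b) mvz).
have p20 : 0 <= (2 * p : R) ^- n.+1 by rewrite invr_ge0 exprn_ge0// mulr_ge0// ltW.
have mg2 : measurable_fun setT g2 by apply: measurable_funM => //; exact: measurable_stable.
have ig2 : leb.-integrable setT (EFin \o g2).
  by have := integrableZl measurableT ((2 * p) ^- n.+1) (stable_integrable s01 n t0); apply: eq_integrable.
have ig1 : leb.-integrable setT (EFin \o g1).
  have /integrableP[mg ig] := @gauss_integrable R n b b0.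
  apply/integrableP; split; first exact/measurable_EFinP.
  rewrite (le_lt_trans _ ig)//.
  rewrite -(@ge0_integral_reflect R n z (fun y => `|(EFin \o (fun x => expR (- b * vdot x x))) y|)%E)//.
  exact: measurableT_comp.
have g10 x : 0 <= g1 x by exact: expR_ge0.
have g20 x : 0 <= g2 x by rewrite mulr_ge0 ?expR_ge0.
have mF : measurable_fun setT (fun w : RN * RN => F w.1 w.2).
  apply: measurable_funM; first exact: (measurableT_comp mg1).
  apply: measurable_funM; last exact: (measurableT_comp mg2).
  by apply: measurableT_comp; [exact: measurable_cos|exact: measurable_vdot].
have bF x y : `|F x y| <= g1 x * g2 y.
  rewrite normrM normrM (ger0_norm (g10 _)) (ger0_norm (g20 _)) ler_wpM2l//.
  by rewrite ler_piMl ?cos_max.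
have FF := Rintegral_fubini sf sf ig1 ig2 mF bF.
have four0 : 0 < 4 :> R by [].
have c0 : 0 < 4 * p * t := mulr_gt0 (mulr_gt0 four0 p0) t0.
transitivity (powR (4 * p * t) (- (n.+1%:R / 2)) * Rintegral leb setT (fun x => Rintegral leb setT (F x))).
  apply: (congr1 (fun w => powR (4 * p * t) (- (n.+1%:R / 2)) * w)).
  apply: eq_Rintegral => x _.
  transitivity (Rintegral leb setT (fun y => (g1 x * (2 * p) ^- n.+1) * (cos (vdot x y) * expR (- t * powR (vdot y y) s)))).
    have -> : expR (- vdot (vsub z x) (vsub z x) / (4 * t)) = g1 x.
      by rewrite /g1 /b; congr expR; rewrite mulNr mulNr mulrC.
    rewrite RintegralZl; [exact: mulrA|exact: measurableT|].
    apply: (@integrable_ler R _ _ _ _ (fun y => expR (- t * powR (vdot y y) s))).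
    - apply: measurable_funM; last exact: measurable_stable.
      by apply: measurableT_comp; [exact: measurable_cos|exact: measurable_vdotr].
    - by move=> y; rewrite normrM (ger0_norm (expR_ge0 _)) ler_piMl ?expR_ge0 ?cos_max.
    - exact: stable_integrable.
  by apply: eq_Rintegral => y _; rewrite /F /g2; ring.
rewrite FF -RintegralZl; [|exact: measurableT|].
2: {
  have mF' : measurable_fun setT (fun w : RN * RN => F w.2 w.1) by exact: (measurableT_comp mF (@measurable_swap _ _ _ _)).
  have bF' y x : `|F x y| <= g2 y * g1 x by rewrite mulrC; exact: bF.
  exact: (integrable_Rintegral_snd sf ig2 ig1 mF' bF'). }
rewrite -RintegralZl; [|exact: measurableT|].
2: {
  apply: (@integrable_ler R _ _ _ _ (symbol t)).
  - apply: measurable_funM; last exact: measurable_symbol.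
    by apply: measurableT_comp; [exact: measurable_cos|exact: measurable_vdotr].
  - by move=> y; rewrite normrM (ger0_norm (symbol_ge0 _ _)) ler_piMl ?symbol_ge0 ?cos_max.
  - exact: symbol_integrable. }
apply: eq_Rintegral => y _.
rewrite /F -(@Rintegral_reflect R n z); last first.
  apply: measurable_funM; first exact: mg1.
  apply: measurable_funM; last exact: measurable_cst.
  by apply: measurableT_comp; [exact: measurable_cos|exact: (@measurable_fun_vdot R _ _ n id (cst y))].
have -> : Rintegral leb setT (fun w => g1 (vsub z w) * (cos (vdot (vsub z w) y) * g2 y)) =
    Rintegral leb setT (fun w => g2 y * (cos (vdot y w + (- vdot z y)) * expR (- b * vdot w w))).
  by apply: eq_Rintegral => w _; rewrite /g1 vsub_subK vdotBl -cosN opprB (vdotC w y); ring.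
rewrite RintegralZl; [|exact: measurableT|].
2: {
  apply: (@integrable_ler R _ _ _ _ (fun w => expR (- b * vdot w w))).
  - by apply: measurable_funM; [exact: measurable_cosd|exact: measurable_gauss].
  - by move=> w; rewrite normrM (ger0_norm (expR_ge0 _)) ler_piMl ?expR_ge0 ?cos_max.
  - exact: gauss_integrable. }
rewrite gauss_fourier; [|exact: b0]; rewrite -piE cosN /g2 /symbol.
have -> : powR (4 * p * t) (- (n.+1%:R / 2)) = (Num.sqrt (p / b) ^+ n.+1)^-1.
  rewrite powRN /b invrK (_ : p * (4 * t) = 4 * p * t); last by ring.
  have -> : Num.sqrt (4 * p * t) ^+ n.+1 = powR (4 * p * t) (n.+1%:R / 2).
    rewrite -powR12_sqrt; [|exact: ltW].
    rewrite -powR_mulrn; [|exact: powR_ge0].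
    by rewrite -powRrM; congr powR; exact: mulrC.
  by [].
have -> : - vdot y y / (4 * b) = - t * vdot y y.
  by rewrite /b; field; rewrite gt_eqF.
have : Num.sqrt (p / b) ^+ n.+1 != 0.
  by apply: expf_neq0; apply: lt0r_neq0; rewrite sqrtr_gt0; exact: divr_gt0.
move: (Num.sqrt (p / b) ^+ n.+1) ((2 * p) ^- n.+1) (expR (- t * vdot y y))
  (expR (- t * powR (vdot y y) s)) (cos (vdot z y)) => Q c e1 e2 c1 Q0.
by field.
Qed.

End HeatKernel.

(** * Positivity of the heat kernel *)

Lemma fine_cvg_seq (R : realType) (u : nat -> \bar R) (l : \bar R) : l \is a fin_num ->
  u @ \oo --> l -> fine (u k) @[k --> \oo] --> fine l.
Proof. by move=> lf ul; apply: fine_cvg; rewrite fineK. Qed.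

Lemma Rintegral_dominated_cvg (R : realType) d (T : measurableType d) (m : {measure set T -> \bar R})
    (f_ : nat -> T -> R) (f g : T -> R) :
  (forall k, measurable_fun setT (f_ k)) ->
  (forall x, f_ ^~ x @ \oo --> f x) ->
  (forall k x, `|f_ k x| <= g x) ->
  m.-integrable setT (EFin \o g) ->
  m.-integrable setT (EFin \o f) /\ Rintegral m setT (f_ k) @[k --> \oo] --> Rintegral m setT f.
Proof.
move=> mf ff fg ig.
have mlim : measurable_fun setT f by apply: (measurable_fun_cvg mf) => x _; exact: ff.
have [] := @dominated_convergence _ _ _ m setT measurableT (fun k => EFin \o f_ k) (EFin \o f) (EFin \o g).
- by move=> k; exact/measurable_EFinP.
- exact/measurable_EFinP.
- by apply: aeW => x _; apply: cvg_EFinT; exact: ff.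
- exact: ig.
- by apply: aeW => x k _; rewrite lee_fin.
move=> if_ _ cv; split=> //.
by apply: fine_cvg_seq => //; exact: integrable_fin_num.
Qed.

(** * Positive definiteness under Gaussian damping, and its multipliers *)

Section PosDef.
Variable R : realType.
Variable n : nat.
Local Notation leb := (lebN R n).
Local Notation RN := (RN R n).
Implicit Types (Phi Psi : RN -> R) (a b c t C : R).

(* Positive definiteness of a possibly non-integrable [Phi], tested after multiplication by a Gaussian so that the Fourier integral converges. *)
Definition gauss_posdef (Phi : RN -> R) : Prop :=
  [/\ measurable_fun setT Phi, (exists C, forall x, `|Phi x| <= C) &
   forall b z, 0 < b -> 0 <= Rintegral leb setT (fun x => cos (vdot z x) * expR (- b * vdot x x) * Phi x)].

(** Positive definiteness expressed as an operation on tested functions, so that the product of two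
    multipliers is the composition of two operations. *)
Definition posdef_mult (Phi : RN -> R) : Prop :=
  [/\ measurable_fun setT Phi, (exists C, forall x, `|Phi x| <= C) &
   forall Psi, gauss_posdef Psi -> gauss_posdef (fun x => Psi x * Phi x)].

Lemma measurable_cosz (z : RN) : measurable_fun setT (fun x : RN => cos (vdot z x)).
Proof. by apply: measurableT_comp; [exact: measurable_cos|exact: measurable_vdotr]. Qed.

Let mcg b z (Phi : RN -> R) : measurable_fun setT Phi ->
  measurable_fun setT (fun x : RN => cos (vdot z x) * expR (- b * vdot x x) * Phi x).
Proof.
by move=> mP; apply: measurable_funM => //; apply: measurable_funM; [exact: measurable_cosz|exact: measurable_gauss].
Qed.

Let bcg b z (Phi : RN -> R) C : (forall x, `|Phi x| <= C) ->
  forall x, `|cos (vdot z x) * expR (- b * vdot x x) * Phi x| <= C * expR (- b * vdot x x).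
Proof.
move=> PC x; rewrite mulrC normrM ler_pM// normrM (ger0_norm (expR_ge0 _)).
by rewrite ler_piMl ?expR_ge0 ?cos_max.
Qed.

Let iCg b C : 0 < b -> leb.-integrable setT (EFin \o (fun x : RN => C * expR (- b * vdot x x))).
Proof.
by move=> b0; have := integrableZl measurableT C (@gauss_integrable R n b b0); apply: eq_integrable.
Qed.

Let icg b z (Phi : RN -> R) : 0 < b -> measurable_fun setT Phi -> (exists C, forall x, `|Phi x| <= C) ->
  leb.-integrable setT (EFin \o (fun x : RN => cos (vdot z x) * expR (- b * vdot x x) * Phi x)).
Proof.
move=> b0 mP [C PC]; exact: (integrable_ler (mcg b z mP) (bcg b z PC) (iCg C b0)).
Qed.

Lemma gauss_posdef1 : gauss_posdef (fun=> 1).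
Proof.
split; [by []|by exists 1 => x; rewrite normr1|move=> b z b0].
have -> : Rintegral leb setT (fun x => cos (vdot z x) * expR (- b * vdot x x) * 1) =
  Rintegral leb setT (fun x => cos (vdot z x + 0) * expR (- b * vdot x x)).
  by apply: eq_Rintegral => x _; rewrite mulr1 addr0.
by rewrite gauss_fourier// cos0 mulr1 mulr_ge0 ?expR_ge0// exprn_ge0// sqrtr_ge0.
Qed.

(** The damping Gaussian times the uniform bound [C] dominates the test integrals, so their signs
    pass to the limit. *)
Lemma gauss_posdef_lim (Phi_ : nat -> RN -> R) Phi C :
  (forall k, gauss_posdef (Phi_ k)) -> (forall k x, `|Phi_ k x| <= C) ->
  (forall x, Phi_ ^~ x @ \oo --> Phi x) -> gauss_posdef Phi.
Proof.
move=> pk bk lk.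
have mk k : measurable_fun setT (Phi_ k) by have [] := pk k.
have mP : measurable_fun setT Phi by apply: (measurable_fun_cvg mk) => x _; exact: lk.
split => //.
  exists C => x; have h : `|Phi_ k x| @[k --> \oo] --> `|Phi x| by apply: cvg_norm; exact: lk.
  by rewrite -(cvg_lim _ h)//; apply: limr_le; [apply/cvg_ex; eexists; exact: h|exact: nearW].
move=> b z b0.
have [_ h] := @Rintegral_dominated_cvg R _ _ leb
  (fun k x => cos (vdot z x) * expR (- b * vdot x x) * Phi_ k x)
  (fun x => cos (vdot z x) * expR (- b * vdot x x) * Phi x)
  (fun x => C * expR (- b * vdot x x)) (fun k => mcg b z (mk k))
  (fun x => cvgM (cvg_cst (cos (vdot z x) * expR (- b * vdot x x))) (lk x)) (fun k => bcg b z (bk k)) (iCg C b0).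
rewrite -(cvg_lim _ h)//; apply: limr_ge; first by apply/cvg_ex; eexists; exact: h.
by apply: nearW => k; have [_ _] := pk k; exact.
Qed.

Lemma gauss_posdefD Phi Psi : gauss_posdef Phi -> gauss_posdef Psi ->
  gauss_posdef (fun x => Phi x + Psi x).
Proof.
move=> [m1 [C1 b1] p1] [m2 [C2 b2] p2]; split; first exact: measurable_funD.
  by exists (C1 + C2) => x; apply: le_trans (ler_normD _ _) _; exact: lerD.
move=> b z b0.
have -> : Rintegral leb setT (fun x => cos (vdot z x) * expR (- b * vdot x x) * (Phi x + Psi x)) =
  Rintegral leb setT (fun x => cos (vdot z x) * expR (- b * vdot x x) * Phi x) +
  Rintegral leb setT (fun x => cos (vdot z x) * expR (- b * vdot x x) * Psi x).
  rewrite -RintegralD; [|exact: measurableT|by apply: icg => //; exists C1|by apply: icg => //; exists C2].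
  by apply: eq_Rintegral => x _; rewrite mulrDr.
by apply: addr_ge0; [exact: p1|exact: p2].
Qed.

Lemma gauss_posdefZ c Phi : 0 <= c -> gauss_posdef Phi -> gauss_posdef (fun x => c * Phi x).
Proof.
move=> c0 [m1 [C1 b1] p1]; split; first exact: measurable_funM.
  by exists (c * C1) => x; rewrite normrM (ger0_norm c0) ler_wpM2l.
move=> b z b0.
have -> : Rintegral leb setT (fun x => cos (vdot z x) * expR (- b * vdot x x) * (c * Phi x)) =
  c * Rintegral leb setT (fun x => cos (vdot z x) * expR (- b * vdot x x) * Phi x).
  rewrite -RintegralZl; [|exact: measurableT|by apply: icg => //; exists C1].
  by apply: eq_Rintegral => x _; rewrite mulrCA.
by apply: mulr_ge0 => //; exact: p1.
Qed.

Lemma posdef_mult_lim (Phi_ : nat -> RN -> R) Phi C :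
  (forall k, posdef_mult (Phi_ k)) -> (forall k x, `|Phi_ k x| <= C) ->
  (forall x, Phi_ ^~ x @ \oo --> Phi x) -> posdef_mult Phi.
Proof.
move=> pk bk lk.
have P1 : gauss_posdef Phi.
  apply: (@gauss_posdef_lim Phi_ _ C) => // k.
  have [_ _ /(_ _ gauss_posdef1)] := pk k.
  by rewrite (_ : (fun x => 1 * Phi_ k x) = Phi_ k)//; apply/funext => x; rewrite mul1r.
have [m1 b1 _] := P1; split=> // Psi pP; have [_ [D bD] _] := pP.
apply: (@gauss_posdef_lim (fun k x => Psi x * Phi_ k x) _ (D * C)).
- by move=> k; have [_ _] := pk k; exact.
- by move=> k x; rewrite normrM ler_pM.
- by move=> x; apply: (cvgM (cvg_cst (Psi x)) (lk x)).
Qed.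

Lemma posdef_multD Phi Psi : posdef_mult Phi -> posdef_mult Psi -> posdef_mult (fun x => Phi x + Psi x).
Proof.
move=> [m1 [C1 b1] p1] [m2 [C2 b2] p2]; split; first exact: measurable_funD.
  by exists (C1 + C2) => x; apply: le_trans (ler_normD _ _) _; exact: lerD.
move=> X pX; rewrite (_ : (fun x => _) = fun x => X x * Phi x + X x * Psi x); last by apply/funext => x; rewrite mulrDr.
by apply: gauss_posdefD; [exact: p1|exact: p2].
Qed.

Lemma posdef_multZ c Phi : 0 <= c -> posdef_mult Phi -> posdef_mult (fun x => c * Phi x).
Proof.
move=> c0 [m1 [C1 b1] p1]; split; first exact: measurable_funM.
  by exists (c * C1) => x; rewrite normrM (ger0_norm c0) ler_wpM2l.
move=> X pX; rewrite (_ : (fun x => _) = fun x => c * (X x * Phi x)); last by apply/funext => x; rewrite mulrCA.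
by apply: gauss_posdefZ => //; exact: p1.
Qed.

Lemma posdef_multM Phi Psi : posdef_mult Phi -> posdef_mult Psi -> posdef_mult (fun x => Phi x * Psi x).
Proof.
move=> [m1 [C1 b1] p1] [m2 [C2 b2] p2]; split; first exact: measurable_funM.
  by exists (C1 * C2) => x; rewrite normrM ler_pM.
move=> X pX; rewrite (_ : (fun x => _) = fun x => X x * Phi x * Psi x); last by apply/funext => x; rewrite mulrA.
by apply: p2; exact: p1.
Qed.

Lemma posdef_mult1 : posdef_mult (fun=> 1).
Proof.
split; [by []|by exists 1 => x; rewrite normr1|move=> X pX].
by rewrite (_ : (fun x => _) = X)//; apply/funext => x; rewrite mulr1.
Qed.

Lemma posdef_multX k Phi : posdef_mult Phi -> posdef_mult (fun x => Phi x ^+ k).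
Proof.
move=> p; elim: k => [|k IH]; first exact: posdef_mult1.
rewrite (_ : (fun x => _) = fun x => Phi x * Phi x ^+ k); last by apply/funext => x; rewrite exprS.
exact: posdef_multM.
Qed.

Lemma posdef_mult_sum (c : nat -> R) (Phi_ : nat -> RN -> R) K :
  (forall k, 0 <= c k) -> (forall k, posdef_mult (Phi_ k)) ->
  posdef_mult (fun x => \sum_(k < K) c k * Phi_ k x).
Proof.
move=> c0 pk; elim: K => [|K IH].
  rewrite (_ : (fun x => _) = fun x => 0 * 1); first exact: (posdef_multZ (lexx 0) posdef_mult1).
  by apply/funext => x; rewrite big_ord0 mul0r.
rewrite (_ : (fun x => _) = fun x => \sum_(k < K) c k * Phi_ k x + c K * Phi_ K x).
  by apply: posdef_multD => //; exact: posdef_multZ.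
by apply/funext => x; rewrite big_ord_recr.
Qed.

(** Multiplication by exp(-a|x|^2) only moves the damping parameter from b to a + b. Apart from
    constants, all later multipliers are built from this one. *)
Lemma posdef_mult_gauss a : 0 <= a -> posdef_mult (fun x => expR (- a * vdot x x)).
Proof.
move=> a0; have ba x : `|expR (- a * vdot x x)| <= 1.
  rewrite ger0_norm ?expR_ge0// -expR0 ler_expR mulNr oppr_le0.
  by rewrite mulr_ge0// vdot_ge0.
split; [exact: measurable_gauss|by exists 1|move=> X [mX [C bX] pX]].
split; first by apply: measurable_funM => //; exact: measurable_gauss.
  by exists (C * 1) => x; rewrite normrM ler_pM.
move=> b z b0.
have -> : Rintegral leb setT (fun x => cos (vdot z x) * expR (- b * vdot x x) * (X x * expR (- a * vdot x x))) =
   Rintegral leb setT (fun x => cos (vdot z x) * expR (- (a + b) * vdot x x) * X x).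
  by apply: eq_Rintegral => x _; rewrite opprD mulrDl expRD; ring.
by apply: pX; exact: ltr_wpDl.
Qed.

(** The exponential series has nonnegative coefficients, and since [Phi] is nonnegative its partial
    sums stay below exp(t C). *)
Lemma posdef_mult_expR t Phi C : 0 <= t -> (forall x, 0 <= Phi x <= C) -> posdef_mult Phi ->
  posdef_mult (fun x => expR (t * Phi x)).
Proof.
move=> t0 bP pP.
apply: (@posdef_mult_lim (fun K x => \sum_(k < K) (t ^+ k / k`!%:R) * Phi x ^+ k) _ (expR (t * C))).
- move=> K; apply: (@posdef_mult_sum (fun k => t ^+ k / k`!%:R) (fun k x => Phi x ^+ k)).
    by move=> k; rewrite divr_ge0// exprn_ge0.
  by move=> k; exact: posdef_multX.
- move=> K x; have /andP[P0 PC] := bP x.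
  rewrite ger0_norm; last by apply: sumr_ge0 => k _; rewrite mulr_ge0 ?divr_ge0 ?exprn_ge0.
  apply: (@le_trans _ _ (expR (t * Phi x))); last by rewrite ler_expR ler_wpM2l.
  rewrite /expR; have -> : \sum_(k < K) t ^+ k / k`!%:R * Phi x ^+ k = series (exp_coeff (t * Phi x)) K.
    by rewrite /series /= big_mkord; apply: eq_bigr => k _; rewrite /exp_coeff /= exprMn; ring.
  apply: nondecreasing_cvgn_le; last exact: is_cvg_series_exp_coeff.
  by apply: nondecreasing_series => k _ _; rewrite /exp_coeff/= divr_ge0// exprn_ge0// mulr_ge0.
- move=> x; rewrite (_ : (fun K => _) = series (exp_coeff (t * Phi x))); first exact: is_cvg_series_exp_coeff.
  apply/funext => K; rewrite /series /= big_mkord; apply: eq_bigr => k _.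
  by rewrite /exp_coeff /= exprMn; ring.
Qed.
End PosDef.

(** * The binomial series of 1 - (1 - x)^s *)

Section Binomial.
Variable R : realType.
Variable s : R.
Hypothesis s01 : 0 < s < 1.

Let s0 : 0 < s. Proof. by case/andP: s01. Qed.
Let s1 : s < 1. Proof. by case/andP: s01. Qed.

(* 1 - (1 - x)^s = \sum_k binom_coef k * x ^ k.+1 *)
Fixpoint binom_coef (k : nat) : R :=
  if k is j.+1 then binom_coef j * ((j.+1%:R - s) / j.+2%:R) else s.

Let natmul_divK k (a b : R) : k.+2%:R * (a * (b / k.+2%:R)) = b * a.
Proof. by rewrite mulrCA [_ * (b / _)]mulrC divfK ?pnatr_eq0// mulrC. Qed.

Lemma binom_coef_ge0 k : 0 <= binom_coef k.
Proof.
elim: k => [|k IH] /=; first exact: ltW.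
rewrite mulr_ge0// divr_ge0// subr_ge0 (le_trans (ltW s1))// ler1n//.
Qed.

(** The recursion reads (k+2) c_(k+1) = (k+1-s) c_k, so (k+1) c_k is nonincreasing and starts at s <
    1. *)
Lemma binom_coef_le k : k.+1%:R * binom_coef k <= 1.
Proof.
elim: k => [|k IH] /=; first by rewrite mul1r ltW.
rewrite natmul_divK.
apply: le_trans IH; rewrite ler_wpM2r ?binom_coef_ge0// gerBl; exact: ltW.
Qed.

Definition binom_sum K (x : R) : R := \sum_(k < K) binom_coef k * x ^+ k.+1.

Lemma binom_sum_ge0 K x : 0 <= x -> 0 <= binom_sum K x.
Proof. by move=> x0; apply: sumr_ge0 => k _; rewrite mulr_ge0 ?binom_coef_ge0 ?exprn_ge0. Qed.

Let dsum K (x : R) : R := \sum_(k < K) binom_coef k * (k.+1%:R * x ^+ k).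

Let is_derive_sum K (x : R) : is_derive x 1 (binom_sum K) (dsum K x).
Proof.
elim: K => [|K IH].
  rewrite /dsum big_ord0 (_ : binom_sum 0 = cst 0); last by apply/funext => y; rewrite /binom_sum big_ord0.
  exact: is_derive_cst.
rewrite /dsum big_ord_recr /= (_ : binom_sum K.+1 = fun y => binom_sum K y + binom_coef K * y ^+ K.+1); last first.
  by apply/funext => y; rewrite /binom_sum big_ord_recr.
have dX : is_derive x 1 (fun y : R => y ^+ K.+1) (K.+1%:R * x ^+ K).
  have := @is_deriveX _ _ id K.+1 x 1 1 (is_derive_id x 1).
  by rewrite exprfctE /= /GRing.scale /= mulr1.
have dZ : is_derive x 1 (fun y : R => binom_coef K * y ^+ K.+1) (binom_coef K * (K.+1%:R * x ^+ K)).
  exact: (is_deriveZ (binom_coef K) dX).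
exact: (is_deriveD IH dZ).
Qed.

(* [binom_sum_bounds] follows from this and the mean value theorem: multiplied by (1 - x)^(-s-1), the right-hand side is the derivative of (1 - binom_sum K x) (1 - x)^(-s) and is nonnegative. *)
Let ode K x : - dsum K x * (1 - x) + s * (1 - binom_sum K x) = K.+1%:R * binom_coef K * x ^+ K.
Proof.
elim: K => [|K IH]; first by rewrite /dsum /binom_sum !big_ord0 /=; ring.
rewrite /dsum /binom_sum !big_ord_recr /= -/(dsum K x) -/(binom_sum K x).
rewrite natmul_divK.
rewrite [LHS](_ : _ = - dsum K x * (1 - x) + s * (1 - binom_sum K x) - binom_coef K * (K.+1%:R * x ^+ K) * (1 - x) - s * (binom_coef K * x ^+ K.+1)); last by ring.
rewrite IH !exprS; ring.
Qed.

Lemma binom_sum_bounds K (x : R) : 0 <= x < 1 ->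
  0 <= 1 - binom_sum K x - powR (1 - x) s <= x ^+ K / (1 - x).
Proof.
move=> /andP[x0 x1].
pose B (y : R) := (1 - binom_sum K y) * powR (1 - y) (- s).
pose B' (y : R) := K.+1%:R * binom_coef K * y ^+ K * powR (1 - y) (- s - 1).
have dB (y : R) : y < 1 -> is_derive y 1 B (B' y).
  move=> y1; have y10 : 0 < 1 - y by rewrite subr_gt0.
  have dp : is_derive y 1 (fun y : R => powR (1 - y) (- s)) (s * powR (1 - y) (- s - 1)).
    have d1 : is_derive y 1 (fun y : R => 1 - y) (-1).
      by have := is_deriveB (is_derive_cst (1 : R) y 1) (is_derive_id y 1); rewrite sub0r.
    have := @is_derive1_comp R (@powR R ^~ (- s)) (fun y : R => 1 - y) y _ _ (is_derive1_powR (- s) y10) d1.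
    by move=> h; apply: (is_derive_eq h); ring.
  have ds := is_derive_sum K y.
  have d2 : is_derive y 1 (fun y : R => 1 - binom_sum K y) (- dsum K y).
    by have := is_deriveB (is_derive_cst (1 : R) y 1) ds; rewrite sub0r.
  have h := is_deriveM d2 dp; apply: (is_derive_eq h).
  rewrite /GRing.scale /= /B' -ode.
  have -> : powR (1 - y) (- s) = powR (1 - y) (- s - 1) * (1 - y).
    transitivity (powR (1 - y) (- s - 1) * powR (1 - y) 1); last by rewrite powRr1// ltW.
    by rewrite -powRD ?subrK// (gt_eqF y10) implybT.
  ring.
have x10 : 0 < 1 - x by rewrite subr_gt0.
have [||c /andP[c0 cx]] := @MVT_segment R B B' 0 x x0.
- by move=> y; rewrite in_itv/= => /andP[_ yx]; apply: dB; exact: lt_trans yx x1.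
- apply: derivable_within_continuous => y; rewrite in_itv/= => /andP[_ yx].
  by have [] := dB y (le_lt_trans yx x1).
rewrite !bnd_simp in c0 cx.
have -> : B 0 = 1.
  rewrite /B subr0 powR1 mulr1 /binom_sum big1 ?subr0// => k _.
  by rewrite exprS mul0r mulr0.
rewrite subr0 => BE.
have Bx : 1 - binom_sum K x - powR (1 - x) s = powR (1 - x) s * (B x - 1).
  rewrite /B mulrBr mulr1 mulrCA powRN mulfV ?mulr1//.
  by rewrite gt_eqF// powR_gt0.
have c1 : 0 < 1 - c by rewrite subr_gt0 (le_lt_trans cx).
have B'0 : 0 <= B' c.
  rewrite /B' mulr_ge0 ?powR_ge0// mulr_ge0 ?exprn_ge0// mulr_ge0 ?binom_coef_ge0//.
(* The mean value point c lies below x, so each factor is bounded by its value at x, with (K+1) c_K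
   <= 1. Multiplying by (1-x)^s and by the length x <= 1 of the interval then yields x^K/(1-x). *)
have B'1 : B' c <= x ^+ K * powR (1 - x) (- s - 1).
  rewrite /B'; apply: ler_pM; rewrite ?powR_ge0//.
  + by rewrite mulr_ge0 ?exprn_ge0// mulr_ge0 ?binom_coef_ge0.
  + rewrite -[leRHS]mul1r; apply: ler_pM; rewrite ?exprn_ge0 ?binom_coef_le//.
      by rewrite mulr_ge0 ?binom_coef_ge0.
    by rewrite lerXn2r ?nnegrE.
  + rewrite -opprD !powRN lef_pV2 ?posrE ?powR_gt0//.
    apply: ge0_ler_powR; [by rewrite addr_ge0// ltW|by rewrite nnegrE ltW|by rewrite nnegrE ltW|].
    by rewrite lerD2l lerN2.
rewrite Bx BE; apply/andP; split; first by rewrite mulr_ge0 ?powR_ge0// mulr_ge0.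
rewrite mulrCA mulrC -mulrA.
have -> : x ^+ K / (1 - x) = powR (1 - x) s * (x ^+ K * powR (1 - x) (- s - 1)) * 1.
  rewrite mulr1 mulrCA -powRD; last by rewrite (gt_eqF x10) implybT.
  by rewrite addrA subrr add0r powR_inv1// ltW.
rewrite [leLHS](_ : _ = powR (1 - x) s * B' c * x); last by ring.
apply: ler_pM => //; [by rewrite mulr_ge0 ?powR_ge0|by rewrite ler_wpM2l ?powR_ge0|exact: ltW].
Qed.

Lemma binom_sum_cvg (x : R) : 0 <= x < 1 -> binom_sum K x @[K --> \oo] --> 1 - powR (1 - x) s.
Proof.
move=> x01; have /andP[x0 x1] := x01.
have : (1 - binom_sum K x - powR (1 - x) s) @[K --> \oo] --> (0 : R).
  apply: (@squeeze_cvgr _ _ _ _ (fun=> 0) (fun K => x ^+ K / (1 - x))).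
  - by apply: nearW => K; exact: binom_sum_bounds.
  - exact: cvg_cst.
  - rewrite -[X in _ --> X](mul0r (1 - x)^-1); apply: cvgM; last exact: cvg_cst.
    by apply: cvg_expr; rewrite ger0_norm.
move=> /(cvgB (cvg_cst (1 - powR (1 - x) s))) h.
rewrite -[X in _ --> X]subr0.
rewrite [X in X @ _ --> _](_ : _ = fun K => (1 - powR (1 - x) s) - (1 - binom_sum K x - powR (1 - x) s)); first exact: h.
by apply/funext => K; ring.
Qed.

Lemma binom_sum_le1 K (x : R) : 0 <= x < 1 -> binom_sum K x <= 1 - powR (1 - x) s.
Proof. by move=> /(binom_sum_bounds K)/andP[+ _]; lra. Qed.
End Binomial.

(** * The stable factor as a multiplier, and the sign of the heat kernel *)

Section Positivity.
Variable R : realType.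
Variables (n : nat) (s : R).
Hypothesis s01 : 0 < s < 1.
Local Notation leb := (lebN R n).
Local Notation RN := (RN R n).
Implicit Types (x z : RN).

Let s0 : 0 < s. Proof. by case/andP: s01. Qed.

Lemma posdef_mult_binom (U : RN -> R) : (forall x, 0 <= U x < 1) -> posdef_mult U ->
  posdef_mult (fun x => 1 - powR (1 - U x) s).
Proof.
move=> U01 pU.
apply: (@posdef_mult_lim R n (fun K x => binom_sum s K (U x)) _ 1).
- move=> K; apply: (@posdef_mult_sum R n (binom_coef s) (fun k x => U x ^+ k.+1)).
    exact: binom_coef_ge0.
  by move=> k; exact: posdef_multX.
- move=> K x; have /andP[U0 _] := U01 x; rewrite ger0_norm ?binom_sum_ge0//.
  by apply: le_trans (binom_sum_le1 s01 K (U01 x)) _; rewrite gerBl powR_ge0.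
- by move=> x; exact: binom_sum_cvg.
Qed.

(** Writing -(1-U)^s = -1 + (1 - (1-U)^s) turns the negative exponent into a constant plus a series
    in [U] with nonnegative coefficients. *)
Lemma posdef_mult_powR (t : R) (U : RN -> R) : 0 <= t -> (forall x, 0 <= U x < 1) -> posdef_mult U ->
  posdef_mult (fun x => expR (- t * powR (1 - U x) s)).
Proof.
move=> t0 U01 pU.
rewrite (_ : (fun x => _) = fun x => expR (- t) * expR (t * (1 - powR (1 - U x) s))); last first.
  by apply/funext => x; rewrite -expRD; congr expR; ring.
apply: posdef_multZ; first exact: expR_ge0.
apply: (@posdef_mult_expR R n t _ 1) => //; last exact: posdef_mult_binom.
move=> x; have /andP[U0 U1] := U01 x.
rewrite gerBl powR_ge0 andbT subr_ge0; apply: (@le_trans _ _ (powR 1 s)); last by rewrite powR1.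
by apply: ge0_ler_powR; [exact: ltW|rewrite nnegrE subr_ge0 ltW|rewrite nnegrE|rewrite gerBl].
Qed.

(** For l > 0 the power is differentiable at l; for l = 0 the bound u <= e^(1/s) gives u^s <= e. *)
Lemma cvg_powR (u : nat -> R) (l : R) : (forall k, 0 <= u k) -> 0 <= l -> u @ \oo --> l ->
  powR (u k) s @[k --> \oo] --> powR l s.
Proof.
move=> u0; rewrite le_eqVlt => /orP[/eqP <- ul|l0 ul]; last first.
  have cl : {for l, continuous (fun x : R => powR x s)}.
    apply: differentiable_continuous; apply/derivable1_diffP.
    by have [] := is_derive1_powR s l0.
  exact: (continuous_cvg _ cl ul).
rewrite powR0 ?gt_eqF//; apply/cvgrPdist_le => e e0.
have e1 : 0 < powR e s^-1 by rewrite powR_gt0.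
move/cvgrPdist_le : ul => /(_ _ e1); apply: filterS => k.
rewrite !sub0r !normrN (ger0_norm (u0 k)) (ger0_norm (powR_ge0 _ _)) => uk.
rewrite -[leRHS](powRr1 (ltW e0)) -(mulVf (lt0r_neq0 s0)) powRrM.
by apply: ge0_ler_powR; rewrite ?nnegrE ?powR_ge0//; exact: ltW.
Qed.

Lemma posdef_mult_stable (t : R) : 0 <= t -> posdef_mult (fun x : RN => expR (- t * powR (vdot x x) s)).
Proof.
move=> t0.
pose e (k : nat) : R := k.+1%:R^-1.
have e0 k : 0 < e k by rewrite invr_gt0.
(* The shift by [e k] keeps [U k x] strictly below 1 even at the origin, as the binomial expansion
   requires. *)
pose U k (x : RN) := expR (- (e k * e k)) * expR (- e k * vdot x x).
have UE k x : U k x = expR (- (e k * (vdot x x + e k))) by rewrite /U -expRD; congr expR; ring.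
have U01 k x : 0 <= U k x < 1.
  by rewrite UE expR_ge0/= -expR0 ltr_expR oppr_lt0 mulr_gt0// ltr_wpDl// vdot_ge0.
have lam k x : (1 - U k x) / e k <= vdot x x + e k.
  rewrite ler_pdivrMr// mulrC lerBlDr -lerBlDl UE.
  by apply: le_trans (expR_ge1Dx _).
apply: (@posdef_mult_lim R n (fun k x => expR (- (t * powR (e k) (- s)) * powR (1 - U k x) s)) _ 1).
- move=> k; apply: posdef_mult_powR => //; first by rewrite mulr_ge0 ?powR_ge0.
  by apply: posdef_multZ; [exact: expR_ge0|apply: posdef_mult_gauss; exact: ltW].
- move=> k x; rewrite ger0_norm ?expR_ge0// -expR0 ler_expR mulNr oppr_le0.
  by rewrite !mulr_ge0 ?powR_ge0.
- move=> x.
  have E k : expR (- (t * powR (e k) (- s)) * powR (1 - U k x) s) = expR (- t * powR ((1 - U k x) / e k) s).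
    congr expR; rewrite powRM ?invr_ge0 ?ltW//; last by have /andP[] := U01 k x; lra.
    rewrite -[(e k)^-1](powR_inv1 (ltW (e0 k))) -powRrM mulN1r; ring.
  under eq_fun do rewrite E.
  have ecv : e k @[k --> \oo] --> (0 : R) by exact: cvg_harmonic.
  have cv : (1 - U k x) / e k @[k --> \oo] --> vdot x x.
    (* These are y/(1+y) <= 1 - exp(-y) <= y for y = e (|x|^2 + e), divided by e. *)
    apply: (@squeeze_cvgr _ _ _ _ (fun k => (vdot x x + e k) / (1 + e k * (vdot x x + e k))) (fun k => vdot x x + e k)).
    - apply: nearW => k; rewrite lam andbT.
      have w0 : 0 < vdot x x + e k by rewrite ltr_wpDl// vdot_ge0.
      have y0 : 0 < e k * (vdot x x + e k) by rewrite mulr_gt0.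
      rewrite ler_pdivlMr// UE expRN.
      set y := e k * (vdot x x + e k) in y0 *.
      have := expR_ge1Dx y => h.
      have E1 : (expR y)^-1 <= (1 + y)^-1 by rewrite lef_pV2 ?posrE ?expR_gt0 ?addr_gt0.
      have -> : (vdot x x + e k) / (1 + y) * e k = 1 - (1 + y)^-1.
        by rewrite /y; field; rewrite -/y gt_eqF// addr_gt0.
      by rewrite lerD2l lerN2.
    - have c1 : vdot x x + e k @[k --> \oo] --> vdot x x.
        by rewrite -[X in _ --> X]addr0; apply: cvgD; [exact: cvg_cst|exact: ecv].
      rewrite -[X in _ --> X]divr1; apply: cvgM => //.
      apply: cvgV; first by rewrite oner_eq0.
      rewrite -[X in _ --> X]addr0; apply: cvgD; first exact: cvg_cst.
      by rewrite -[X in _ --> X](mul0r (vdot x x)); apply: cvgM.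
    - by rewrite -[X in _ --> X]addr0; apply: cvgD; [exact: cvg_cst|exact: ecv].
  apply: (@cvg_comp _ _ _ _ expR); last exact: continuous_expR.
  apply: cvgM; first exact: cvg_cst.
  apply: cvg_powR; [|exact: vdot_ge0|exact: cv].
  by move=> k; have /andP[_ ?] := U01 k x; rewrite divr_ge0 ?subr_ge0 ?ltW.
Qed.

(** Testing the stable multiplier on the constant 1 with damping parameter b = t produces exactly
    the Fourier integral of the symbol. *)
Lemma heat_kernel_ge0 t (z : RN) : 0 < t -> 0 <= heat_kernel s t z.
Proof.
move=> t0; rewrite heat_kernelE//.
have [_ _ /(_ _ (@gauss_posdef1 R n)) [_ _ /(_ t z t0)]] := posdef_mult_stable (ltW t0).
have -> : Rintegral leb setT (fun x => cos (vdot z x) * symbol s t x) =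
  Rintegral leb setT (fun x => cos (vdot z x) * expR (- t * vdot x x) * (1 * expR (- t * powR (vdot x x) s))).
  by apply: eq_Rintegral => x _; rewrite mul1r mulrA.
move=> h; apply: mulr_ge0; last exact: h.
by rewrite invr_ge0 exprn_ge0// mulr_ge0// pi_ge0.
Qed.

End Positivity.

(** * Mass, Fourier transform and semigroup property *)

(** Inversion is rewritten through the measurable real power as x times (x^2)^(-1); both sides are 0
    at 0. *)
Lemma measurable_invr (R : realType) : measurable_fun setT (fun x : R => x^-1).
Proof.
rewrite (_ : (fun x => _) = fun x : R => x * powR (x * x) (-1)); last first.
  apply/funext => x; rewrite powR_inv1; last by rewrite -expr2 sqr_ge0.
  have [->|x0] := eqVneq x 0; first by rewrite invr0 mul0r.
  by field.
apply: measurable_funM; first exact: measurable_id.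
apply: (measurableT_comp (measurable_powR _)).
by apply: measurable_funM; exact: measurable_id.
Qed.

Section HeatKernelTheory.
Variable R : realType.
Variables (n : nat) (s : R).
Hypothesis s01 : 0 < s < 1.
Local Notation leb := (lebN R n).
Local Notation RN := (RN R n).
Local Notation mu := (@lebesgue_measure R).
Implicit Types (x y z : RN) (t r : R).
Local Notation p t := (heat_kernel s t : RN -> R).

Let s0 : 0 < s. Proof. by case/andP: s01. Qed.
Let sf := @lebN_sigma_finite R n.

Lemma measurable_frac_heat_kernel :
  measurable_fun setT (fun w : RN * measurableTypeR R => frac_heat_kernel s w.2 w.1).
Proof.
rewrite /frac_heat_kernel; apply: measurable_funM; first exact: measurable_cst.
apply: (measurable_Rintegral_snd sf (f := fun (w : RN * measurableTypeR R) (xi : RN) => cos (vdot w.1 xi) * expR (- w.2 * powR (vdot xi xi) s))).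
apply: measurable_funM.
  apply: measurableT_comp; first exact: measurable_cos.
  have m11 : measurable_fun setT (fun z : (RN * measurableTypeR R) * RN => z.1.1).
    exact: (measurableT_comp (@measurable_fst _ _ _ _) (@measurable_fst _ _ _ _)).
  have m2 : measurable_fun setT (fun z : (RN * measurableTypeR R) * RN => z.2) by exact: measurable_snd.
  exact: (measurable_fun_vdot m11 m2).
apply: measurableT_comp; first exact: measurable_expR.
apply: measurable_funM.
  apply: measurableT_comp; first exact: oppr_measurable.
  exact: (measurableT_comp (@measurable_snd _ _ _ _) (@measurable_fst _ _ _ _)).
apply: (measurableT_comp (measurable_powR s)).
exact: (measurableT_comp (@measurable_sqn R n) (@measurable_snd _ _ _ _)).
Qed.

(** Joint measurability in space and time, for the use of Tonelli in Duhamel's formula. *)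
Lemma measurable_heat_kernel2 :
  measurable_fun setT (fun w : RN * measurableTypeR R => heat_kernel s w.2 w.1).
Proof.
rewrite /heat_kernel; apply: measurable_funM.
  apply: (measurableT_comp (measurable_powR _)).
  by apply: measurable_funM; [exact: measurable_cst|exact: measurable_snd].
apply: (measurable_Rintegral_snd sf (f := fun (w : RN * measurableTypeR R) (xi : RN) => expR (- vdot (vsub w.1 xi) (vsub w.1 xi) / (4 * w.2)) * frac_heat_kernel s w.2 xi)).
have m11 : measurable_fun setT (fun z : (RN * measurableTypeR R) * RN => z.1.1).
  exact: (measurableT_comp (@measurable_fst _ _ _ _) (@measurable_fst _ _ _ _)).
have m12 : measurable_fun setT (fun z : (RN * measurableTypeR R) * RN => z.1.2).
  exact: (measurableT_comp (@measurable_snd _ _ _ _) (@measurable_fst _ _ _ _)).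
have m2 : measurable_fun setT (fun z : (RN * measurableTypeR R) * RN => z.2) by exact: measurable_snd.
apply: measurable_funM; last first.
  by apply: (measurableT_comp measurable_frac_heat_kernel (g := fun z : (RN * measurableTypeR R) * RN => (z.2, z.1.2))); exact: measurable_fun_pair.
apply: measurableT_comp; first exact: measurable_expR.
apply: measurable_funM.
  apply: measurableT_comp; first exact: oppr_measurable.
  have mv := measurable_fun_vsub m11 m2.
  exact: (measurable_fun_vdot mv mv).
apply: measurableT_comp; first exact: measurable_invr.
by apply: measurable_funM; [exact: measurable_cst|exact: m12].
Qed.

Lemma measurable_heat_kernel t : measurable_fun setT (p t).
Proof. exact: (measurableT_comp measurable_heat_kernel2 (measurable_pair2 t)). Qed.

Let c : R := (2 * pi) ^- n.+1.
Let c0 : 0 < c.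
Proof. by rewrite invr_gt0; apply: exprn_gt0; apply: mulr_gt0; [|exact: pi_gt0]. Qed.

Let pE t z : 0 < t -> p t z = c * Rintegral leb setT (fun x => cos (vdot z x) * symbol s t x).
Proof. by move=> t0; exact: heat_kernelE. Qed.

Let intcs t z : 0 < t -> leb.-integrable setT (EFin \o (fun x => cos (vdot z x) * symbol s t x)).
Proof.
move=> t0; apply: (@integrable_ler R _ _ _ _ (symbol s t)).
- by apply: measurable_funM; [exact: measurable_cosz|exact: measurable_symbol].
- by move=> y; rewrite normrM (ger0_norm (symbol_ge0 _ _ _)) ler_piMl ?symbol_ge0 ?cos_max.
- exact: symbol_integrable.
Qed.

Lemma heat_kernelN t z : 0 < t -> p t (vsub (vzero R n) z) = p t z.
Proof.
move=> t0; rewrite !pE//; congr (_ * _); apply: eq_Rintegral => x _.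
by rewrite vdotBl vdot0l sub0r cosN.
Qed.

Lemma heat_kernel_sym t x y : 0 < t -> p t (vsub x y) = p t (vsub y x).
Proof.
move=> t0; rewrite !pE//; congr (_ * _); apply: eq_Rintegral => w _.
by rewrite !vdotBl -cosN opprB.
Qed.

(** The mass-one Gaussian, concentrating at the origin as [b] grows: up to a constant, the Fourier
    transform of the damping factor exp(-|y|^2/(4b)). *)
Let K b (w : RN) : R := (Num.sqrt (pi / b) ^+ n.+1)^-1 * expR (- b * vdot w w).

Let A0 (b : R) : 0 < b -> 0 < Num.sqrt (pi / b) ^+ n.+1.
Proof. by move=> b0; apply: exprn_gt0; rewrite sqrtr_gt0; apply: divr_gt0; [exact: pi_gt0|]. Qed.

Let K0 (b : R) w : 0 < b -> 0 <= K b w.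
Proof. by move=> b0; apply: mulr_ge0; [rewrite invr_ge0; exact: ltW (A0 b0)|exact: expR_ge0]. Qed.

Let mK (b : R) : measurable_fun setT (K b).
Proof. by apply: measurable_funM; [exact: measurable_cst|exact: measurable_gauss]. Qed.

Let iK (b : R) : 0 < b -> leb.-integrable setT (EFin \o K b).
Proof.
by move=> b0; have := integrableZl measurableT (Num.sqrt (pi / b) ^+ n.+1)^-1 (@gauss_integrable R n b b0); apply: eq_integrable.
Qed.

Let iK1 (b : R) : 0 < b -> Rintegral leb setT (K b) = 1.
Proof.
move=> b0; rewrite /K RintegralZl; [|exact: measurableT|exact: gauss_integrable].
by rewrite gauss_integral// mulVf// gt_eqF// A0.
Qed.

Lemma integrable_reflect (g : RN -> R) x : leb.-integrable setT (EFin \o g) ->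
  leb.-integrable setT (EFin \o (fun y => g (vsub x y))).
Proof.
move=> /integrableP[mg ig].
have mv : measurable_fun setT (fun y : RN => vsub x y) by exact: (@measurable_fun_vsub R _ _ n (cst x) id).
apply/integrableP; split; first exact: (measurableT_comp mg mv).
rewrite (le_lt_trans _ ig)// -(@ge0_integral_reflect R n x (fun y => `|(EFin \o g) y|)%E)//.
exact: measurableT_comp.
Qed.

(* The weight 1 - exp(-|.|^2) makes the error term explicitly computable when integrated against the Gaussians [K]. *)
Let modulus t (xi : RN) (e : R) : 0 < t -> 0 < e -> exists2 M, 0 <= M &
  forall eta, `|symbol s t eta - symbol s t xi| <= e + M * (1 - expR (- vdot (vsub xi eta) (vsub xi eta))).
Proof.
move=> t0 e0.
(* The symbol depends on eta only through l = |eta|^2; the absolute value makes [G] continuous on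
   the whole line. *)
pose G (l : R) := expR (- t * l) * expR (- t * powR `|l| s).
have GE eta : symbol s t eta = G (vdot eta eta) by rewrite /G ger0_norm// vdot_ge0.
pose l0 := vdot xi xi.
have : G l @[l --> l0] --> G l0.
  apply/(@cvg_nbhsP _ R^o) => u ul; apply: cvgM.
    apply: continuous_cvg; first exact: continuous_expR.
    by apply: cvgM; [exact: cvg_cst|exact: ul].
  apply: continuous_cvg; first exact: continuous_expR.
  apply: cvgM; first exact: cvg_cst.
  by apply: cvg_powR => //; apply: cvg_norm.
move/cvgrPdist_le => /(_ _ e0) /nbhs_ballP [rho /= rho0 Hrho].
have l00 : 0 <= l0 by exact: vdot_ge0.
(* With w = |xi - eta|^2, |xi|^2 - |eta|^2 = 2 xi.(xi - eta) - w, which Young's inequality bounds by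
   th l0 + (1 + 1/th) w. The choice of [th] keeps the first term within rho/2, and [r] keeps the
   second below rho/2 when w < r. *)
pose th := rho / (2 * (1 + l0)).
have th0 : 0 < th by rewrite divr_gt0// mulr_gt0// ltr_pwDl.
pose r := rho / (2 * (1 + th^-1)).
have r0 : 0 < r by rewrite divr_gt0// mulr_gt0// addr_gt0// invr_gt0.
have er : 0 < 1 - expR (- r) by rewrite subr_gt0 -expR0 ltr_expR oppr_lt0.
exists (1 - expR (- r))^-1; first by rewrite invr_ge0 ltW.
move=> eta; set w := vdot (vsub xi eta) (vsub xi eta).
have w0 : 0 <= w by exact: vdot_ge0.
have M0 : 0 <= (1 - expR (- r))^-1 by rewrite invr_ge0 ltW.
have ew : 0 <= 1 - expR (- w) by rewrite subr_ge0 -expR0 ler_expR oppr_le0.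
(* Far from [xi] the two symbol values, both in [0, 1], differ by at most 1, and the weighted term
   is already at least 1. *)
have [wr|rw] := ltP w r; last first.
  apply: (@le_trans _ _ 1).
    have := symbol_ge0 s t eta; have := symbol_ge0 s t xi.
    have := symbol_le1 s eta (ltW t0); have := symbol_le1 s xi (ltW t0).
    by rewrite ler_norml => *; apply/andP; split; lra.
  have : 1 <= (1 - expR (- r))^-1 * (1 - expR (- w)).
    by rewrite mulrC ler_pdivlMr// mul1r lerD2l lerN2 ler_expR lerN2.
  lra.
apply: (@le_trans _ _ e); last by rewrite lerDl mulr_ge0.
rewrite !GE distrC; apply: Hrho; rewrite /ball /=.
have E1 : vdot eta eta = l0 - 2 * vdot xi (vsub xi eta) + w.
  by rewrite /w vdot_vsub_sq vdotBr -/l0; ring.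
have Y := vdot_young xi (vsub xi eta) th0; rewrite -/w -/l0 in Y.
have -> : l0 - vdot eta eta = 2 * vdot xi (vsub xi eta) - w by rewrite E1; ring.
apply: le_lt_trans (ler_normB _ _) _; rewrite normrM (ger0_norm (ler0n _ 2)) (ger0_norm w0).
apply: le_lt_trans (lerD Y (lexx _)) _.
have E2 : th * l0 <= rho / 2.
  rewrite /th mulrAC ler_pdivrMr ?mulr_gt0 ?ltr_pwDl//.
  by rewrite (_ : rho / 2 * _ = rho * (1 + l0)); [rewrite ler_pM2l//; lra|field].
have E3 : (1 + th^-1) * w < rho / 2.
  apply: (@lt_le_trans _ _ ((1 + th^-1) * r)).
    by rewrite ltr_pM2l// addr_gt0// invr_gt0.
  rewrite /r le_eqVlt; apply/orP; left; apply/eqP; field.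
  by rewrite !gt_eqF// addr_gt0.
by rewrite mulrDl mul1r in E3; lra.
Qed.

(** Multiplying [K b] by exp(-|w|^2) changes its parameter to b + 1, so the error is one minus a
    quotient of Gaussian integrals and tends to 0 as [b] grows. *)
Let Kexp (b : R) : 0 < b ->
  Rintegral leb setT (fun w => (1 - expR (- vdot w w)) * K b w) = 1 - Num.sqrt (b / (b + 1)) ^+ n.+1.
Proof.
move=> b0; have b1 : 0 < b + 1 by rewrite addr_gt0.
pose A := Num.sqrt (pi / b) ^+ n.+1; have A0' : A != 0 by rewrite gt_eqF// A0.
have i2 := integrableZl measurableT A^-1 (@gauss_integrable R n _ b1).
have -> : Rintegral leb setT (fun w => (1 - expR (- vdot w w)) * K b w) =
    Rintegral leb setT (fun w => K b w - A^-1 * expR (- (b + 1) * vdot w w)).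
  apply: eq_Rintegral => w _; rewrite /K -/A mulrBl mul1r mulrCA; congr (_ - _ * _).
  by rewrite -expRD; congr expR; ring.
rewrite RintegralB; [|exact: measurableT|exact: iK|by move: i2; apply: eq_integrable].
rewrite iK1//; congr (_ - _).
rewrite RintegralZl; [|exact: measurableT|exact: gauss_integrable].
rewrite gauss_integral// (_ : pi / (b + 1) = (pi / b) * (b / (b + 1))); last first.
  by move: (pi : R) => q; field; rewrite !gt_eqF.
rewrite sqrtrM; last by apply: ltW; apply: divr_gt0; [exact: pi_gt0|].
by rewrite exprMn -/A mulKf.
Qed.

Let iKr (b : R) x : 0 < b -> leb.-integrable setT (EFin \o (fun eta => K b (vsub x eta))).
Proof. by move=> b0; apply: integrable_reflect; exact: iK. Qed.

Let msub x : measurable_fun setT (fun y : RN => vsub x y).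
Proof. exact: (@measurable_fun_vsub R _ _ n (cst x) id). Qed.

Let approx_le t xi (e M b : R) : 0 < t -> 0 < b ->
  (forall eta, `|symbol s t eta - symbol s t xi| <= e + M * (1 - expR (- vdot (vsub xi eta) (vsub xi eta)))) ->
  `|Rintegral leb setT (fun eta => symbol s t eta * K b (vsub xi eta)) - symbol s t xi| <=
  e + M * (1 - Num.sqrt (b / (b + 1)) ^+ n.+1).
Proof.
move=> t0 b0 eM.
have mKr : measurable_fun setT (fun eta => K b (vsub xi eta)) by exact: (measurableT_comp (mK b) (msub xi)).
have iKs : leb.-integrable setT (EFin \o (fun eta => symbol s t eta * K b (vsub xi eta))).
  apply: (@integrable_ler R _ _ _ _ (fun eta => K b (vsub xi eta))); last exact: iKr.
    by apply: measurable_funM; [exact: measurable_symbol|exact: mKr].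
  move=> eta; rewrite ger0_norm; last by rewrite mulr_ge0 ?symbol_ge0 ?K0.
  by rewrite ler_piMl ?K0// symbol_le1// ltW.
have iKc : leb.-integrable setT (EFin \o (fun eta => symbol s t xi * K b (vsub xi eta))).
  by have := integrableZl measurableT (symbol s t xi) (iKr xi b0); apply: eq_integrable.
have -> : symbol s t xi = Rintegral leb setT (fun eta => symbol s t xi * K b (vsub xi eta)).
  rewrite RintegralZl; [|exact: measurableT|exact: iKr].
  by rewrite Rintegral_reflect; [rewrite iK1// mulr1|exact: mK].
rewrite -RintegralB; [|exact: measurableT|exact: iKs|exact: iKc].
have iE : leb.-integrable setT (EFin \o (fun w => e * K b w)).
  by have := integrableZl measurableT e (iK b0); apply: eq_integrable.
have iX : leb.-integrable setT (EFin \o (fun w => (1 - expR (- vdot w w)) * K b w)).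
  apply: (@integrable_ler R _ _ _ _ (K b)); last exact: iK.
    apply: measurable_funM; last exact: mK.
    apply: measurable_funB; first exact: measurable_cst.
    by apply: measurableT_comp; [exact: measurable_expR|apply: measurableT_comp; [exact: oppr_measurable|exact: measurable_sqn]].
  move=> w; rewrite normrM (ger0_norm (K0 _ b0)) ler_piMl ?K0//.
  have := vdot_ge0 w; have := expR_gt0 (- vdot w w).
  by move=> ? ?; rewrite ger0_norm; [lra|rewrite subr_ge0 -expR0 ler_expR oppr_le0].
have iM : leb.-integrable setT (EFin \o (fun w => M * ((1 - expR (- vdot w w)) * K b w))).
  by have := integrableZl measurableT M iX; apply: eq_integrable.
have iW : leb.-integrable setT (EFin \o (fun w => e * K b w + M * ((1 - expR (- vdot w w)) * K b w))).
  by have := integrableD measurableT iE iM; apply: eq_integrable.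
have -> : e + M * (1 - Num.sqrt (b / (b + 1)) ^+ n.+1) =
    Rintegral leb setT (fun w => e * K b w + M * ((1 - expR (- vdot w w)) * K b w)).
  rewrite RintegralD; [|exact: measurableT|exact: iE|exact: iM].
  rewrite RintegralZl; [|exact: measurableT|exact: iK].
  rewrite RintegralZl; [|exact: measurableT|exact: iX].
  by rewrite Kexp// iK1// mulr1.
rewrite -[leRHS](Rintegral_reflect xi); last by apply/measurable_EFinP; exact: (measurable_int leb iW).
have iD : leb.-integrable setT (EFin \o (fun eta => symbol s t eta * K b (vsub xi eta) - symbol s t xi * K b (vsub xi eta))).
  by have := integrableB measurableT iKs iKc; apply: eq_integrable.
apply: (le_trans (le_normr_Rintegral measurableT iD)).
apply: le_Rintegral; [exact: measurableT|exact: integrable_norm|exact: (integrable_reflect xi iW)|].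
move=> eta _ /=; rewrite -mulrBl normrM (ger0_norm (K0 _ b0)).
apply: (le_trans (ler_wpM2r (K0 _ b0) (eM eta))).
by rewrite mulrDl -mulrA.
Qed.

Let approx_cvg t xi : 0 < t ->
  Rintegral leb setT (fun eta => symbol s t eta * K k.+1%:R (vsub xi eta)) @[k --> \oo] --> symbol s t xi.
Proof.
move=> t0; apply/cvgrPdist_le => e e0.
have e20 : 0 < e / 2 by rewrite divr_gt0.
have [M M0 eM] := modulus xi t0 e20.
have cv : M * (1 - Num.sqrt (k.+1%:R / (k.+1%:R + 1)) ^+ n.+1) @[k --> \oo] --> (0 : R).
  rewrite -[X in _ --> X](mulr0 M); apply: cvgM; first exact: cvg_cst.
  rewrite -[X in _ --> X](subrr (1 : R)); apply: cvgB; first exact: cvg_cst.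
  have sq : Num.sqrt (k.+1%:R / (k.+1%:R + 1)) @[k --> \oo] --> (1 : R).
    rewrite -[X in _ --> X]sqrtr1; apply: continuous_cvg; first exact: sqrt_continuous.
    rewrite (_ : (fun k => _) = fun k => 1 - harmonic k.+1 :> R); last first.
      apply/funext => k; rewrite /harmonic /= natr1.
      have : k.+2%:R != 0 :> R by rewrite pnatr_eq0.
      by rewrite -[k.+1%:R](addrK 1) natr1; move: (k.+2%:R : R) => q q0; field.
    rewrite -[X in _ --> X]subr0; apply: cvgB; first exact: cvg_cst.
    by have h := @cvg_harmonic R; rewrite -cvg_shiftS in h.
  rewrite -[X in _ --> X](expr1n _ n.+1).
  by apply: (continuous_cvg _ (@exprn_continuous R n.+1 1) sq).
move/cvgrPdist_le : cv => /(_ _ e20); apply: filterS => k.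
rewrite sub0r normrN => Hk.
rewrite distrC; apply: (le_trans (approx_le t0 _ eM)); first by rewrite ltr0n.
by have := le_trans (ler_norm _) Hk; lra.
Qed.

Lemma symbolN t (xi : RN) : symbol s t (vsub (vzero R n) xi) = symbol s t xi.
Proof. by rewrite /symbol vdot_vsub_sq !vdot0l mulr0 subr0 add0r. Qed.

Let const_eq (P b : R) : 0 < P -> 0 < b ->
  (2 * P) ^- n.+1 * Num.sqrt (P / (4 * b)^-1) ^+ n.+1 = (Num.sqrt (P / b) ^+ n.+1)^-1.
Proof.
move=> P0 b0; rewrite invrK -!exprVn -exprMn; congr (_ ^+ _).
have S0 : 0 < Num.sqrt (P / b) by rewrite sqrtr_gt0 divr_gt0.
apply: (mulIf (lt0r_neq0 S0)); rewrite mulVf ?gt_eqF// -mulrA -sqrtrM; last first.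
  by rewrite mulr_ge0 ?mulr_ge0 ?ltW.
rewrite (_ : P * (4 * b) * (P / b) = (2 * P) ^+ 2); last by field; rewrite gt_eqF.
by rewrite sqrtr_sqr ger0_norm ?mulr_ge0 ?(ltW P0)// mulVf// gt_eqF// mulr_gt0.
Qed.

(** After exchanging the integrals, the product-to-sum formula splits cos(y.xi) cos(y.eta) into two
    Gaussian transforms, concentrated at eta = xi and at eta = -xi. The symbol is even, so both
    averages have the same limit. *)
Let regularised t xi (b : R) : 0 < t -> 0 < b ->
  Rintegral leb setT (fun y => p t y * (cos (vdot y xi) * expR (- (4 * b)^-1 * vdot y y))) =
  2^-1 * (Rintegral leb setT (fun eta => symbol s t eta * K b (vsub xi eta)) +
   Rintegral leb setT (fun eta => symbol s t eta * K b (vsub (vsub (vzero R n) xi) eta))).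
Proof.
move=> t0 b0; pose d := (4 * b)^-1; have d0 : 0 < d by rewrite invr_gt0 mulr_gt0.
have isK x : leb.-integrable setT (EFin \o (fun eta => symbol s t eta * K b (vsub x eta))).
  apply: (@integrable_ler R _ _ _ _ (fun eta => K b (vsub x eta))); last exact: iKr.
    by apply: measurable_funM; [exact: measurable_symbol|exact: (measurableT_comp (mK b) (msub x))].
  move=> eta; rewrite ger0_norm; last by rewrite mulr_ge0 ?symbol_ge0 ?K0.
  by rewrite ler_piMl ?K0// symbol_le1// ltW.
rewrite -RintegralD; [|exact: measurableT|exact: isK|exact: isK].
rewrite -RintegralZl; [|exact: measurableT|by have := integrableD measurableT (isK xi) (isK (vsub (vzero R n) xi)); apply: eq_integrable].
pose F y eta := (cos (vdot y xi) * expR (- d * vdot y y)) * (c * (cos (vdot y eta) * symbol s t eta)).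
have mcy x : measurable_fun setT (fun y : RN => cos (vdot y x)).
  by apply: measurableT_comp; [exact: measurable_cos|exact: (@measurable_fun_vdot R _ _ n id (cst x))].
have mg1 : measurable_fun setT (fun y => cos (vdot y xi) * expR (- d * vdot y y)).
  by apply: measurable_funM; [exact: mcy|exact: measurable_gauss].
have mF : measurable_fun setT (fun w : RN * RN => F w.1 w.2).
  apply: measurable_funM; first exact: (measurableT_comp mg1 (@measurable_fst _ _ _ _)).
  apply: measurable_funM; first exact: measurable_cst.
  apply: measurable_funM; last exact: (measurableT_comp (@measurable_symbol R n s t) (@measurable_snd _ _ _ _)).
  by apply: measurableT_comp; [exact: measurable_cos|exact: measurable_vdot].
have bF y eta : `|F y eta| <= expR (- d * vdot y y) * (c * symbol s t eta).
  rewrite /F normrM normrM (ger0_norm (expR_ge0 _)) normrM (ger0_norm (ltW c0)) normrM (ger0_norm (symbol_ge0 _ _ _)).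
  apply: ler_pM; rewrite ?mulr_ge0 ?symbol_ge0 ?expR_ge0 ?(ltW c0)//.
    by rewrite ler_piMl ?expR_ge0 ?cos_max.
  by rewrite ler_wpM2l ?(ltW c0)// ler_piMl ?symbol_ge0 ?cos_max.
have ic : leb.-integrable setT (EFin \o (fun eta => c * symbol s t eta)).
  by have := integrableZl measurableT c (symbol_integrable n s t0); apply: eq_integrable.
have -> : Rintegral leb setT (fun y => p t y * (cos (vdot y xi) * expR (- (4 * b)^-1 * vdot y y))) =
    Rintegral leb setT (fun y => Rintegral leb setT (F y)).
  apply: eq_Rintegral => y _; rewrite pE//.
  rewrite /F RintegralZl; [|exact: measurableT|]; last first.
    by have := integrableZl measurableT c (intcs y t0); apply: eq_integrable.
  rewrite RintegralZl; [|exact: measurableT|exact: intcs].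
  exact: mulrC.
rewrite (Rintegral_fubini sf sf (gauss_integrable n d0) ic mF bF).
apply: eq_Rintegral => eta _.
have -> : Rintegral leb setT (F^~ eta) =
    Rintegral leb setT (fun y => (c * symbol s t eta * 2^-1) * (cos (vdot (vsub xi eta) y + 0) * expR (- d * vdot y y) + cos (vdot (vsub (vsub (vzero R n) xi) eta) y + 0) * expR (- d * vdot y y))).
  apply: eq_Rintegral => y _; rewrite /F !addr0 !vdotBl vdot0l (vdotC y xi) (vdotC y eta).
  rewrite (_ : 0 - vdot xi y - vdot eta y = - (vdot xi y + vdot eta y)); last by ring.
  by rewrite cosN cosB cosD; field.
have ig z : leb.-integrable setT (EFin \o (fun y => cos (vdot z y + 0) * expR (- d * vdot y y))).
  apply: (@integrable_ler R _ _ _ _ (fun y => expR (- d * vdot y y))); last exact: gauss_integrable.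
    by apply: measurable_funM; [exact: measurable_cosd|exact: measurable_gauss].
  by move=> y; rewrite normrM (ger0_norm (expR_ge0 _)) ler_piMl ?expR_ge0 ?cos_max.
rewrite RintegralZl; [|exact: measurableT|by have := integrableD measurableT (ig (vsub xi eta)) (ig (vsub (vsub (vzero R n) xi) eta)); apply: eq_integrable].
rewrite RintegralD; [|exact: measurableT|exact: ig|exact: ig].
rewrite !gauss_fourier// !cos0 !mulr1 /K -(const_eq (pi_gt0 R) b0) -/c -/d.
have E z : - vdot z z / (4 * d) = - b * vdot z z by rewrite /d; field; rewrite gt_eqF.
rewrite !E.
move: (Num.sqrt (pi / d) ^+ n.+1) c (symbol s t eta) (expR (- b * vdot (vsub xi eta) (vsub xi eta)))
  (expR _) => q1 q2 q3 q4 q5.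
ring.
Qed.

Lemma heat_kernel_regularised_cvg t xi : 0 < t ->
  Rintegral leb setT (fun y => p t y * (cos (vdot y xi) * expR (- (4 * k.+1%:R)^-1 * vdot y y))) @[k --> \oo]
    --> symbol s t xi.
Proof.
move=> t0; under eq_fun do rewrite (regularised _ t0 (ltr0Sn _ _)).
rewrite (_ : symbol s t xi = 2^-1 * (symbol s t xi + symbol s t (vsub (vzero R n) xi))); last first.
  by rewrite symbolN; field.
by apply: cvgM; [exact: cvg_cst|apply: cvgD; exact: approx_cvg].
Qed.
End HeatKernelTheory.

Lemma monotone_cvg_integral (R : realType) d (T : measurableType d) (m : {measure set T -> \bar R})
    (g : nat -> T -> \bar R) (f : T -> \bar R) :
  (forall k, measurable_fun setT (g k)) -> (forall k x, 0 <= g k x)%E ->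
  (forall x, nondecreasing_seq (g^~ x)) -> (forall x, g^~ x @ \oo --> f x) ->
  (\int[m]_x g k x)%E @[k --> \oo] --> (\int[m]_x f x)%E.
Proof.
move=> mg g0 ndg gf.
have := @cvg_monotone_convergence _ _ _ m setT measurableT g mg (fun k x _ => g0 k x) (fun x _ => ndg x).
rewrite [X in _ -> _ --> X](_ : _ = \int[m]_x limn (g^~ x))%E//.
by apply: eq_integral => x _; apply/esym/cvg_lim => //; exact: gf.
Qed.

(** * From regularised inversion to unit mass and the convolution law *)

Section HeatSemigroup.
Variable R : realType.
Variables (n : nat) (s : R).
Hypothesis s01 : 0 < s < 1.
Local Notation leb := (lebN R n).
Local Notation RN := (RN R n).
Local Notation mu := (@lebesgue_measure R).
Implicit Types (x y z : RN) (t r : R).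
Local Notation p t := (heat_kernel s t : RN -> R).

Let sf := @lebN_sigma_finite R n.
Let c : R := (2 * pi) ^- n.+1.
Let c0 : 0 < c.
Proof. by rewrite invr_gt0; apply: exprn_gt0; apply: mulr_gt0; [|exact: pi_gt0]. Qed.

Let p0 t z : 0 < t -> 0 <= p t z. Proof. exact: heat_kernel_ge0. Qed.

Lemma heat_kernel_bound t : 0 < t -> exists C, forall z, p t z <= C.
Proof.
move=> t0; exists (c * Rintegral leb setT (symbol s t)) => z.
rewrite heat_kernelE// -/c; apply: ler_wpM2l; first exact: ltW.
have i1 : leb.-integrable setT (EFin \o (fun x => cos (vdot z x) * symbol s t x)).
  apply: (@integrable_ler R _ _ _ _ (symbol s t)); last exact: symbol_integrable.
    by apply: measurable_funM; [exact: measurable_cosz|exact: measurable_symbol].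
  by move=> y; rewrite normrM (ger0_norm (symbol_ge0 _ _ _)) ler_piMl ?symbol_ge0 ?cos_max.
apply: le_Rintegral; [exact: measurableT|exact: i1|exact: symbol_integrable|].
by move=> x _; rewrite ler_piMl ?symbol_ge0// cos_le1.
Qed.

Let dl k : R := (4 * k.+1%:R)^-1.
Let dl0 k : 0 < dl k. Proof. by rewrite invr_gt0 mulr_gt0. Qed.

Let dlcvg : dl k @[k --> \oo] --> (0 : R).
Proof.
rewrite (_ : dl = fun k => 4^-1 * harmonic k); last by apply/funext => k; rewrite /dl invfM.
by rewrite -[X in _ --> X](mulr0 (4^-1 : R)); apply: cvgM; [exact: cvg_cst|exact: cvg_harmonic].
Qed.

Let gcvg y : expR (- dl k * vdot y y) @[k --> \oo] --> (1 : R).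
Proof.
rewrite -expR0; apply: continuous_cvg; first exact: continuous_expR.
rewrite (_ : 0 = - 0 * vdot y y); last by rewrite oppr0 mul0r.
by apply: cvgM; [apply: cvgN; exact: dlcvg|exact: cvg_cst].
Qed.

(** Integrability of p_t is not yet known. Since p_t is nonnegative, the damped kernels increase to
    it, and monotone convergence identifies the mass with the limit of their transforms at frequency
    0, where the symbol is 1. *)
Lemma heat_kernel_integral t : 0 < t -> (\int[leb]_y (p t y)%:E = 1)%E.
Proof.
move=> t0.
have mp := @measurable_heat_kernel R n s t.
pose f k y := p t y * expR (- dl k * vdot y y).
have mf k : measurable_fun setT (f k) by apply: measurable_funM; [exact: mp|exact: measurable_gauss].
have f0 k y : 0 <= f k y by rewrite mulr_ge0 ?p0 ?expR_ge0.
have [C pC] := heat_kernel_bound t0.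
have ifk k : leb.-integrable setT (EFin \o f k).
  apply: (@integrable_ler R _ _ _ _ (fun y => C * expR (- dl k * vdot y y))) => //.
    by move=> y; rewrite ger0_norm// ler_wpM2r ?expR_ge0.
  by have := integrableZl measurableT C (@gauss_integrable R n _ (dl0 k)); apply: eq_integrable.
have L1 : (\int[leb]_y (f k y)%:E)%E @[k --> \oo] --> (\int[leb]_y (p t y)%:E)%E.
  apply: (@monotone_cvg_integral _ _ _ leb (fun k y => (f k y)%:E)).
  - by move=> k; exact/measurable_EFinP.
  - by move=> k y; rewrite lee_fin.
  - move=> y a b ab; rewrite lee_fin ler_wpM2l ?p0// ler_expR ler_wpM2r ?vdot_ge0// lerN2.
    by rewrite lef_pV2 ?posrE ?mulr_gt0// ler_pM2l// ler_nat ltnS.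
  - move=> y; apply: cvg_EFinT; rewrite -[X in _ --> X]mulr1.
    by apply: cvgM; [exact: cvg_cst|exact: gcvg].
have L2 := @heat_kernel_regularised_cvg R n s s01 t (vzero R n) t0.
have symb0 : symbol s t (vzero R n) = 1.
  (* [powR 0 0] is 1, so the value of the symbol at the origin depends on s being nonzero. *)
  have sn0 : s != 0 by apply: lt0r_neq0; case/andP: s01.
  by rewrite /symbol vdot0 (powR0 sn0) mulr0 expR0 mulr1.
rewrite symb0 in L2.
have L3 : (\int[leb]_y (f k y)%:E)%E @[k --> \oo] --> (1 : \bar R)%E.
  rewrite (_ : (fun k => _) = fun k => (Rintegral leb setT (fun y => p t y * (cos (vdot y (vzero R n)) * expR (- (4 * k.+1%:R)^-1 * vdot y y))))%:E).
    apply: cvg_EFinT; exact: L2.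
  apply/funext => k.
  have -> : Rintegral leb setT (fun y => p t y * (cos (vdot y (vzero R n)) * expR (- (4 * k.+1%:R)^-1 * vdot y y))) = Rintegral leb setT (f k).
    by apply: eq_Rintegral => y _; rewrite vdot0 cos0 mul1r.
  by rewrite /Rintegral fineK//; exact: (integrable_fin_num measurableT (ifk k)).
exact: (cvg_unique _ L1 L3).
Qed.

Lemma heat_kernel_integrable t : 0 < t -> leb.-integrable setT (EFin \o p t).
Proof.
move=> t0; apply/integrableP; split; first by apply/measurable_EFinP; exact: measurable_heat_kernel.
rewrite (eq_integral (fun y => (p t y)%:E)); first by rewrite heat_kernel_integral// ltry.
by move=> y _; rewrite /= ger0_norm ?p0.
Qed.

(** With integrability of p_t now available, p_t itself dominates the damped integrands. *)
Lemma heat_kernel_fourier t xi : 0 < t ->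
  Rintegral leb setT (fun y => p t y * cos (vdot y xi)) = symbol s t xi.
Proof.
move=> t0; have L2 := @heat_kernel_regularised_cvg R n s s01 t xi t0.
have mc : measurable_fun setT (fun y : RN => cos (vdot y xi)).
  by apply: measurableT_comp; [exact: measurable_cos|exact: (@measurable_fun_vdot R _ _ n id (cst xi))].
have mp := @measurable_heat_kernel R n s t.
have cv y : p t y * (cos (vdot y xi) * expR (- dl k * vdot y y)) @[k --> \oo] --> p t y * cos (vdot y xi).
  rewrite -[X in _ --> X]mulr1 -mulrA; apply: cvgM; first exact: cvg_cst.
  by apply: cvgM; [exact: cvg_cst|exact: gcvg].
have dom k y : `|p t y * (cos (vdot y xi) * expR (- dl k * vdot y y))| <= p t y.
  rewrite normrM (ger0_norm (p0 _ t0)) ler_piMr ?p0// normrM (ger0_norm (expR_ge0 _)).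
  rewrite mulr_ile1 ?expR_ge0 ?cos_max// -expR0 ler_expR mulNr oppr_le0.
  by rewrite mulr_ge0 ?vdot_ge0// ltW.
have [_ L1] := @Rintegral_dominated_cvg R _ _ leb _ _ _
  (fun k => measurable_funM mp (measurable_funM mc (@measurable_gauss R n (dl k)))) cv dom
  (heat_kernel_integrable t0).
exact: (cvg_unique _ L1 L2).
Qed.

Let integrable_pr t x : 0 < t -> leb.-integrable setT (EFin \o (fun y => p t (vsub x y))).
Proof. by move=> t0; apply: integrable_reflect; exact: heat_kernel_integrable. Qed.

Let msub x : measurable_fun setT (fun y : RN => vsub x y).
Proof. exact: (@measurable_fun_vsub R _ _ n (cst x) id). Qed.

Let mpr t x : measurable_fun setT (fun y => p t (vsub x y)).
Proof. exact: (measurableT_comp (@measurable_heat_kernel R n s t) (msub x)). Qed.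

Let mcosr x : measurable_fun setT (fun y : RN => cos (vdot y x)).
Proof. by apply: measurableT_comp; [exact: measurable_cos|exact: (@measurable_fun_vdot R _ _ n id (cst x))]. Qed.

(** Because p_t is even, the phases x.xi - y.xi and x.xi + y.xi give the same integral; their
    average contains no sine. *)
Let conv_cos t x xi : 0 < t ->
  Rintegral leb setT (fun y => p t (vsub x y) * cos (vdot y xi)) = cos (vdot x xi) * symbol s t xi.
Proof.
move=> t0.
have mp := @measurable_heat_kernel R n s t.
have ic (th sg : R) : leb.-integrable setT (EFin \o (fun y => p t y * cos (th + sg * vdot y xi))).
  apply: (@integrable_ler R _ _ _ _ (p t)); last exact: heat_kernel_integrable.
    apply: measurable_funM; first exact: mp.
    apply: measurableT_comp; first exact: measurable_cos.
    apply: measurable_funD; first exact: measurable_cst.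
    apply: measurable_funM; first exact: measurable_cst.
    exact: (@measurable_fun_vdot R _ _ n id (cst xi)).
  by move=> y; rewrite normrM (ger0_norm (p0 _ t0)) ler_piMr ?p0 ?cos_max.
have E1 : Rintegral leb setT (fun y => p t (vsub x y) * cos (vdot y xi)) =
    Rintegral leb setT (fun y => p t y * cos (vdot x xi + (-1) * vdot y xi)).
  rewrite -(Rintegral_reflect x); last by apply: measurable_funM; [exact: mpr|exact: mcosr].
  by apply: eq_Rintegral => y _; rewrite vsub_subK vdotBl mulN1r.
have E2 : Rintegral leb setT (fun y => p t (vsub x y) * cos (vdot y xi)) =
    Rintegral leb setT (fun y => p t y * cos (vdot x xi + 1 * vdot y xi)).
  rewrite E1 -(Rintegral_reflect (vzero R n)); last first.
    by apply/measurable_EFinP; exact: (measurable_int leb (ic _ _)).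
  apply: eq_Rintegral => y _; rewrite heat_kernelN// vdotBl vdot0l mul1r; congr (_ * cos _); ring.
have two : 2 != 0 :> R by [].
apply: (mulfI two); rewrite mulr2n mulrDl mul1r {1}E1 E2.
rewrite -RintegralD; [|exact: measurableT|exact: ic|exact: ic].
rewrite -(heat_kernel_fourier xi t0).
have -> : Rintegral leb setT (fun y => p t y * cos (vdot x xi + (-1) * vdot y xi) + p t y * cos (vdot x xi + 1 * vdot y xi)) =
   Rintegral leb setT (fun y => (2 * cos (vdot x xi)) * (p t y * cos (vdot y xi))).
  by apply: eq_Rintegral => y _; rewrite mulN1r mul1r cosB cosD; ring.
rewrite RintegralZl; [by rewrite mulrA|exact: measurableT|].
by have := ic 0 1; apply: eq_integrable => // y _ /=; rewrite add0r mul1r.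
Qed.

Lemma symbolD t r (xi : RN) : symbol s (t + r) xi = symbol s t xi * symbol s r xi.
Proof. by rewrite /symbol opprD !mulrDl !expRD; ring. Qed.

(** Expand p_r as a cosine integral, exchange, and apply [conv_cos]: the two symbols multiply to the
    symbol at time t + r. *)
Let semigroup_R t r x : 0 < t -> 0 < r ->
  Rintegral leb setT (fun y => p t (vsub x y) * p r y) = p (t + r) x.
Proof.
move=> t0 r0.
pose F y eta := p t (vsub x y) * (c * (cos (vdot y eta) * symbol s r eta)).
have mF : measurable_fun setT (fun w : RN * RN => F w.1 w.2).
  apply: measurable_funM; first exact: (measurableT_comp (mpr t x) (@measurable_fst _ _ _ _)).
  apply: measurable_funM; first exact: measurable_cst.
  apply: measurable_funM; last exact: (measurableT_comp (@measurable_symbol R n s r) (@measurable_snd _ _ _ _)).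
  by apply: measurableT_comp; [exact: measurable_cos|exact: measurable_vdot].
have bF y eta : `|F y eta| <= p t (vsub x y) * (c * symbol s r eta).
  rewrite /F normrM (ger0_norm (p0 _ t0)) ler_wpM2l ?p0// normrM (ger0_norm (ltW c0)) ler_wpM2l ?(ltW c0)//.
  by rewrite normrM (ger0_norm (symbol_ge0 _ _ _)) ler_piMl ?symbol_ge0 ?cos_max.
have ic : leb.-integrable setT (EFin \o (fun eta => c * symbol s r eta)).
  by have := integrableZl measurableT c (symbol_integrable n s r0); apply: eq_integrable.
have ics y r' : 0 < r' -> leb.-integrable setT (EFin \o (fun eta => cos (vdot y eta) * symbol s r' eta)).
  move=> r'0; apply: (@integrable_ler R _ _ _ _ (symbol s r')); last exact: symbol_integrable.
    by apply: measurable_funM; [exact: measurable_cosz|exact: measurable_symbol].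
  by move=> eta; rewrite normrM (ger0_norm (symbol_ge0 _ _ _)) ler_piMl ?symbol_ge0 ?cos_max.
have -> : Rintegral leb setT (fun y => p t (vsub x y) * p r y) = Rintegral leb setT (fun y => Rintegral leb setT (F y)).
  apply: eq_Rintegral => y _; rewrite [p r y](heat_kernelE s01)// -/c /F.
  rewrite RintegralZl; [|exact: measurableT|]; last first.
    by have := integrableZl measurableT c (ics y r r0); apply: eq_integrable.
  by rewrite RintegralZl; [|exact: measurableT|exact: ics].
rewrite (Rintegral_fubini sf sf (integrable_pr x t0) ic mF bF).
rewrite (heat_kernelE s01); last exact: addr_gt0.
rewrite -/c -RintegralZl; [|exact: measurableT|by apply: ics; exact: addr_gt0].
apply: eq_Rintegral => eta _.
have -> : Rintegral leb setT (F^~ eta) =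
   Rintegral leb setT (fun y => (c * symbol s r eta) * (p t (vsub x y) * cos (vdot y eta))).
  by apply: eq_Rintegral => y _; rewrite /F; ring.
rewrite RintegralZl; [|exact: measurableT|].
  by rewrite conv_cos// symbolD; ring.
apply: (@integrable_ler R _ _ _ _ (fun y => p t (vsub x y))); last exact: integrable_pr.
  by apply: measurable_funM; [exact: mpr|exact: mcosr].
by move=> y; rewrite normrM (ger0_norm (p0 _ t0)) ler_piMr ?p0 ?cos_max.
Qed.

Lemma heat_kernel_semigroup t r x z : 0 < t -> 0 < r ->
  (\int[leb]_y (p t (vsub x y) * p r (vsub y z))%:E = (p (t + r) (vsub x z))%:E)%E.
Proof.
move=> t0 r0.
have [C pC] := heat_kernel_bound r0.
have mp2 : measurable_fun setT (fun y => p t y * p r (vsub (vsub x z) y)).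
  by apply: measurable_funM; [exact: measurable_heat_kernel|exact: mpr].
(* The substitution y -> x - y exchanges the roles of [t] and [r]; hence the commuted sum below. *)
rewrite -(@ge0_integral_reflect R n x (fun y => (p t (vsub x y) * p r (vsub y z))%:E)); last 2 first.
- apply/measurable_EFinP; apply: measurable_funM; first exact: mpr.
  apply: (measurableT_comp (@measurable_heat_kernel R n s r)).
  exact: (@measurable_fun_vsub R _ _ n id (cst z)).
- by move=> y; rewrite lee_fin mulr_ge0 ?p0.
rewrite (eq_integral (fun y => (p r (vsub (vsub x z) y) * p t y)%:E)); last first.
  move=> y _; rewrite vsub_subK (vsub_subAC x y z).
  exact: (congr1 EFin (mulrC _ _)).
rewrite [t + r]addrC.
apply: (etrans _ (congr1 EFin (semigroup_R (vsub x z) r0 t0))).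
rewrite /Rintegral fineK; [reflexivity|].
apply: (integrable_fin_num measurableT).
apply: (@integrable_ler R _ _ _ _ (fun y => C * p t y)).
- by apply: measurable_funM; [exact: mpr|exact: measurable_heat_kernel].
- move=> y; rewrite ger0_norm; [|by apply: mulr_ge0; exact: p0].
  by apply: ler_wpM2r; [exact: p0|exact: pC].
- by have := integrableZl measurableT C (heat_kernel_integrable t0); apply: eq_integrable.
Qed.

Lemma heat_kernel_integral_sub t x : 0 < t -> (\int[leb]_y (p t (vsub x y))%:E = 1)%E.
Proof.
move=> t0; rewrite (@ge0_integral_reflect R n x (fun y => (p t y)%:E)).
- exact: heat_kernel_integral.
- by apply/measurable_EFinP; exact: measurable_heat_kernel.
- by move=> y; rewrite lee_fin p0.
Qed.

Lemma heat_kernel_integral_subl t y : 0 < t -> (\int[leb]_x (p t (vsub x y))%:E = 1)%E.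
Proof.
move=> t0; rewrite -(heat_kernel_integral_sub y t0).
by apply: eq_integral => x _; rewrite heat_kernel_sym.
Qed.

End HeatSemigroup.

(** * The semigroup on nonnegative functions *)

(** The integral of a nonnegative function is a supremum over the simple functions below it, so
    monotonicity holds for arbitrary functions, measurable or not. *)
Lemma le_integral_ge0 (R : realType) d (T : measurableType d) (m : {measure set T -> \bar R})
    (D : set T) (f1 f2 : T -> \bar R) :
  (forall x, D x -> 0 <= f1 x)%E -> (forall x, D x -> f1 x <= f2 x)%E ->
  (\int[m]_(x in D) f1 x <= \int[m]_(x in D) f2 x)%E.
Proof.
move=> f10 f12; have f20 x : D x -> (0 <= f2 x)%E by move=> Dx; exact: le_trans (f10 _ Dx) (f12 _ Dx).
rewrite !ge0_integralE//; apply: le_ereal_sup => _ [h hf <-]; exists h => // x.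
apply: le_trans (hf x) _; rewrite !patchE; case: ifPn => // /set_mem; exact: f12.
Qed.

(** * Extension to the line of functions continuous on [0, oo) *)

Section ContinuousExtension.
Variable R : realType.
Variable h : R -> R.
Hypothesis hc : {within `[0%R, +oo[%classic, continuous h}.

(** Constancy to the left of 0 turns right continuity at 0 into continuity. *)
Lemma continuous_extend_max : continuous (fun x : R => h (Num.max x 0)).
Proof.
have [hi h0] := (continuous_within_itvcyP 0 h).1 hc.
move=> x; have [x0|x0|->] := ltgtP x 0.
- rewrite /continuous_at (_ : Num.max x 0 = 0); last by apply/max_idPr; exact: ltW.
  apply: cvg_near_cst; near=> y; rewrite (_ : Num.max y 0 = 0)//; apply/max_idPr; apply: ltW.
  by near: y; exact: lt_nbhsl.
- rewrite /continuous_at (_ : Num.max x 0 = x); last by apply/max_idPl; exact: ltW.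
  have hx : h y @[y --> x] --> h x by apply: hi; rewrite in_itv/= x0.
  apply: cvg_trans hx; apply: near_eq_cvg; near=> y.
  rewrite (_ : Num.max y 0 = y)//; apply/max_idPl; apply: ltW.
  by near: y; exact: lt_nbhsr.
- apply/left_right_continuousP; rewrite maxxx; split.
    apply: cvg_near_cst; near=> y; rewrite (_ : Num.max y 0 = 0)//; apply/max_idPr; apply: ltW.
    by near: y; exact: nbhs_left_lt.
  apply: cvg_trans h0; apply: near_eq_cvg; near=> y.
  rewrite (_ : Num.max y 0 = y)//; apply/max_idPl; apply: ltW.
  by near: y; exact: nbhs_right_gt.
Unshelve. all: end_near. Qed.

Lemma measurable_extend_max : measurable_fun setT (fun x : R => h (Num.max x 0)).
Proof. by apply: continuous_measurable_fun; exact: continuous_extend_max. Qed.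

End ContinuousExtension.

Section Semigroup.
Variable R : realType.
Variables (n : nat) (s : R).
Hypothesis s01 : 0 < s < 1.
Local Notation leb := (lebN R n).
Local Notation RN := (RN R n).
Local Notation mu := (@lebesgue_measure R).
Local Notation RT := (RN * measurableTypeR R)%type.
Implicit Types (x y z : RN) (t r : R) (v : RN -> \bar R).
Local Notation p t := (heat_kernel s t : RN -> R).
Local Opaque heat_kernel.
Let sf := @lebN_sigma_finite R n.

(** The extended-real counterpart of [semigroup], to which Tonelli applies for all nonnegative
    measurable data. *)
Definition heatS t v x : \bar R := (\int[leb]_y ((p t (vsub x y))%:E * v y))%E.

Let p0 t z : 0 < t -> 0 <= p t z. Proof. exact: heat_kernel_ge0. Qed.
Let pe0 t z : 0 < t -> (0 <= (p t z)%:E)%E. Proof. by move=> ?; rewrite lee_fin p0. Qed.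

Lemma measurable_heat_kernel_sub t : measurable_fun setT (fun w : RN * RN => (p t (vsub w.1 w.2))%:E).
Proof.
apply/measurable_EFinP; exact: (measurableT_comp (@measurable_heat_kernel R n s t) (@measurable_vsub R n)).
Qed.

Lemma measurable_heat_kernel_subr t x : measurable_fun setT (fun y : RN => (p t (vsub x y))%:E).
Proof. exact: (measurableT_comp (measurable_heat_kernel_sub t) (measurable_pair1 x)). Qed.

Lemma measurable_heat_kernel_subl t y : measurable_fun setT (fun x : RN => (p t (vsub x y))%:E).
Proof. exact: (measurableT_comp (measurable_heat_kernel_sub t) (measurable_pair2 y)). Qed.

Lemma measurable_heat_integrand t v : measurable_fun setT v ->
  measurable_fun setT (fun w : RN * RN => (p t (vsub w.1 w.2))%:E * v w.2)%E.
Proof.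
move=> mv; apply: emeasurable_funM; first exact: measurable_heat_kernel_sub.
exact: (measurableT_comp mv (@measurable_snd _ _ _ _)).
Qed.

Lemma measurable_heatS t v : 0 < t -> measurable_fun setT v -> (forall y, 0 <= v y)%E ->
  measurable_fun setT (heatS t v).
Proof.
move=> t0 mv v0; apply: (measurable_integral_snd sf (f := fun x y => ((p t (vsub x y))%:E * v y)%E)).
  exact: measurable_heat_integrand.
by move=> x y; apply: mule_ge0 => //; exact: pe0.
Qed.

Lemma heatS_ge0 t v x : 0 < t -> (forall y, 0 <= v y)%E -> (0 <= heatS t v x)%E.
Proof. by move=> t0 v0; apply: integral_ge0 => y _; apply: mule_ge0 => //; exact: pe0. Qed.

Lemma heatS_semigroup t r v x : 0 < t -> 0 < r -> measurable_fun setT v -> (forall y, 0 <= v y)%E ->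
  heatS t (heatS r v) x = heatS (t + r) v x.
Proof.
move=> t0 r0 mv v0; rewrite /heatS.
rewrite (eq_integral (fun y => \int[leb]_z ((p t (vsub x y))%:E * ((p r (vsub y z))%:E * v z)))%E); last first.
  move=> y _; rewrite ge0_integralZl_EFin//.
  - by move=> z _; apply: mule_ge0 => //; exact: pe0.
  - by apply: emeasurable_funM => //; exact: measurable_heat_kernel_subr.
  - exact: p0.
rewrite (ge0_fubini sf sf); last 2 first.
- apply: emeasurable_funM; last exact: measurable_heat_integrand.
  exact: (measurableT_comp (measurable_heat_kernel_subr t x) (@measurable_fst _ _ _ _)).
- by move=> y z; apply: mule_ge0; [exact: pe0|apply: mule_ge0 => //; exact: pe0].
apply: eq_integral => z _.
rewrite (eq_integral (fun y => ((p t (vsub x y) * p r (vsub y z))%:E * v z))%E); last first.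
  by move=> y _; rewrite [in RHS]EFinM; exact: muleA.
rewrite ge0_integralZr//.
- by rewrite (heat_kernel_semigroup s01 x z t0 r0).
- apply: (emeasurable_funM (f := fun y => (p t (vsub x y))%:E) (g := fun y => (p r (vsub y z))%:E)).
    exact: measurable_heat_kernel_subr.
  exact: measurable_heat_kernel_subl.
- by move=> y _; rewrite lee_fin; apply: mulr_ge0; exact: p0.
Qed.

(** Tonelli and the unit mass of the kernel in its first variable. Conservation of mass is what
    later shows that the flow of a nonzero datum does not vanish. *)
Lemma integral_heatS t v : 0 < t -> measurable_fun setT v -> (forall y, 0 <= v y)%E ->
  (\int[leb]_x heatS t v x = \int[leb]_y v y)%E.
Proof.
move=> t0 mv v0; rewrite /heatS (ge0_fubini sf sf); last 2 first.
- exact: measurable_heat_integrand.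
- by move=> y z; apply: mule_ge0 => //; exact: pe0.
apply: eq_integral => y _; rewrite ge0_integralZr//.
- by rewrite heat_kernel_integral_subl// mul1e.
- exact: measurable_heat_kernel_subl.
- by move=> z _; exact: pe0.
Qed.

Lemma ae_le_heatS t v w x : 0 < t -> measurable_fun setT v -> (forall y, 0 <= v y)%E ->
  measurable_fun setT w -> (forall y, 0 <= w y)%E ->
  {ae leb, forall y, (v y <= w y)%E} -> (heatS t v x <= heatS t w x)%E.
Proof.
move=> t0 mv v0 mw w0 vw; apply: ae_ge0_le_integral => //.
- by move=> y _; apply: mule_ge0 => //; exact: pe0.
- by apply: emeasurable_funM => //; exact: measurable_heat_kernel_subr.
- by move=> y _; apply: mule_ge0 => //; exact: pe0.
- by apply: emeasurable_funM => //; exact: measurable_heat_kernel_subr.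
by apply: filterS vw => y vwy _; apply: lee_wpmul2l => //; exact: pe0.
Qed.

Lemma heatSZ t v x (k : R) : 0 < t -> 0 <= k -> measurable_fun setT v -> (forall y, 0 <= v y)%E ->
  heatS t (fun y => k%:E * v y)%E x = (k%:E * heatS t v x)%E.
Proof.
move=> t0 k0 mv v0; rewrite /heatS -ge0_integralZl_EFin//.
- by apply: eq_integral => y _; rewrite muleCA.
- by move=> y _; apply: mule_ge0 => //; exact: pe0.
- by apply: emeasurable_funM => //; exact: measurable_heat_kernel_subr.
Qed.

Lemma heatS_cst t x (M : R) : 0 < t -> 0 <= M -> heatS t (cst M%:E) x = M%:E.
Proof.
move=> t0 M0; rewrite /heatS ge0_integralZr//.
- by rewrite heat_kernel_integral_sub// mul1e.
- exact: measurable_heat_kernel_subr.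
- by move=> y _; exact: pe0.
Qed.

Lemma heatS_le t v x (M : R) : 0 < t -> 0 <= M -> measurable_fun setT v -> (forall y, 0 <= v y)%E ->
  {ae leb, forall y, (v y <= M%:E)%E} -> (heatS t v x <= M%:E)%E.
Proof.
move=> t0 M0 mv v0 vM; rewrite -(heatS_cst x t0 M0).
by apply: ae_le_heatS => //; move=> y; rewrite lee_fin.
Qed.

Lemma semigroupE t (u : RN -> R) x : semigroup s t u x = fine (heatS t (EFin \o u) x).
Proof. by []. Qed.

Lemma ae_eq_heatS t v w x : measurable_fun setT v -> measurable_fun setT w ->
  {ae leb, forall y, v y = w y} -> heatS t v x = heatS t w x.
Proof.
move=> mv mw vw; apply: ae_eq_integral => //.
- by apply: emeasurable_funM => //; exact: measurable_heat_kernel_subr.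
- by apply: emeasurable_funM => //; exact: measurable_heat_kernel_subr.
by apply: filterS vw => y vwy _; rewrite vwy.
Qed.

End Semigroup.

(** * The Duhamel operator on space-time functions *)

Section Duhamel.
Variable R : realType.
Variables (n : nat) (s : R).
Hypothesis s01 : 0 < s < 1.
Local Notation leb := (lebN R n).
Local Notation RN := (RN R n).
Local Notation mu := (@lebesgue_measure R).
Local Notation RT := (RN * measurableTypeR R)%type.
Implicit Types (x y : RN) (t r : R) (z : RT) (w : RT -> R).
Local Notation p t := (heat_kernel s t : RN -> R).
Local Opaque heat_kernel.
Let sf := @lebN_sigma_finite R n.
Let smu := @sigma_finiteT _ _ _ mu.

(** Cut off at t <= 0, where positivity of [heat_kernel] is not established, so that sign and joint
    measurability hold at all times. *)
Definition hkernel t x : R := if 0 < t then heat_kernel s t x else 0.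

Lemma hkernel_ge0 t x : 0 <= hkernel t x.
Proof. by rewrite /hkernel; case: ifPn => // t0; exact: heat_kernel_ge0. Qed.

Lemma hkernelE t x : 0 < t -> hkernel t x = heat_kernel s t x.
Proof. by rewrite /hkernel => ->. Qed.

Lemma measurable_hkernel : measurable_fun setT (fun z : RT => hkernel z.2 z.1).
Proof.
apply: measurable_fun_ifT.
- by apply: measurable_fun_ltr; [exact: measurable_cst|exact: measurable_snd].
- exact: measurable_heat_kernel2.
- exact: measurable_cst.
Qed.

Variables h f : R -> R.
Hypothesis hc : {within `[0%R, +oo[%classic, continuous h}.
Hypothesis h0 : forall t, 0 <= t -> 0 <= h t.
Hypothesis fc : {within `[0%R, +oo[%classic, continuous f}.
Hypothesis f0 : forall a, 0 <= a -> 0 <= f a.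

Definition hpos t : R := if 0 < t then h (Num.max t 0) else 0.
Definition fpos (a : R) : R := f (Num.max a 0).

Lemma hpos_ge0 t : 0 <= hpos t.
Proof. by rewrite /hpos; case: ifPn => // t0; apply: h0; rewrite le_max lexx orbT. Qed.

Lemma hposE t : 0 < t -> hpos t = h t.
Proof. by rewrite /hpos => t0; rewrite t0; congr h; apply/max_idPl; exact: ltW. Qed.

Lemma measurable_hpos : measurable_fun setT hpos.
Proof.
apply: measurable_fun_ifT; [|exact: measurable_extend_max|exact: measurable_cst].
by apply: measurable_fun_ltr; [exact: measurable_cst|exact: measurable_id].
Qed.

Lemma fpos_ge0 (a : R) : 0 <= fpos a.
Proof. by apply: f0; rewrite le_max lexx orbT. Qed.

Lemma fposE (a : R) : 0 <= a -> fpos a = f a.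
Proof. by move=> a0; congr f; apply/max_idPl. Qed.

Lemma measurable_fpos : measurable_fun setT fpos.
Proof. exact: measurable_extend_max. Qed.

Lemma continuous_fpos : continuous fpos.
Proof. exact: continuous_extend_max. Qed.

Definition duhamel_kernel w z (sigma : R) y : R :=
  hkernel (z.2 - sigma) (vsub z.1 y) * (hpos sigma * fpos (w (y, sigma))).

Definition duhamel w z : \bar R :=
  (\int[mu]_sigma \int[leb]_y (duhamel_kernel w z sigma y)%:E)%E.

Lemma duhamel_kernel_ge0 w z (sigma : R) y : 0 <= duhamel_kernel w z sigma y.
Proof. by apply: mulr_ge0; [exact: hkernel_ge0|apply: mulr_ge0; [exact: hpos_ge0|exact: fpos_ge0]]. Qed.

Lemma measurable_duhamel_kernel w : measurable_fun setT w ->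
  measurable_fun setT (fun q : (RT * measurableTypeR R) * RN => duhamel_kernel w q.1.1 q.1.2 q.2).
Proof.
move=> mw.
have m1 : measurable_fun setT (fun q : (RT * measurableTypeR R) * RN => q.1) by exact: measurable_fst.
have my : measurable_fun setT (fun q : (RT * measurableTypeR R) * RN => q.2) by exact: measurable_snd.
have mz : measurable_fun setT (fun q : (RT * measurableTypeR R) * RN => q.1.1) by exact: (measurableT_comp (@measurable_fst _ _ _ _) m1).
have ms : measurable_fun setT (fun q : (RT * measurableTypeR R) * RN => q.1.2) by exact: (measurableT_comp (@measurable_snd _ _ _ _) m1).
have mx : measurable_fun setT (fun q : (RT * measurableTypeR R) * RN => q.1.1.1) by exact: (measurableT_comp (@measurable_fst _ _ _ _) mz).
have mt : measurable_fun setT (fun q : (RT * measurableTypeR R) * RN => q.1.1.2) by exact: (measurableT_comp (@measurable_snd _ _ _ _) mz).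
apply: measurable_funM; last apply: measurable_funM.
- apply: (measurableT_comp measurable_hkernel (g := fun q : (RT * measurableTypeR R) * RN => (vsub q.1.1.1 q.2, q.1.1.2 - q.1.2))).
  by apply: measurable_fun_pair; [exact: measurable_fun_vsub|exact: measurable_funB].
- exact: (measurableT_comp measurable_hpos ms).
- apply: (measurableT_comp measurable_fpos).
  by apply: (measurableT_comp mw (g := fun q : (RT * measurableTypeR R) * RN => (q.2, q.1.2))); exact: measurable_fun_pair.
Qed.

Lemma measurable_duhamel_inner2 w : measurable_fun setT w ->
  measurable_fun setT (fun q : RT * measurableTypeR R => \int[leb]_y (duhamel_kernel w q.1 q.2 y)%:E)%E.
Proof.
move=> mw; apply: (measurable_integral_snd sf (f := fun (q : RT * measurableTypeR R) y => (duhamel_kernel w q.1 q.2 y)%:E)).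
  by apply/measurable_EFinP; exact: measurable_duhamel_kernel.
by move=> q y; rewrite lee_fin duhamel_kernel_ge0.
Qed.

Lemma measurable_duhamel_inner w z : measurable_fun setT w ->
  measurable_fun setT (fun sigma : measurableTypeR R => \int[leb]_y (duhamel_kernel w z sigma y)%:E)%E.
Proof. by move=> mw; exact: (measurableT_comp (measurable_duhamel_inner2 mw) (measurable_pair1 z)). Qed.

Lemma measurable_duhamel_kernel_y w z (sigma : R) : measurable_fun setT w ->
  measurable_fun setT (fun y => duhamel_kernel w z sigma y).
Proof. by move=> mw; exact: (measurableT_comp (measurable_duhamel_kernel mw) (measurable_pair1 (z, sigma))). Qed.

Lemma duhamel_inner_ge0 w z (sigma : R) : (0 <= \int[leb]_y (duhamel_kernel w z sigma y)%:E)%E.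
Proof. by apply: integral_ge0 => y _; rewrite lee_fin duhamel_kernel_ge0. Qed.

Lemma duhamel_ge0 w z : (0 <= duhamel w z)%E.
Proof. by apply: integral_ge0 => sigma _; exact: duhamel_inner_ge0. Qed.

Lemma measurable_duhamel w : measurable_fun setT w -> measurable_fun setT (duhamel w).
Proof.
move=> mw; apply: (measurable_integral_snd smu (f := fun z (sigma : measurableTypeR R) => \int[leb]_y (duhamel_kernel w z sigma y)%:E)%E).
  exact: measurable_duhamel_inner2.
by move=> z sigma; exact: duhamel_inner_ge0.
Qed.

Lemma duhamel_le w1 w2 z : measurable_fun setT w1 -> measurable_fun setT w2 ->
  (forall z', fpos (w1 z') <= fpos (w2 z')) -> (duhamel w1 z <= duhamel w2 z)%E.
Proof.
move=> m1 m2 w12; apply: le_integral_ge0 => sigma _; first exact: duhamel_inner_ge0.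
apply: le_integral_ge0 => y _; first by rewrite lee_fin duhamel_kernel_ge0.
rewrite lee_fin; apply: ler_wpM2l; first exact: hkernel_ge0.
by apply: ler_wpM2l; [exact: hpos_ge0|exact: w12].
Qed.

(** Monotone convergence in y, then in sigma. Monotonicity is asked of f(w_k), since in the
    existence part [f] is monotone only on a bounded range. *)
Lemma duhamel_cvg (w_ : nat -> RT -> R) w z :
  (forall k, measurable_fun setT (w_ k)) -> (forall z', w_ ^~ z' @ \oo --> w z') ->
  (forall z' i j, (i <= j)%N -> fpos (w_ i z') <= fpos (w_ j z')) ->
  duhamel (w_ k) z @[k --> \oo] --> duhamel w z.
Proof.
move=> mw cw ndw.
have le_inner (i j : nat) (sigma : R) y : (i <= j)%N -> duhamel_kernel (w_ i) z sigma y <= duhamel_kernel (w_ j) z sigma y.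
  move=> ij; apply: ler_wpM2l; first exact: hkernel_ge0.
  by apply: ler_wpM2l; [exact: hpos_ge0|exact: ndw].
apply: (@monotone_cvg_integral _ _ _ mu (fun k sigma => \int[leb]_y (duhamel_kernel (w_ k) z sigma y)%:E)%E).
- by move=> k; exact: measurable_duhamel_inner.
- by move=> k sigma; exact: duhamel_inner_ge0.
- move=> sigma i j ij; apply: le_integral_ge0 => y _; first by rewrite lee_fin duhamel_kernel_ge0.
  by rewrite lee_fin; exact: le_inner.
move=> sigma; apply: (@monotone_cvg_integral _ _ _ leb (fun k y => (duhamel_kernel (w_ k) z sigma y)%:E)%E).
- by move=> k; apply/measurable_EFinP; exact: measurable_duhamel_kernel_y.
- by move=> k y; rewrite lee_fin duhamel_kernel_ge0.
- by move=> y i j ij; rewrite lee_fin; exact: le_inner.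
move=> y; apply: cvg_EFinT; apply: cvgM; first exact: cvg_cst.
apply: cvgM; first exact: cvg_cst.
by apply: (continuous_cvg _ (@continuous_fpos _)); exact: cw.
Qed.

(* The kernel truncations vanish outside 0 < sigma < t, so the integral in the definition of a mild solution is an integral over the whole line. *)
Lemma duhamelE w x t : (forall z, 0 <= w z) -> 0 < t ->
  (\int[mu]_(sigma in `]0%R, t[%classic)
     \int[leb]_y (heat_kernel s (t - sigma) (vsub x y) * (h sigma * f (w (y, sigma))))%:E)%E =
  duhamel w (x, t).
Proof.
move=> w0 t0; rewrite integral_mkcond; apply: eq_integral => sigma _.
rewrite patchE; case: ifPn => [/set_mem|/negP nin].
  rewrite /= in_itv/= => /andP[s0 st]; apply: eq_integral => y _.
  by rewrite /duhamel_kernel /= hkernelE ?subr_gt0// hposE// fposE.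
rewrite integral0_eq// => y _; rewrite /duhamel_kernel /=.
have [s0|s0] := ltP 0 sigma; last by rewrite /hpos ltNge s0/= mul0r mulr0.
rewrite /hkernel subr_gt0 ifN ?mul0r//; apply/negP => st.
by apply: nin; apply/mem_set; rewrite /= in_itv/= s0.
Qed.

End Duhamel.

(** * Global existence *)

Section GlobalExistence.
Variable R : realType.
Variables (n : nat) (s : R).
Hypothesis s01 : 0 < s < 1.
Local Notation leb := (lebN R n).
Local Notation RN := (RN R n).
Local Notation mu := (@lebesgue_measure R).
Local Notation RT := (RN * measurableTypeR R)%type.
Implicit Types (x y : RN) (t r : R) (z : RT) (w : RT -> R).
Local Notation p t := (heat_kernel s t : RN -> R).
Local Opaque heat_kernel.
Let sf := @lebN_sigma_finite R n.

Variables h f : R -> R.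
Hypothesis hc : {within `[0%R, +oo[%classic, continuous h}.
Hypothesis h0 : forall t, 0 <= t -> 0 <= h t.
Hypothesis fc : {within `[0%R, +oo[%classic, continuous f}.
Hypothesis f0 : forall a, 0 <= a -> 0 <= f a.
Hypothesis f00 : f 0 = 0.

Variable m : R.
Hypothesis m0 : 0 < m.
Hypothesis f_nd : forall a b, 0 < a -> a <= b -> b <= m -> f a <= f b.
Hypothesis fr_nd : forall a b, 0 < a -> a <= b -> b <= m -> f a / a <= f b / b.
Variable v0 : RN -> R.
Hypothesis v0X : in_X v0.
Hypothesis v0_ge0 : \forall x \ae leb, 0 <= v0 x.
Hypothesis v0_nz : ~ (\forall x \ae leb, v0 x = 0).
Hypothesis v0m : (Linf_norm v0 <= m%:E)%E.
Local Notation N sigma := (fine (Linf_norm (semigroup s sigma v0))).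
Hypothesis v0_small : (\int[mu]_(sigma in `]0%R, +oo[%classic) (h sigma * f (N sigma) / N sigma)%:E < 1)%E.

(** An everywhere nonnegative representative of [v0], whose sign is prescribed almost everywhere
    only. *)
Let v x : \bar R := (Num.max (v0 x) 0)%:E.

Let mv : measurable_fun setT v.
Proof.
have [mv0 _] := v0X; apply/measurable_EFinP.
by apply: measurable_maxr => //; exact: measurable_cst.
Qed.

Let v_ge0 x : (0 <= v x)%E. Proof. by rewrite lee_fin le_max lexx orbT. Qed.

Let v_ae : {ae leb, forall x, v x = (v0 x)%:E}.
Proof. by apply: filterS v0_ge0 => x x0; rewrite /v; congr EFin; apply/max_idPl. Qed.

Let v_le : {ae leb, forall x, (v x <= m%:E)%E}.
Proof.
have /ess_supP H : (ess_sup leb (fun x => (`|v0 x|)%:E) <= m%:E)%E by exact: v0m.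
apply: filterS H => x; rewrite /v !lee_fin => H.
by rewrite ge_max (ltW m0) andbT; exact: le_trans (ler_norm _) H.
Qed.

Let v_int : (\int[leb]_x v x = L1_norm v0)%E.
Proof.
have [mv0 _] := v0X.
apply: ae_eq_integral => //.
- by apply/measurable_EFinP; exact: measurableT_comp.
by apply: filterS v0_ge0 => x x0 _; rewrite /v (ger0_norm x0); congr EFin; apply/max_idPl.
Qed.

Let V t x : \bar R := heatS s t v x.

Let mVx t : 0 < t -> measurable_fun setT (V t).
Proof. by move=> t0; exact: measurable_heatS. Qed.

Let V0 t x : 0 < t -> (0 <= V t x)%E. Proof. by move=> t0; exact: heatS_ge0. Qed.

Let Vm t x : 0 < t -> (V t x <= m%:E)%E.
Proof. by move=> t0; apply: heatS_le => //; exact: ltW. Qed.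

Let Vfin t x : 0 < t -> V t x \is a fin_num.
Proof.
by move=> t0; rewrite ge0_fin_numE ?V0//; apply: le_lt_trans (Vm x t0) _; rewrite ltry.
Qed.

Let VE t x : 0 < t -> heatS s t (EFin \o v0) x = V t x.
Proof.
move=> t0; apply: ae_eq_heatS => //.
  by have [mv0 _] := v0X; exact/measurable_EFinP.
by apply: filterS v_ae => y ->.
Qed.

Let VS t x : 0 < t -> semigroup s t v0 x = fine (V t x).
Proof. by move=> t0; rewrite semigroupE VE. Qed.

Let NE t : 0 < t -> (N t)%:E = Linf_norm (semigroup s t v0) /\ 0 <= N t <= m.
Proof.
move=> t0.
have Lm : (Linf_norm (semigroup s t v0 : RN -> R) <= m%:E)%E.
  apply/ess_supP; apply: aeW => x /=; rewrite VS//.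
  by rewrite ger0_norm ?fine_ge0 ?V0// fineK ?Vfin// Vm.
have L0 : (0 <= Linf_norm (semigroup s t v0 : RN -> R))%E.
  (* A nonnegative function has negative essential supremum only over a null space, and then [v0]
     would vanish almost everywhere. *)
  rewrite leNgt; apply/negP => L0.
  have := @ess_sup_ge _ _ _ leb (fun x => (`|semigroup s t v0 x|)%:E) => H.
  apply: v0_nz; apply: filterS H => x Hx; exfalso.
  by have := le_lt_trans Hx L0; rewrite lte_fin ltNge normr_ge0.
have Lf : Linf_norm (semigroup s t v0 : RN -> R) \is a fin_num.
  by rewrite ge0_fin_numE//; apply: le_lt_trans Lm _; rewrite ltry.
by split; [rewrite fineK|rewrite fine_ge0//= -lee_fin fineK].
Qed.

Let VN t : 0 < t -> {ae leb, forall x, (V t x <= (N t)%:E)%E}.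
Proof.
move=> t0; have [-> _] := NE t0.
have := @ess_sup_ge _ _ _ leb (fun x => (`|semigroup s t v0 x|)%:E).
apply: filterS => x; apply: le_trans.
by rewrite VS// -{1}(fineK (Vfin x t0)) lee_fin ler_norm.
Qed.

Let Q t : R := f (N t) / N t.

Let Q0 t : 0 < t -> 0 <= Q t.
Proof. by move=> t0; have [_ /andP[N0 _]] := NE t0; rewrite divr_ge0// f0. Qed.

Let f_ndm (a b : R) : 0 <= a -> a <= b -> b <= m -> f a <= f b.
Proof.
rewrite le_eqVlt => /orP[/eqP <- ab bm|a0 ab bm]; last exact: f_nd.
by rewrite f00 f0.
Qed.

(** For a > 0 the ratio f(a)/a is at most its value [Q t] at N t, because a <= N t <= m; at a = 0
    the left-hand side is f(0) = 0. *)
Let fQ t (a b : R) : 0 < t -> 0 <= a -> a <= b -> b <= N t -> fpos f a <= Q t * b.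
Proof.
move=> t0 a0 ab bN; rewrite fposE//; have [_ /andP[N0 Nm]] := NE t0.
move: a0; rewrite le_eqVlt => /orP[/eqP a0|a0].
  by rewrite -a0 f00 mulr_ge0 ?Q0//; rewrite a0.
have : f a / a <= Q t by apply: fr_nd => //; exact: le_trans ab bN.
rewrite ler_pdivrMr// => /le_trans; apply.
by rewrite ler_wpM2l ?Q0.
Qed.

Let Vf z : \bar R := (\int[leb]_y ((hkernel s z.2 (vsub z.1 y))%:E * v y))%E.

Let Vf0 z : (0 <= Vf z)%E.
Proof. by apply: integral_ge0 => y _; apply: mule_ge0 => //; rewrite lee_fin hkernel_ge0. Qed.

Let VfE x t : 0 < t -> Vf (x, t) = V t x.
Proof. by move=> t0; apply: eq_integral => y _; rewrite /= hkernelE. Qed.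

Let Vf_le0 x t : t <= 0 -> Vf (x, t) = 0%E.
Proof. by move=> t0; rewrite /Vf integral0_eq// => y _; rewrite /hkernel /= ltNge t0 mul0e. Qed.

Let Vfm z : (Vf z <= m%:E)%E.
Proof.
case: z => x t; have [t0|t0] := ltP 0 t; first by rewrite VfE// Vm.
by rewrite Vf_le0// lee_fin ltW.
Qed.

Let Vffin z : Vf z \is a fin_num.
Proof. by rewrite ge0_fin_numE//; apply: le_lt_trans (Vfm z) _; rewrite ltry. Qed.

Let mVf : measurable_fun setT Vf.
Proof.
apply: (measurable_integral_snd sf (f := fun z y => ((hkernel s z.2 (vsub z.1 y))%:E * v y)%E)).
  apply: emeasurable_funM; last exact: (measurableT_comp mv (@measurable_snd _ _ _ _)).
  apply/measurable_EFinP.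
  apply: (measurableT_comp (@measurable_hkernel R n s) (g := fun q : RT * RN => (vsub q.1.1 q.2, q.1.2))).
  have m1 : measurable_fun setT (fun q : RT * RN => q.1) by exact: measurable_fst.
  have m2 : measurable_fun setT (fun q : RT * RN => q.2) by exact: measurable_snd.
  have mx : measurable_fun setT (fun q : RT * RN => q.1.1) by exact: (measurableT_comp (@measurable_fst _ _ _ _) m1).
  have mt : measurable_fun setT (fun q : RT * RN => q.1.2) by exact: (measurableT_comp (@measurable_snd _ _ _ _) m1).
  by apply: measurable_fun_pair => //; exact: measurable_fun_vsub.
by move=> z y; apply: mule_ge0 => //; rewrite lee_fin hkernel_ge0.
Qed.

Let I : \bar R := (\int[mu]_(sigma in `]0%R, +oo[%classic) (h sigma * f (N sigma) / N sigma)%:E)%E.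
Let A : R := fine I.

Let I0 : (0 <= I)%E.
Proof.
apply: integral_ge0 => t /=; rewrite in_itv/= andbT => t0.
by rewrite lee_fin -mulrA mulr_ge0 ?Q0// h0// ltW.
Qed.

Let IE : I = A%:E.
Proof. by rewrite /A fineK// ge0_fin_numE//; apply: lt_trans v0_small _; rewrite ltry. Qed.

Let A0 : 0 <= A. Proof. exact: fine_ge0. Qed.
Let A1 : A < 1. Proof. by rewrite -lte_fin -IE. Qed.

(** The order interval between 0 and V, preserved by the iteration; it lies under [m], where [f] is
    monotone. *)
Definition below w := measurable_fun setT w /\ forall z, 0 <= w z /\ ((w z)%:E <= Vf z)%E.

(* Since f(a)/a is nondecreasing, w <= V gives f(w) <= Q sigma * V, and the semigroup property turns the kernel integral into V t x. *)
Let inner_le w x t (sigma : R) : below w -> 0 < sigma < t ->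
  (\int[leb]_y (duhamel_kernel s h f w (x, t) sigma y)%:E <= (h sigma * Q sigma)%:E * V t x)%E.
Proof.
move=> [mw bw] /andP[s0 st]; have ts0 : 0 < t - sigma by rewrite subr_gt0.
have t0 : 0 < t by exact: lt_trans st.
have hQ0 : 0 <= h sigma * Q sigma by rewrite mulr_ge0 ?Q0 ?h0 ?ltW.
rewrite /V -[X in heatS s X v x](subrK sigma) -heatS_semigroup//.
rewrite -heatSZ//; last 2 first.
- exact: mVx.
- by move=> y; exact: V0.
apply: ae_ge0_le_integral => //.
- by move=> y _; rewrite lee_fin duhamel_kernel_ge0.
- by apply/measurable_EFinP; exact: measurable_duhamel_kernel_y.
- move=> y _; apply: mule_ge0; first by rewrite lee_fin heat_kernel_ge0.
  by apply: mule_ge0; [rewrite lee_fin|exact: V0].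
- apply: emeasurable_funM; first exact: measurable_heat_kernel_subr.
  by apply: emeasurable_funM; [exact: measurable_cst|exact: mVx].
apply: filterS (VN s0) => y VNy _.
rewrite /duhamel_kernel /= hkernelE// hposE// -[heatS s sigma v y]/(V sigma y) -(fineK (Vfin y s0)).
rewrite -!EFinM lee_fin; apply: ler_wpM2l; first exact: heat_kernel_ge0.
rewrite -mulrA; apply: ler_wpM2l; first by rewrite h0// ltW.
have [w0 wV] := bw (y, sigma); rewrite VfE// -(fineK (Vfin y s0)) lee_fin in wV.
by apply: fQ => //; rewrite -lee_fin fineK ?Vfin.
Qed.

Let duhamel_le_V w z : below w -> (duhamel s h f w z <= A%:E * Vf z)%E.
Proof.
move=> bw; have [mw _] := bw; case: z => x t.
have inner0 (sigma : R) : ~ (0 < sigma < t) -> (\int[leb]_y (duhamel_kernel s h f w (x, t) sigma y)%:E = 0)%E.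
  move=> nst; rewrite integral0_eq// => y _; rewrite /duhamel_kernel /=.
  have [s0|s0] := ltP 0 sigma; last by rewrite /hpos ltNge s0/= mul0r mulr0.
  rewrite /hkernel subr_gt0 ifN ?mul0r//; apply/negP => st.
  by apply: nst; rewrite s0.
have [t0|t0] := ltP 0 t; last first.
  rewrite Vf_le0// mule0 /duhamel integral0_eq// => sigma _; apply: inner0.
  by move=> /andP[? ?]; have := lt_trans (_ : 0 < sigma) (_ : sigma < t); lra.
rewrite VfE// -(fineK (Vfin x t0)); set r := fine (V t x).
have r0 : 0 <= r by apply: fine_ge0; exact: V0.
have inner_le' (sigma : R) : 0 < sigma -> (\int[leb]_y (duhamel_kernel s h f w (x, t) sigma y)%:E <= (h sigma * Q sigma)%:E * r%:E)%E.
  move=> s0; have [st|st] := ltP sigma t.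
    by rewrite /r fineK ?Vfin//; apply: inner_le => //; rewrite s0.
  rewrite inner0; last by move=> /andP[_]; rewrite ltNge st.
  by rewrite -EFinM lee_fin mulr_ge0// mulr_ge0 ?Q0 ?h0// ltW.
have DE : duhamel s h f w (x, t) = (\int[mu]_(sigma in `]0%R, +oo[%classic) \int[leb]_y (duhamel_kernel s h f w (x, t) sigma y)%:E)%E.
  rewrite integral_mkcond; apply: eq_integral => sigma _; rewrite patchE; case: ifPn => // /negP nin.
  by apply: inner0 => /andP[s0 _]; apply: nin; apply/mem_set; rewrite /= in_itv/= s0.
rewrite DE; move: r0; rewrite le_eqVlt => /orP[/eqP r0|r0].
  rewrite -r0 mule0 integral0_eq// => sigma /=; rewrite in_itv/= andbT => s0.
  apply/eqP; rewrite eq_le duhamel_inner_ge0// andbT.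
  by have := inner_le' _ s0; rewrite -r0 mule0.
have mi : measurable_fun setT (fun sigma : measurableTypeR R => \int[leb]_y (duhamel_kernel s h f w (x, t) sigma y)%:E)%E.
  exact: measurable_duhamel_inner.
(* The function sigma -> Q sigma is not known to be measurable, so r is not pulled out of the
   integral of h Q r. The measurable Duhamel integrand is divided by r instead, and then compared
   with h Q by [le_integral_ge0]. *)
have -> : (\int[mu]_(sigma in `]0%R, +oo[%classic) \int[leb]_y (duhamel_kernel s h f w (x, t) sigma y)%:E)%E =
   (r%:E * \int[mu]_(sigma in `]0%R, +oo[%classic) (r^-1%:E * \int[leb]_y (duhamel_kernel s h f w (x, t) sigma y)%:E))%E.
  rewrite -ge0_integralZl_EFin//.
  - apply: eq_integral => sigma _; rewrite muleA -EFinM divff ?mul1e// gt_eqF//.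
  - move=> sigma _; apply: mule_ge0; [by rewrite lee_fin invr_ge0 ltW|exact: duhamel_inner_ge0].
  - by apply: emeasurable_funM; [exact: measurable_cst|exact: measurable_funTS].
  - exact: ltW.
rewrite muleC; apply: lee_wpmul2r; first by rewrite lee_fin ltW.
rewrite -IE; apply: le_integral_ge0 => sigma /=.
  by move=> _; apply: mule_ge0; [by rewrite lee_fin invr_ge0 ltW|exact: duhamel_inner_ge0].
rewrite in_itv/= andbT => s0.
apply: (@le_trans _ _ (r^-1%:E * ((h sigma * Q sigma)%:E * r%:E))%E).
  by apply: lee_wpmul2l; [rewrite lee_fin invr_ge0 ltW|exact: inner_le'].
rewrite -!EFinM lee_fin mulrCA mulVf ?gt_eqF// mulr1.
by rewrite /Q mulrA.
Qed.

Let dlt : R := 1 - A.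
Let dlt0 : 0 < dlt. Proof. by rewrite subr_gt0. Qed.

Let Psi w z : R := fine (dlt%:E * Vf z + duhamel s h f w z)%E.

Let Psi_le w z : below w -> (dlt%:E * Vf z + duhamel s h f w z <= Vf z)%E.
Proof.
move=> bw; apply: (@le_trans _ _ (dlt%:E * Vf z + A%:E * Vf z)%E).
  by apply: leeD2l; exact: duhamel_le_V.
by rewrite -(fineK (Vffin z)) -!EFinM -EFinD -mulrDl subrK mul1r.
Qed.

Let PsiE w z : below w -> (Psi w z)%:E = (dlt%:E * Vf z + duhamel s h f w z)%E.
Proof.
move=> bw; rewrite /Psi fineK// ge0_fin_numE.
  by apply: le_lt_trans (Psi_le z bw) _; rewrite -(fineK (Vffin z)) ltry.
by apply: adde_ge0; [apply: mule_ge0 => //; rewrite lee_fin ltW|exact: duhamel_ge0].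
Qed.

Let Psi_below w : below w -> below (Psi w).
Proof.
move=> bw; have [mw _] := bw; split.
  apply: (measurableT_comp (fine_measurable measurableT)).
  apply: emeasurable_funD; last exact: measurable_duhamel.
  by apply: emeasurable_funM; [exact: measurable_cst|exact: mVf].
move=> z; split; last by rewrite PsiE// Psi_le.
by apply: fine_ge0; apply: adde_ge0; [apply: mule_ge0 => //; rewrite lee_fin ltW|exact: duhamel_ge0].
Qed.

Let below_m w z : below w -> w z <= m.
Proof. by move=> [_ /(_ z)[_ wV]]; rewrite -lee_fin; exact: le_trans wV (Vfm z). Qed.

Let below_ge0 w z : below w -> 0 <= w z. Proof. by move=> [_ /(_ z)[]]. Qed.

Let fpos_nd w1 w2 z : below w1 -> below w2 -> w1 z <= w2 z -> fpos f (w1 z) <= fpos f (w2 z).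
Proof.
move=> b1 b2 w12; rewrite !fposE ?below_ge0//.
by apply: f_ndm; [exact: below_ge0|exact: w12|exact: below_m].
Qed.

Let W k : RT -> R := iter k Psi (fun=> 0).

Let W_below k : below (W k).
Proof.
elim: k => [|k IH]; last exact: Psi_below.
by split; [exact: measurable_cst|move=> z; split => //; exact: Vf0].
Qed.

Let W_E k z : W k.+1 z = Psi (W k) z. Proof. by []. Qed.

Let W_S k z : W k z <= W k.+1 z.
Proof.
elim: k z => [|k IH] z; first exact: below_ge0 (W_below 1).
suff : (dlt%:E * Vf z + duhamel s h f (W k) z <= dlt%:E * Vf z + duhamel s h f (W k.+1) z)%E.
  by rewrite -(PsiE z (W_below k)) -(PsiE z (W_below k.+1)) lee_fin.
apply: leeD2l; apply: duhamel_le => //; [by have [] := W_below k|by have [] := W_below k.+1|].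
by move=> z'; exact: fpos_nd.
Qed.

Let W_nd z : nondecreasing_seq (W^~ z).
Proof. by apply/nondecreasing_seqP => k; exact: W_S. Qed.

Let w z : R := limn (W^~ z).

Let W_cvg z : W^~ z @ \oo --> w z.
Proof.
apply: nondecreasing_is_cvgn; first exact: W_nd.
by exists m => _ [k _ <-]; apply: below_m.
Qed.

Let w_below : below w.
Proof.
split.
  by apply: (measurable_fun_cvg (fun k => proj1 (W_below k))) => z _; exact: W_cvg.
move=> z; have cz : cvgn (W^~ z) by apply/cvg_ex; exists (w z); exact: W_cvg.
split.
  by apply: limr_ge => //; apply: nearW => k; exact: below_ge0.
rewrite -(fineK (Vffin z)) lee_fin; apply: limr_le => //; apply: nearW => k.
by have [_ /(_ z)[_]] := W_below k; rewrite -(fineK (Vffin z)) lee_fin.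
Qed.

(** The Duhamel terms of the iterates have two limits: [duhamel s h f w z] by monotone convergence,
    and w z - d because they equal W (k+1) z - d. *)
Let w_fix z : (w z)%:E = (dlt%:E * Vf z + duhamel s h f w z)%E.
Proof.
pose d := dlt * fine (Vf z).
have dE : (dlt%:E * Vf z)%E = d%:E by rewrite /d EFinM fineK.
have DE k : duhamel s h f (W k) z = (W k.+1 z - d)%:E.
  have := PsiE z (W_below k); rewrite dE -W_E => WE.
  by rewrite EFinB WE addeAC subee// add0e.
have c1 : duhamel s h f (W k) z @[k --> \oo] --> duhamel s h f w z.
  apply: duhamel_cvg => //.
  - by move=> k; have [] := W_below k.
  - by move=> z' i j ij; apply: fpos_nd => //; exact: W_nd.
have c2 : duhamel s h f (W k) z @[k --> \oo] --> (w z - d)%:E.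
  under eq_fun do rewrite DE.
  apply: cvg_EFinT; apply: cvgB; last exact: cvg_cst.
  by have cz := @W_cvg z; rewrite -cvg_shiftS in cz; exact: cz.
by rewrite (cvg_unique _ c1 c2)// dE -EFinD addrC subrK.
Qed.

Let bounds t : (L1_norm (fun x => w (x, t)) <= L1_norm v0)%E /\ (Linf_norm (fun x => w (x, t)) <= m%:E)%E.
Proof.
have wn x : `|w (x, t)| = w (x, t) by rewrite ger0_norm// below_ge0.
split; last first.
  by apply/ess_supP; apply: aeW => x /=; rewrite wn lee_fin below_m.
rewrite -v_int /L1_norm; under eq_integral do rewrite wn.
have [t0|t0] := ltP 0 t; last first.
  rewrite integral0_eq; first by apply: integral_ge0.
  move=> x _; have [_ /(_ (x, t))[w0]] := w_below; rewrite Vf_le0// lee_fin => w0'.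
  by congr EFin; apply/eqP; rewrite eq_le w0' w0.
rewrite -(integral_heatS s01 t0 mv v_ge0); apply: le_integral_ge0 => x _; first by rewrite lee_fin below_ge0.
by rewrite -[heatS s t v x]/(V t x) -VfE//; have [_ /(_ (x, t))[]] := w_below.
Qed.

Let v_int_gt0 : (0 < \int[leb]_x v x)%E.
Proof.
rewrite lt0e integral_ge0// andbT; apply/eqP => vI0; apply: v0_nz.
have [mv0 _] := v0X.
have /ae_eq_integral_abs : measurable_fun setT v by exact: mv.
move=> /(_ leb measurableT) [+ _].
rewrite (eq_integral v); last by move=> x _; rewrite gee0_abs.
move=> /(_ vI0) va; move: v_ae; apply: filter_app; move: va; apply: filterS => x vx0 vx.
by have := vx0 Logic.I; rewrite vx => -[].
Qed.

(** If w vanished almost everywhere, so would the nonnegative summand dlt V of the fixed point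
    equation; but by conservation of mass the integral of V over times in ]0, 1[ is the mass of [v],
    which is positive. *)
Let w_nontrivial : nontrivial (fun x t => w (x, t)).
Proof.
pose M : {measure set RT -> \bar R} := (leb \x mu)%E.
move=> w0; have {}w0 : \forall z \ae M, w (z.1, z.2) = 0 by exact: w0.
have Vae : {ae M, forall z, setT z -> Vf z = cst 0%E z}.
  apply: filterS w0 => -[x t] /= wz _.
  have := w_fix (x, t); rewrite wz => /esym/eqP.
  rewrite padde_eq0; [|by apply: mule_ge0 => //; rewrite lee_fin ltW|exact: duhamel_ge0].
  by move=> /andP[+ _]; rewrite mule_eq0 eqe gt_eqF//= => /eqP.
have VI : (\int[M]_z Vf z = 0)%E.
  rewrite (@ae_eq_integral _ _ _ M setT (cst 0%E) Vf)//; first by rewrite integral0.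
move: VI; rewrite (@fubini_tonelli2 _ _ _ _ _ (lebSF R n) mu)// /fubini_G.
apply/eqP; rewrite gt_eqF//.
apply: (@lt_le_trans _ _ (\int[mu]_(t in `]0%R, 1%R[%classic) cst (\int[leb]_x v x) t)%E).
  by rewrite integral_cst//= lebesgue_measure_itv/= lte_fin ltr01 -EFinB subr0 mule1 v_int_gt0.
rewrite [leLHS]integral_mkcond; apply: le_integral_ge0 => t _.
  by rewrite patchE; case: ifPn => // _; apply: integral_ge0.
rewrite patchE; case: ifPn => [/set_mem|_]; last exact: integral_ge0.
rewrite /= in_itv/= => /andP[t0 _].
rewrite -(integral_heatS s01 t0 mv v_ge0); apply: le_integral_ge0 => x _; first exact: V0.
by rewrite VfE.
Qed.

Lemma global_existence : exists delta : R, 0 < delta /\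
  exists u : RN -> R -> R, mild_solution s h f +oo%E (fun x => delta * v0 x) u /\ nontrivial u.
Proof.
exists dlt; split => //; exists (fun x t => w (x, t)); split; last exact: w_nontrivial.
split; first by move=> x t _ _; exact: below_ge0.
split.
  by rewrite (_ : (fun z => _) = w); [have [] := w_below|apply/funext => -[]].
split.
  have [_ [L1 _]] := v0X.
  have L1f : L1_norm v0 \is a fin_num by rewrite ge0_fin_numE//; exact: integral_ge0.
  exists (Num.max (fine (L1_norm v0)) m); apply: aeW => t _ _; have [b1 b2] := bounds t.
  split.
    by apply: le_trans b1 _; rewrite -(fineK L1f) lee_fin le_max lexx.
  by apply: le_trans b2 _; rewrite lee_fin le_max lexx orbT.
move=> t t0 _; apply: aeW => x.
rewrite (duhamelE s h f x) => [|z|//]; last exact: below_ge0.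
rewrite w_fix; congr (_ + _)%E.
rewrite semigroupE (_ : EFin \o _ = fun y => (dlt%:E * (EFin \o v0) y)%E)//.
rewrite VfE// (_ : heatS s t (fun y => (dlt%:E * (EFin \o v0) y)%E) x = heatS s t (fun y => (dlt%:E * v y)%E) x).
  by rewrite heatSZ// ?ltW// -/(V t x) -(fineK (Vfin x t0)) -EFinM.
have [mv0 _] := v0X.
apply: ae_eq_heatS.
- by apply: emeasurable_funM; [exact: measurable_cst|exact/measurable_EFinP].
- by apply: emeasurable_funM; [exact: measurable_cst|exact: mv].
by apply: filterS v_ae => y /= ->.
Qed.

End GlobalExistence.

(** * Blow-up *)

Section OdeComparison.
Variable R : realType.
Local Notation mu := (@lebesgue_measure R).
Implicit Types (a b t x : R).

Lemma continuous_itv_integrable (g : R -> R) a b : continuous g -> mu.-integrable `[a, b] (EFin \o g).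
Proof.
move=> cg; apply: continuous_compact_integrable; first exact: segment_compact.
exact: continuous_subspaceT.
Qed.

(** An integral from b is differentiated only to the right of b, so base points are later taken
    strictly below the interval of interest: -1 for [0, t1], a/2 for [a, oo). *)
Lemma continuous_primitive (g : R -> R) b : continuous g ->
  exists F : R -> R, forall x, b < x -> is_derive x 1 F (g x).
Proof.
move=> cg; exists (fun x => \int[mu]_(t in `[b, x]) g t)%R => x bx.
have [d dE] := @continuous_FTC1_closed R g b x (x + 1) (ltr_pwDr ltr01 (lexx x))
  (@continuous_itv_integrable g b (x + 1) cg) bx (cg x).
by split; [exact: d|rewrite -derive1E].
Qed.

Lemma Rintegral_primitive (g F : R -> R) (b x y : R) : continuous g ->
  (forall z, b < z -> is_derive z 1 F (g z)) -> b < x -> x <= y ->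
  (\int[mu]_(t in `[x, y]) g t)%R = F y - F x.
Proof.
move=> cg dF bx; rewrite le_eqVlt => /orP[/eqP <-|xy].
  by rewrite set_itv1 Rintegral_set1 subrr.
have dz z : b < z -> derivable F z 1 by move=> /dF[].
have cz z : b < z -> {for z, continuous F}.
  by move=> bz; apply/differentiable_continuous/derivable1_diffP; exact: dz.
rewrite /Rintegral (@continuous_FTC2 _ g F x y xy).
- by [].
- exact: continuous_subspaceT.
- split=> [z||].
  + by rewrite in_itv/= => /andP[xz _]; apply: dz; exact: lt_trans xz.
  + by apply: cvg_at_right_filter; exact: cz.
  + by apply: cvg_at_left_filter; apply: cz; exact: lt_trans xy.
- by move=> z; rewrite in_itv/= => /andP[xz _]; rewrite derive1E; have [] := dF z (lt_trans bx xz).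
Qed.

Variables (hh ff G : R -> R) (a t1 : R).
Hypotheses (chh : continuous hh) (cff : continuous ff) (cG : continuous G).
Hypothesis hh0 : forall t, 0 <= hh t.
Hypothesis ff_nd : forall b c, 0 <= b -> b <= c -> ff b <= ff c.
Hypothesis ff_ge0 : forall b, 0 <= ff b.
Hypothesis ff_gt0 : forall b, 0 < b -> 0 < ff b.
Hypotheses (a0 : 0 < a) (t10 : 0 < t1).
Hypothesis Ga : forall t, 0 <= t <= t1 -> a + (\int[mu]_(r in `[0%R, t]) (hh r * ff (G r)))%R <= G t.

(** Let H be the left-hand side of [Ga]. As H <= G, H' = hh ff(G) >= hh ff(H), so a primitive of
    1/ff taken along H grows at least as fast as a primitive of hh. Replacing r by max(r, a/2) makes
    1/ff continuous on the line and leaves it unchanged on [a, oo), where H takes its values. *)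
Lemma ode_comparison : (\int[mu]_(r in `[0%R, t1]) hh r)%R <=
  (\int[mu]_(r in `[a, G t1]) (ff (Num.max r (a / 2)))^-1)%R.
Proof.
have a20 : 0 < a / 2 by rewrite divr_gt0.
pose phi r := (ff (Num.max r (a / 2)))^-1.
have fm0 r : 0 < ff (Num.max r (a / 2)) by apply: ff_gt0; rewrite lt_max a20 orbT.
have cphi : continuous phi.
  have cm : continuous (fun y : R => Num.max y (a / 2)).
    by move=> r; apply: (@continuous_max _ _ id (cst (a / 2))); [exact: cvg_id|exact: cvg_cst].
  have cfm : continuous (fun y : R => ff (Num.max y (a / 2))).
    by move=> r; apply: (@continuous_comp _ _ _ (fun y : R => Num.max y (a / 2)) ff); [exact: cm|exact: cff].
  by move=> r; apply: cvgV; [rewrite gt_eqF|exact: cfm].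
have cg : continuous (fun r => hh r * ff (G r)).
  by move=> r; apply: cvgM; [exact: chh|apply: (@continuous_comp _ _ _ G ff); [exact: cG|exact: cff]].
have m10 : -1 < 0 :> R by rewrite ltrN10.
have [FM dFM] := continuous_primitive (-1) chh.
have [FG dFG] := continuous_primitive (-1) cg.
have [FP dFP] := continuous_primitive (a / 2) cphi.
pose H t := a + (FG t - FG 0).
have HE t : 0 <= t -> H t = a + (\int[mu]_(r in `[0%R, t]) (hh r * ff (G r)))%R.
  by move=> t0; rewrite (Rintegral_primitive cg dFG m10 t0).
have Ht0 t : 0 <= t <= t1 -> a <= H t <= G t.
  move=> /[dup] t01 /andP[t0 tt1]; rewrite HE// Ga// andbT lerDl.
  apply: Rintegral_ge0 => r; rewrite /= in_itv/= => /andP[r0 rt].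
  exact: mulr_ge0.
have dH t : -1 < t -> is_derive t 1 H (hh t * ff (G t)).
  move=> t1'; have := is_deriveD (is_derive_cst a t 1) (is_deriveB (dFG t t1') (is_derive_cst (FG 0) t 1)).
  by rewrite subr0 add0r.
pose K t := FP (H t) - FM t.
have dK t : 0 <= t <= t1 -> is_derive t 1 K (phi (H t) * (hh t * ff (G t)) - hh t).
  move=> t01; have /andP[t0 _] := t01; have tm1 : -1 < t by exact: lt_le_trans m10 t0.
  have /andP[aH _] := Ht0 t t01.
  have aH2 : a / 2 < H t by apply: lt_le_trans aH; lra.
  have := is_deriveB (is_derive1_comp (dFP _ aH2) (dH t tm1)) (dFM t tm1).
  by rewrite mulrC.
have K01 : K 0 <= K t1.
  apply: (@ger0_derive1_le_cc R K 0 t1) => //; rewrite ?in_itv/= ?lexx ?ltW//.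
  - by move=> t; rewrite in_itv/= => /andP[t0 tt1]; have [] := dK t; rewrite ?ltW.
  - move=> t; rewrite in_itv/= => /andP[t0 tt1].
    have t01 : 0 <= t <= t1 by rewrite !ltW.
    have [_] := dK t t01; rewrite derive1E => ->.
    have /andP[aH HG] := Ht0 t t01.
    have Hpos : 0 < H t by exact: lt_le_trans a0 aH.
    have phiE : phi (H t) = (ff (H t))^-1.
      by rewrite /phi; congr (ff _)^-1; apply/max_idPl; apply: le_trans aH; lra.
    rewrite phiE subr_ge0 mulrCA ler_peMr// mulrC ler_pdivlMr ?ff_gt0// mul1r.
    by apply: ff_nd => //; exact: ltW.
  - apply: derivable_within_continuous => t; rewrite in_itv/= => t01.
    by have [] := dK t t01.
have t11 : 0 <= t1 <= t1 by rewrite lexx ltW.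
have /andP[aH HG] := Ht0 t1 t11.
have aa2 : a / 2 < a by lra.
rewrite (Rintegral_primitive chh dFM m10 (ltW t10)) -/phi.
apply: (@le_trans _ _ (FP (H t1) - FP a)).
  have H0 : H 0 = a by rewrite /H subrr addr0.
  by move: K01; rewrite /K H0; lra.
rewrite (Rintegral_primitive cphi dFP aa2 (le_trans aH HG)) lerD2r.
rewrite -subr_ge0 -(Rintegral_primitive cphi dFP (lt_le_trans aa2 aH) HG).
by apply: Rintegral_ge0 => r _; rewrite invr_ge0 ltW.
Qed.

End OdeComparison.

(** * Continuity of the primitive of a bounded integrable function *)

Section BoundedPrimitive.
Variable R : realType.
Local Notation mu := (@lebesgue_measure R).
Variables (F : R -> R) (B : R).
Hypothesis iF : mu.-integrable setT (EFin \o F).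
Hypothesis F0B : forall r, 0 <= F r <= B.

Lemma Rintegral_Iio_lipschitz (t t' : R) : t <= t' ->
  0 <= (\int[mu]_(r in `]-oo, t'[) F r)%R - (\int[mu]_(r in `]-oo, t[) F r)%R <= B * (t' - t).
Proof.
move=> tt'.
have U : (`]-oo, t'[ = `]-oo, t[ `|` `[t, t'[)%classic by rewrite -itv_bndbnd_setU.
rewrite U Rintegral_setU//.
- rewrite addrAC subrr add0r; apply/andP; split.
    by apply: Rintegral_ge0 => r _; have /andP[] := F0B r.
  have -> : B * (t' - t) = (\int[mu]_(r in `[t, t'[) B)%R.
    rewrite /Rintegral integral_cst//= lebesgue_measure_itv/= lte_fin.
    by case: ltP => [//|t't]; rewrite mule0 (le_anti (_ : t <= t' <= t)) ?tt'// subrr mulr0.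
  apply: le_Rintegral => //.
  - by apply: (integrableS _ _ _ iF).
  - apply/integrableP; split; first exact: measurable_cst.
    rewrite integral_cst//= lebesgue_measure_itv/= lte_fin; case: ifP => _; rewrite ?mule0//.
    by rewrite -EFinD -EFinM ltry.
  - by move=> r _; have /andP[] := F0B r.
- by apply: (integrableS _ _ _ iF) => //; exact: measurableU.
- by rewrite disj_set2E; apply/eqP/seteqP; split=> // r [] /=; rewrite !in_itv/= => rt /andP[]; rewrite leNgt rt.
Qed.

Lemma continuous_Rintegral_Iio : continuous (fun t => \int[mu]_(r in `]-oo, t[) F r)%R.
Proof.
have B0 : 0 <= B by have /andP[/le_trans] := F0B 0; apply.
move=> t; apply/cvgrPdist_lt => e e0; near=> t'.
apply: (@le_lt_trans _ _ (B * `|t - t'|)).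
  have [tt'|/ltW tt'] := leP t t'.
    have /andP[] := Rintegral_Iio_lipschitz tt'.
    by rewrite distrC => /ger0_norm ->; rewrite distrC (ger0_norm (_ : 0 <= t' - t))// subr_ge0.
  have /andP[] := Rintegral_Iio_lipschitz tt'.
  by move=> /ger0_norm ->; rewrite (ger0_norm (_ : 0 <= t - t'))// subr_ge0.
apply: (@le_lt_trans _ _ ((B + 1) * `|t - t'|)).
  by apply: ler_wpM2r => //; rewrite lerDl.
rewrite mulrC -ltr_pdivlMr ?ltr_wpDl//; near: t'.
by apply: (@cvgr_dist_lt _ _ _ _ _ id) => //; rewrite divr_gt0// ltr_wpDl.
Unshelve. all: by end_near. Qed.

End BoundedPrimitive.

(** * Contradiction from a global mild solution *)

Section BlowUp.
Variable R : realType.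
Variables (n : nat) (s : R).
Hypothesis s01 : 0 < s < 1.
Local Notation leb := (lebN R n).
Local Notation RN := (RN R n).
Local Notation mu := (@lebesgue_measure R).
Local Notation RT := (RN * measurableTypeR R)%type.
Implicit Types (x y : RN) (t r : R) (z : RT).
Local Notation p t := (heat_kernel s t : RN -> R).
Local Opaque heat_kernel.
Let sf := @lebN_sigma_finite R n.
Let smu := @sigma_finiteT _ _ _ mu.

Variables h f : R -> R.
Hypothesis hc : {within `[0%R, +oo[%classic, continuous h}.
Hypothesis h0 : forall t, 0 <= t -> 0 <= h t.
Hypothesis fc : {within `[0%R, +oo[%classic, continuous f}.
Hypothesis f0 : forall a, 0 <= a -> 0 <= f a.
Hypothesis f_nd : forall a b, 0 <= a -> a <= b -> f a <= f b.
Hypothesis f_gt0 : forall a, 0 < a -> 0 < f a.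
Hypothesis jensen : forall t (w0 : RN -> R), 0 < t -> in_X w0 -> (forall x, 0 <= w0 x) ->
  forall x, f (semigroup s t w0 x) <= semigroup s t (fun y => f (w0 y)) x.

Variable u0 : RN -> R.
Hypothesis u0X : in_X u0.
Hypothesis u0_ge0 : \forall x \ae leb, 0 <= u0 x.
Variable u : RN -> R -> R.
Hypothesis u_mild : mild_solution s h f +oo%E u0 u.
Variable kappa : R.
Hypothesis kappa0 : 0 < kappa.

(** Nonnegative also at negative times, about whose sign a mild solution says nothing. *)
Let w z := Num.max (u z.1 z.2) 0.
Let v x : \bar R := (Num.max (u0 x) 0)%:E.

Let w_ge0 z : 0 <= w z. Proof. by rewrite le_max lexx orbT. Qed.

Let wE x t : 0 <= t -> w (x, t) = u x t.
Proof. by move=> t0; apply/max_idPl; case: u_mild => u_ge0 _; apply: u_ge0 => //; exact: ltry. Qed.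

Let mw : measurable_fun setT w.
Proof. by have [_ [mu_ _]] := u_mild; apply: measurable_maxr => //; exact: measurable_cst. Qed.

Let mwt t : measurable_fun setT (fun y => w (y, t)).
Proof. exact: (measurableT_comp mw (measurable_pair2 t)). Qed.

Let mv : measurable_fun setT v.
Proof.
have [mu0 _] := u0X; apply/measurable_EFinP.
by apply: measurable_maxr => //; exact: measurable_cst.
Qed.

Let v_ge0 x : (0 <= v x)%E. Proof. by rewrite lee_fin le_max lexx orbT. Qed.

Let v_ae : {ae leb, forall x, v x = (u0 x)%:E}.
Proof. by apply: filterS u0_ge0 => x x0; rewrite /v; congr EFin; apply/max_idPl. Qed.

Let fw t y : \bar R := (fpos f (w (y, t)))%:E.
Let fw_ge0 t y : (0 <= fw t y)%E. Proof. by rewrite lee_fin fpos_ge0. Qed.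
Let mfw t : measurable_fun setT (fw t).
Proof. by apply/measurable_EFinP; exact: (measurableT_comp (measurable_fpos fc) (mwt t)). Qed.

Let aeF : Filter (nbhs (almost_everywhere mu)).
Proof. exact: ae_filter_ringOfSetsType. Qed.

(** The bounds on a mild solution hold at almost every time only; the Jensen-type hypothesis is
    applied at these times. *)
Let good (C t : R) := in_X (fun y => w (y, t)) /\ {ae leb, forall y, w (y, t) <= C}.

Let good_ae : exists2 C : R, 0 < C & {ae leb, forall y, (v y <= C%:E)%E} /\ {ae mu, forall t, 0 < t -> good C t}.
Proof.
have [_ [_ [[C uC] _]]] := u_mild.
have [_ [_ u0fin]] := u0X.
have [K vK] : exists K : R, {ae leb, forall y, (v y <= K%:E)%E}.
  exists (fine (Linf_norm u0)).
  have /ess_supP H : (Linf_norm u0 <= (fine (Linf_norm u0))%:E)%E.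
    by case: (Linf_norm u0) u0fin => //= _; exact: leNye.
  apply: filterS2 v_ae H => y -> H; apply: le_trans H; rewrite lee_fin; exact: ler_norm.
have M0 : 0 < Num.max (Num.max C K) 1 by rewrite lt_max ltr01 orbT.
exists (Num.max (Num.max C K) 1) => //; split.
  by apply: filterS vK => y /le_trans; apply; rewrite lee_fin !le_max lexx orbT.
move: uC; apply: (@filterS _ _ aeF) => t uC t0; have [u1 uoo] := uC t0 (ltry _).
have wtE : (fun y => w (y, t)) = u^~ t by apply/funext => y; rewrite (wE _ (ltW t0)).
split.
  split; first exact: mwt.
  rewrite wtE; split; first exact: le_lt_trans u1 (ltry _).
  exact: le_lt_trans uoo (ltry _).
have /ess_supP H := uoo; apply: filterS H => y; rewrite (wE _ (ltW t0)) lee_fin => H.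
by apply: le_trans (ler_norm _) _; apply: le_trans H _; rewrite !le_max lexx.
Qed.

Let duhamel_ae t : 0 < t -> {ae leb, forall y, ((w (y, t))%:E = heatS s t v y + duhamel s h f w (y, t))%E}.
Proof.
move=> t0; have [_ [_ [_ U]]] := u_mild.
have [C C0 [vC _]] := good_ae.
apply: filterS (U t t0 (ltry _)) => y; rewrite -(wE _ (ltW t0)) => ->; congr (_ + _)%E.
  rewrite semigroupE (@ae_eq_heatS _ _ _ _ _ v y _ mv).
  - rewrite fineK// ge0_fin_numE; last exact: heatS_ge0.
    by apply: le_lt_trans (ltry C); apply: heatS_le => //; exact: ltW.
  - by have [mu0 _] := u0X; exact/measurable_EFinP.
  - by apply: filterS v_ae => z ->.
rewrite -(duhamelE s h f y w_ge0 t0); apply: eq_integral => r /set_mem.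
by rewrite /= in_itv/= => /andP[r0 _]; apply: eq_integral => z _; rewrite (wE _ (ltW r0)).
Qed.

Section Point.
Variables (x : RN) (C B : R).

(* The unknown of the scalar integral inequality: the solution at time t, evolved by the linear flow up to time kappa and evaluated at x. *)
Let psi t : \bar R := (\int[leb]_y (hkernel s (kappa - t) (vsub x y) * w (y, t))%:E)%E.

Let mpsi : measurable_fun setT (psi : measurableTypeR R -> \bar R).
Proof.
apply: (measurable_integral_snd sf (f := fun (t : measurableTypeR R) y => (hkernel s (kappa - t) (vsub x y) * w (y, t))%:E)).
  apply/measurable_EFinP; apply: measurable_funM.
    apply: (measurableT_comp (f := fun z : RT => hkernel s z.2 z.1) (measurable_hkernel s) (g := fun q : measurableTypeR R * RN => (vsub x q.2, kappa - q.1))).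
    apply: measurable_fun_pair.
      by apply: measurable_fun_vsub; [exact: measurable_cst|exact: measurable_snd].
    by apply: measurable_funB; [exact: measurable_cst|exact: measurable_fst].
  apply: (measurableT_comp mw (g := fun q : measurableTypeR R * RN => (q.2, q.1))).
  by apply: measurable_fun_pair; [exact: measurable_snd|exact: measurable_fst].
by move=> t y; rewrite lee_fin; apply: mulr_ge0 => //; exact: hkernel_ge0.
Qed.

Let psiE t : t < kappa -> psi t = heatS s (kappa - t) (fun y => (w (y, t))%:E) x.
Proof. by move=> tk; apply: eq_integral => y _; rewrite hkernelE ?subr_gt0// EFinM. Qed.

Let Q t r := heatS s (kappa - t) (fun y => \int[leb]_y' (duhamel_kernel s h f w (y, t) r y')%:E)%E x.

(** Flowing from r to t and then from t to kappa is flowing from r to kappa, so [Q t r] does not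
    depend on [t]. *)
Let QE t r : 0 < r < t -> t < kappa -> Q t r = ((hpos h r)%:E * heatS s (kappa - r) (fw r) x)%E.
Proof.
move=> /andP[r0 rt] tk; have kt : 0 < kappa - t by rewrite subr_gt0.
have tr : 0 < t - r by rewrite subr_gt0.
rewrite /Q (_ : (fun y => _) = (fun y => (hpos h r)%:E * heatS s (t - r) (fw r) y)%E); last first.
  apply/funext => y; rewrite -(heatSZ s01 y tr)//; last exact: hpos_ge0.
  by apply: eq_integral => y' _; rewrite /duhamel_kernel /= hkernelE// /fw -!EFinM.
rewrite heatSZ//; [|exact: hpos_ge0|exact: measurable_heatS|by move=> y; exact: heatS_ge0].
rewrite (heatS_semigroup s01 x kt tr (mfw r) (fw_ge0 r)).
by have -> : kappa - t + (t - r) = kappa - r by rewrite addrA subrK.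
Qed.

Let mQ t : t < kappa -> measurable_fun setT (Q t : measurableTypeR R -> \bar R).
Proof.
move=> tk; have kt : 0 < kappa - t by rewrite subr_gt0.
apply: (measurable_integral_snd sf (f := fun (r : measurableTypeR R) y =>
  ((p (kappa - t) (vsub x y))%:E * \int[leb]_y' (duhamel_kernel s h f w (y, t) r y')%:E)%E)).
  apply: emeasurable_funM.
    exact: (measurableT_comp (measurable_heat_kernel_subr s (kappa - t) x) (@measurable_snd _ _ _ _)).
  apply: (measurableT_comp (measurable_duhamel_inner2 s01 hc h0 fc f0 mw) (g := fun q : measurableTypeR R * RN => ((q.2, t), q.1))).
  apply: measurable_fun_pair; last exact: measurable_fst.
  by apply: measurable_fun_pair; [exact: measurable_snd|exact: measurable_cst].
move=> r y; apply: mule_ge0; first by rewrite lee_fin heat_kernel_ge0.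
exact: duhamel_inner_ge0.
Qed.

Let Q_ge0 t r : t < kappa -> (0 <= Q t r)%E.
Proof. by move=> tk; apply: heatS_ge0; rewrite ?subr_gt0// => y; exact: duhamel_inner_ge0. Qed.

(** The linear flow over time kappa - t is applied to Duhamel's formula at time t; the datum term
    becomes the flow over time kappa, and Tonelli moves the flow inside the time integral. *)
Let psi_duhamel t : 0 < t -> t < kappa -> psi t = (heatS s kappa v x + \int[mu]_r Q t r)%E.
Proof.
move=> t0 tk; have kt : 0 < kappa - t by rewrite subr_gt0.
have mD : measurable_fun setT (fun y => duhamel s h f w (y, t)).
  exact: (measurableT_comp (measurable_duhamel s01 hc h0 fc f0 mw) (measurable_pair2 t)).
have D0 y : (0 <= duhamel s h f w (y, t))%E by exact: duhamel_ge0.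
have mS := measurable_heatS s01 t0 mv v_ge0.
have S0 y : (0 <= heatS s t v y)%E by exact: heatS_ge0.
rewrite psiE// (@ae_eq_heatS _ _ _ _ _ (fun y => heatS s t v y + duhamel s h f w (y, t))%E x); last 3 first.
- by apply/measurable_EFinP; exact: mwt.
- exact: emeasurable_funD.
- exact: duhamel_ae.
have pe0 y : (0 <= (p (kappa - t) (vsub x y))%:E)%E by rewrite lee_fin heat_kernel_ge0.
rewrite {1}/heatS (eq_integral (fun y => ((p (kappa - t) (vsub x y))%:E * heatS s t v y +
  (p (kappa - t) (vsub x y))%:E * duhamel s h f w (y, t))%E)); last first.
  by move=> y _; rewrite ge0_muleDr.
rewrite ge0_integralD//; last 4 first.
- by move=> y _; exact: mule_ge0.
- by apply: emeasurable_funM => //; exact: measurable_heat_kernel_subr.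
- by move=> y _; exact: mule_ge0.
- by apply: emeasurable_funM => //; exact: measurable_heat_kernel_subr.
congr (_ + _)%E.
  have := heatS_semigroup s01 x kt t0 mv v_ge0; rewrite subrK => <-; by [].
rewrite /Q /heatS -(ge0_fubini sf smu (f := fun y r => ((p (kappa - t) (vsub x y))%:E *
  \int[leb]_y' (duhamel_kernel s h f w (y, t) r y')%:E)%E)).
- apply: eq_integral => y _; rewrite /duhamel ge0_integralZl_EFin//.
  + by move=> r _; exact: duhamel_inner_ge0.
  + exact: measurable_duhamel_inner.
  + exact: heat_kernel_ge0.
- apply: emeasurable_funM.
    exact: (measurableT_comp (measurable_heat_kernel_subr s (kappa - t) x) (@measurable_fst _ _ _ _)).
  apply: (measurableT_comp (measurable_duhamel_inner2 s01 hc h0 fc f0 mw) (g := fun q : RN * measurableTypeR R => ((q.1, t), q.2))).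
  apply: measurable_fun_pair; last exact: measurable_snd.
  by apply: measurable_fun_pair; [exact: measurable_fst|exact: measurable_cst].
- by move=> y r; apply: mule_ge0 => //; exact: duhamel_inner_ge0.
Qed.

Let psi_le t : 0 < C -> good C t -> t < kappa -> (psi t <= C%:E)%E.
Proof.
move=> C0 [_ wC] tk; rewrite psiE//; apply: heatS_le => //.
- by rewrite subr_gt0.
- exact: ltW.
- by apply/measurable_EFinP; exact: mwt.
- by move=> y; rewrite lee_fin.
Qed.

Let psi_jensen t : 0 < C -> good C t -> t < kappa ->
  ((fpos f (fine (psi t)))%:E <= heatS s (kappa - t) (fw t) x)%E.
Proof.
move=> C0 [wX wC] tk; have kt : 0 < kappa - t by rewrite subr_gt0.
have fin : heatS s (kappa - t) (fw t) x \is a fin_num.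
  rewrite ge0_fin_numE; last exact: heatS_ge0.
  apply: le_lt_trans (ltry (f C)); apply: heatS_le => //; first by apply: f0; exact: ltW.
  by apply: filterS wC => y wC; rewrite lee_fin fposE//; exact: f_nd.
rewrite -(fineK fin) lee_fin fposE; last first.
  by apply: fine_ge0; apply: integral_ge0 => y _; rewrite lee_fin; apply: mulr_ge0 => //; exact: hkernel_ge0.
have := jensen kt wX (fun y => w_ge0 (y, t)) x.
rewrite !semigroupE psiE//.
by rewrite (_ : EFin \o (fun y => f (w (y, t))) = fw t)//; apply/funext => y; rewrite /fw fposE.
Qed.

Hypothesis C0 : 0 < C.
Hypothesis vC : {ae leb, forall y, (v y <= C%:E)%E}.
Hypothesis goodC : {ae mu, forall t, 0 < t -> good C t}.
Hypothesis hB : forall t, 0 <= t <= kappa -> h (Num.max t 0) <= B.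
Local Notation a := (fine (heatS s kappa v x)).
Hypothesis a0 : 0 < a.

Let afin : heatS s kappa v x = a%:E.
Proof.
rewrite fineK// ge0_fin_numE; last exact: heatS_ge0.
by apply: le_lt_trans (ltry C); apply: heatS_le => //; exact: ltW.
Qed.

(** The cap at [C] bounds [F] at every time, which makes its primitive continuous; at good times
    [psi] is below [C] and the cap is inactive. *)
Let F r := if r < kappa then hpos h r * fpos f (Num.min (fine (psi r)) C) else 0.

Let F0 r : 0 <= F r.
Proof. by rewrite /F; case: ifP => // _; apply: mulr_ge0; [exact: hpos_ge0|exact: fpos_ge0]. Qed.

Let fpos_nd (b c : R) : b <= c -> fpos f b <= fpos f c.
Proof.
move=> bc; apply: f_nd; first by rewrite le_max lexx orbT.
by rewrite ge_max !le_max bc lexx orbT.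
Qed.

Let B0 : 0 <= B.
Proof.
have k0 : 0 <= (0 : R) <= kappa by apply/andP; split; [exact: lexx|exact: ltW].
by apply: le_trans (hB k0); apply: h0; rewrite le_max lexx.
Qed.

Let FI r : F r <= B * fpos f C * \1_(`]0%R, kappa[) r.
Proof.
have fC0 := fpos_ge0 f0 C.
rewrite indicE /F; case: (ltP r kappa) => rk; last by rewrite !mulr_ge0.
case: (ltP 0 r) => r0; last by rewrite /hpos ltNge r0/= mul0r !mulr_ge0.
rewrite mem_set ?mulr1; last by rewrite /= in_itv/= r0.
apply: ler_pM; [exact: hpos_ge0|exact: fpos_ge0| |].
  by rewrite /hpos r0; apply: hB; rewrite !ltW.
by apply: fpos_nd; rewrite ge_min lexx orbT.
Qed.

Let F0B r : 0 <= F r <= B * fpos f C.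
Proof.
rewrite F0/=; apply: le_trans (FI r) _; rewrite ler_piMr//; first by rewrite mulr_ge0//; exact: fpos_ge0.
Qed.

Let mF : measurable_fun setT (F : measurableTypeR R -> R).
Proof.
apply: measurable_fun_ifT.
- by apply: measurable_fun_ltr; [exact: measurable_id|exact: measurable_cst].
- apply: measurable_funM; first exact: measurable_hpos.
  apply: (measurableT_comp (measurable_fpos fc)).
  apply: measurable_minr; last exact: measurable_cst.
  exact: (measurableT_comp (fine_measurable measurableT) mpsi).
- exact: measurable_cst.
Qed.

Let IF : (\int[mu]_r (F r)%:E <= (B * fpos f C * kappa)%:E)%E.
Proof.
apply: (@le_trans _ _ (\int[mu]_(r in `]0%R, kappa[%classic) cst (B * fpos f C)%:E r)%E).
  rewrite [leRHS]integral_mkcond; apply: le_integral_ge0 => r _; first by rewrite lee_fin.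
  have := FI r; rewrite patchE indicE; case: ifP => _; rewrite ?mulr1 ?mulr0 lee_fin//.
by rewrite integral_cst//= lebesgue_measure_itv/= lte_fin kappa0 sube0 -EFinM.
Qed.

Let iF : mu.-integrable setT (EFin \o F).
Proof.
apply/integrableP; split; first exact/measurable_EFinP.
apply: (@le_lt_trans _ _ (\int[mu]_r (F r)%:E)%E); last by apply: le_lt_trans IF _; exact: ltry.
by apply: le_integral_ge0 => r _ //=; rewrite ger0_norm.
Qed.

Let G t := a + (\int[mu]_(r in `]-oo, t[) F r)%R.

Let GE t : ((G t)%:E = a%:E + \int[mu]_(r in `]-oo, t[%classic) (F r)%:E)%E.
Proof.
rewrite /G EFinD; congr (_ + _)%E; rewrite /Rintegral fineK//; apply: integrable_fin_num => //.
exact: (integrableS _ _ _ iF).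
Qed.

Let G_le t : G t <= a + B * fpos f C * kappa.
Proof.
rewrite -lee_fin [leLHS]GE EFinD leeD2l//; apply: le_trans IF.
by apply: ge0_subset_integral => //; [exact/measurable_EFinP|move=> r _; rewrite lee_fin].
Qed.

Let Fgood t : 0 < t -> t < kappa -> good C t -> F t = hpos h t * fpos f (fine (psi t)).
Proof.
move=> t0 tk gt; rewrite /F tk; congr (_ * fpos f _); apply/min_idPl.
have pC := psi_le C0 gt tk.
have p0 : (0 <= psi t)%E by rewrite psiE//; apply: heatS_ge0; rewrite ?subr_gt0// => y; rewrite lee_fin.
by rewrite -lee_fin fineK// ge0_fin_numE//; exact: le_lt_trans pC (ltry _).
Qed.

(** The Jensen-type inequality at almost every r gives F r <= Q t r; integrating and using
    [psi_duhamel] compares the two functions. *)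
Let G_psi t : 0 < t -> t < kappa -> good C t -> G t <= fine (psi t).
Proof.
move=> t0 tk gt.
have pC := psi_le C0 gt tk.
have p0 : (0 <= psi t)%E by rewrite psiE//; apply: heatS_ge0; rewrite ?subr_gt0// => y; rewrite lee_fin.
rewrite -lee_fin fineK; last by rewrite ge0_fin_numE//; exact: le_lt_trans pC (ltry _).
rewrite GE psi_duhamel// afin leeD2l// [leLHS]integral_mkcond; apply: ae_ge0_le_integral => //.
- by move=> r _; rewrite patchE; case: ifP => // _; rewrite lee_fin.
- apply/(measurable_restrictT _ _).1 => //.
  by apply: measurable_funTS; exact/measurable_EFinP.
- by move=> r _; exact: Q_ge0.
- exact: mQ.
move: goodC; apply: (@filterS _ _ aeF) => r gr _; rewrite patchE; case: ifP => [/set_mem|_]; last exact: Q_ge0.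
rewrite /= in_itv/= => rt; have [r0|r0] := ltP 0 r; last first.
  by rewrite /F (lt_trans rt tk) /hpos ltNge r0/= mul0r; exact: Q_ge0.
have rk := lt_trans rt tk.
rewrite QE ?r0// (Fgood r0 rk (gr r0)) EFinM; apply: lee_wpmul2l; first by rewrite lee_fin hpos_ge0.
exact: (psi_jensen C0 (gr r0) rk).
Qed.

Let hh t := h (Num.max t 0).
Let chh : continuous hh. Proof. exact: continuous_extend_max. Qed.
Let hh0 t : 0 <= hh t. Proof. by apply: h0; rewrite le_max lexx orbT. Qed.

Let cG : continuous G.
Proof.
move=> t; apply: cvgD; first exact: cvg_cst.
exact: (continuous_Rintegral_Iio iF F0B).
Qed.

Let cfG : continuous (fun r => hh r * fpos f (G r)).
Proof.
move=> r; apply: cvgM; first exact: chh.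
by apply: (@continuous_comp _ _ _ G (fpos f)); [exact: cG|exact: continuous_fpos].
Qed.

(** Since [G] lies below [psi] at good times and [f] is monotone, h f(G) <= F almost everywhere. The
    inequality thus passes from [psi] to the continuous [G] and reaches t = kappa, where the
    truncated kernel makes [psi] meaningless. *)
Let Ga t : 0 <= t <= kappa -> a + (\int[mu]_(r in `[0%R, t]) (hh r * fpos f (G r)))%R <= G t.
Proof.
move=> /andP[t0 tk]; rewrite -lee_fin [leRHS]GE [leLHS](EFinD a).
apply: leeD2l.
have mg D : measurable_fun D (fun r : R => (hh r * fpos f (G r))%:E).
  apply: measurable_funTS; apply/measurable_EFinP; exact: continuous_measurable_fun.
have g0 r : (0 <= (hh r * fpos f (G r))%:E)%E.
  by rewrite lee_fin; apply: mulr_ge0 => //; exact: fpos_ge0.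
rewrite /Rintegral fineK; last first.
  by apply: integrable_fin_num => //; exact: continuous_itv_integrable.
rewrite -integral_itv_bndo_bndc// -integral_itv_obnd_cbnd//.
apply: (@le_trans _ _ (\int[mu]_(r in `]0%R, t[%classic) (F r)%:E)%E).
  apply: ae_ge0_le_integral.
  - exact: measurable_itv.
  - by move=> r _; exact: g0.
  - exact: mg.
  - by move=> r _; rewrite lee_fin.
  - by apply: measurable_funTS; exact/measurable_EFinP.
  move: goodC; apply: (@filterS _ _ aeF) => r gr; rewrite /= in_itv/= => /andP[r0 rt].
  have rk := lt_le_trans rt tk.
  rewrite (Fgood r0 rk (gr r0)) lee_fin /hpos r0; apply: ler_wpM2l => //.
  by apply: fpos_nd; exact: (G_psi r0 rk (gr r0)).
apply: ge0_subset_integral => //.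
- by apply: measurable_funTS; exact/measurable_EFinP.
- by move=> r _; rewrite lee_fin.
- by move=> r; rewrite /= !in_itv/= => /andP[].
Qed.

(** Any [K] above the a priori bound [G_le] for G kappa may serve as upper limit, which leaves room
    for one choice valid at all points x. *)
Lemma mild_osgood (K : R) : a + B * fpos f C * kappa <= K ->
  (\int[mu]_(r in `[0%R, kappa]%classic) (h r)%:E <= \int[mu]_(r in `[a, K]%classic) ((fpos f r)^-1)%:E)%E.
Proof.
move=> KB.
have ff_nd b c : 0 <= b -> b <= c -> fpos f b <= fpos f c by move=> _; exact: fpos_nd.
have ff_gt0 b : 0 < b -> 0 < fpos f b by move=> b0; rewrite fposE ?ltW//; exact: f_gt0.
have cf := continuous_fpos fc.
have a20 : 0 < a / 2 by rewrite divr_gt0.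
have := ode_comparison chh cf cG hh0 ff_nd (fpos_ge0 f0) ff_gt0 a0 kappa0 Ga.
have maxa r : a <= r -> Num.max r (a / 2) = r.
  by move=> ar; apply/max_idPl; apply: le_trans ar; lra.
have ci : continuous (fun r => (fpos f (Num.max r (a / 2)))^-1).
  move=> r; apply: cvgV; first by rewrite gt_eqF// ff_gt0// lt_max a20 orbT.
  have cm : continuous (fun y : R => Num.max y (a / 2)).
    by move=> y; apply: (@continuous_max _ _ id (cst (a / 2))); [exact: cvg_id|exact: cvg_cst].
  by apply: (@continuous_comp _ _ _ (fun y : R => Num.max y (a / 2)) (fpos f)); [exact: cm|exact: cf].
rewrite -lee_fin /Rintegral !fineK; last 2 first.
- by apply: integrable_fin_num => //; exact: continuous_itv_integrable.
- by apply: integrable_fin_num => //; exact: continuous_itv_integrable.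
move=> ode; apply: le_trans (le_trans ode _).
  apply: le_integral_ge0 => r; rewrite /= in_itv/= => /andP[r0 _].
    by rewrite lee_fin; exact: h0.
  by rewrite /hh; have /max_idPl -> := r0.
rewrite [leLHS]integral_mkcond [leRHS]integral_mkcond; apply: le_integral_ge0 => r _.
  by rewrite patchE; case: ifP => // _; rewrite lee_fin invr_ge0; exact: fpos_ge0.
rewrite !patchE; case: ifPn => [/set_mem|_]; last first.
  by case: ifP => // _; rewrite lee_fin invr_ge0; exact: fpos_ge0.
rewrite /= in_itv/= => /andP[ar rG]; rewrite mem_set; last first.
  by rewrite /= in_itv/= ar/=; apply: le_trans rG _; exact: le_trans (G_le _) KB.
by rewrite maxa.
Qed.

End Point.

Hypothesis u0_nz : ~ (\forall x \ae leb, u0 x = 0).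
Hypothesis osgood_le :
  (\int[mu]_(r in `[fine (Linf_norm (semigroup s kappa u0)), +oo[%classic) (1 / f r)%:E
   <= \int[mu]_(r in `[0%R, kappa]%classic) (h r)%:E)%E.

Lemma mild_solution_not_global : False.
Proof.
have [C C0 [vC goodC]] := good_ae.
have [B hB] : exists B, forall t, 0 <= t <= kappa -> h (Num.max t 0) <= B.
  have [c _ hc_] := EVT_max (ltW kappa0) (continuous_subspaceT (continuous_extend_max hc)).
  by exists (h (Num.max c 0)) => t tk; apply: hc_; rewrite in_itv.
pose a x := fine (heatS s kappa v x).
have SleC x : (heatS s kappa v x <= C%:E)%E by apply: heatS_le => //; exact: ltW.
have SE x : heatS s kappa v x = (a x)%:E.
  rewrite /a fineK// ge0_fin_numE; last exact: heatS_ge0.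
  exact: le_lt_trans (SleC x) (ltry _).
have a_ge0 x : 0 <= a x by rewrite -lee_fin -SE; exact: heatS_ge0.
have a_leC x : a x <= C by rewrite -lee_fin -SE.
have aE : semigroup s kappa u0 = a.
  apply/funext => x; rewrite semigroupE; congr fine; apply: ae_eq_heatS.
  - by have [mu0 _] := u0X; exact/measurable_EFinP.
  - exact: mv.
  - by apply: filterS v_ae => z ->.
move: osgood_le; rewrite aE; set A := fine _ => ogA.
have LC : (Linf_norm a <= C%:E)%E.
  by apply/ess_supP; apply: aeW => x /=; rewrite lee_fin ger0_norm.
have LA : (Linf_norm a <= A%:E)%E.
  by rewrite /A; case: (Linf_norm a) LC => //= _; exact: leNye.
(* Were the flow of [u0] zero at time kappa, conservation of mass would make [u0] vanish almost
   everywhere. *)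
have A0 : 0 < A.
  rewrite ltNge; apply/negP => A0; apply: u0_nz.
  have /ess_supP H := LA.
  have S0 : {ae leb, forall x, heatS s kappa v x = 0%E}.
    apply: filterS H => x; rewrite lee_fin ger0_norm// => aA.
    by rewrite SE; congr EFin; apply/le_anti; rewrite a_ge0 (le_trans aA A0).
  have mS := measurable_heatS s01 kappa0 mv v_ge0.
  have I0 : (\int[leb]_x v x = 0)%E.
    rewrite -(integral_heatS s01 kappa0 mv v_ge0).
    rewrite -[RHS](integral0 leb setT); apply: ae_eq_integral => //.
    by apply: filterS S0 => x -> _.
  have : (\int[leb]_x `|v x| = 0)%E.
    by rewrite -I0; apply: eq_integral => x _; rewrite gee0_abs.
  move=> /(ae_eq_integral_abs _ measurableT mv) v0ae.
  apply: filterS2 v_ae v0ae => x vx /(_ Logic.I).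
  by rewrite vx => -[].
have LE : Linf_norm a = A%:E.
  by move: A0 LA LC; rewrite /A; case: (Linf_norm a) => //=; rewrite ltxx.
have fE r : 0 <= r -> fpos f r = f r by exact: fposE.
pose K := Num.max (C + B * fpos f C * kappa) A.
have AK : A <= K by rewrite le_max lexx orbT.
have K0 : 0 < K by exact: lt_le_trans A0 AK.
have A20 : 0 < A / 2 by rewrite divr_gt0.
have fA2 : 0 < f (A / 2) by exact: f_gt0.
(* A lower bound for the integral of 1/f over ]K, K + 1], part of the tail beyond [K]. *)
pose D := (f (K + 1))^-1.
have K10 : 0 < K + 1 by rewrite addr_gt0.
have D0 : 0 < D by rewrite invr_gt0 f_gt0.
(* So close to [A] that the integral of 1/f over [A', A[ is at most (A - A')/f(A/2) <= D/2; staying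
   above A/2 is what bounds 1/f by 1/f(A/2). *)
pose A' := Num.max (A / 2) (A - D * f (A / 2) / 2).
have DA : 0 < D * f (A / 2) / 2 by rewrite divr_gt0// mulr_gt0.
have A'A : A' < A by rewrite gt_max; apply/andP; split; [lra|rewrite ltrBlDr ltrDl].
have A2A' : A / 2 <= A' by rewrite le_max lexx.
have A'0 : 0 < A' by exact: lt_le_trans A20 A2A'.
have [x xA] : exists x, A' < a x.
  apply: contrapT => nx.
  have : (Linf_norm a <= A'%:E)%E.
    apply/ess_supP; apply: aeW => x /=; rewrite lee_fin ger0_norm// leNgt; apply/negP => xA.
    by apply: nx; exists x.
  by rewrite LE lee_fin leNgt A'A.
have xK : a x + B * fpos f C * kappa <= K by rewrite le_max lerD2r a_leC.
have ogx := mild_osgood C0 vC goodC hB (lt_trans A'0 xA) xK.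
pose g r := ((fpos f r)^-1)%:E.
have mg (E : set R) : measurable_fun E g.
  apply: measurable_funTS; apply/measurable_EFinP.
  exact: (measurableT_comp (@measurable_invr R) (measurable_fpos fc)).
have g0 r : (0 <= g r)%E by rewrite lee_fin invr_ge0; exact: fpos_ge0.
have gle b c : 0 < b -> b <= c -> (g c <= g b)%E.
  move=> b0 bc; have c0 := lt_le_trans b0 bc.
  rewrite lee_fin (fE _ (ltW b0)) (fE _ (ltW c0)) lef_pV2 ?posrE; [|exact: f_gt0|exact: f_gt0].
  by apply: f_nd => //; exact: ltW.
pose X := (\int[mu]_(r in `[A, K]%classic) g r)%E.
(* Finiteness lets [X] cancel in the final contradiction X + D <= D/2 + X. *)
have Xfin : X \is a fin_num.
  rewrite ge0_fin_numE; last by apply: integral_ge0 => r _; exact: g0.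
  apply: (@le_lt_trans _ _ (\int[mu]_(r in `[A, K]%classic) cst (g A) r)%E).
    by apply: le_integral_ge0 => r; rewrite /= in_itv/= => /andP[Ar _]; [exact: g0|exact: gle].
  rewrite integral_cst//= lebesgue_measure_itv/= lte_fin; case: ifP => _; rewrite ?mule0//.
  by rewrite -EFinD -EFinM ltry.
have dis (i j k : itv_bound R) : [disjoint [set` Interval i j] & [set` Interval j k]].
  rewrite disj_set2E; apply/eqP/seteqP; split=> // r [] /=.
  rewrite !itv_boundlr => /andP[_ rj] /andP[jr _].
  by have := le_trans rj jr; rewrite bnd_simp ltxx.
have up : (X + D%:E <= \int[mu]_(r in `[A, +oo[%classic) (1 / f r)%:E)%E.
  have DE : (D%:E <= \int[mu]_(r in `]K, (K + 1)%R]%classic) g r)%E.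
    apply: (@le_trans _ _ (\int[mu]_(r in `]K, (K + 1)%R]%classic) cst D%:E r)%E).
      by rewrite integral_cst//= lebesgue_measure_itv/= lte_fin ltrDl ltr01 -EFinD addrAC subrr add0r mule1.
    apply: le_integral_ge0 => r; rewrite /= in_itv/= => /andP[Kr rK]; first by rewrite lee_fin ltW.
    by rewrite /D -(fE _ (ltW K10)); apply: gle => //; exact: lt_trans Kr.
  apply: le_trans (leeD2l X DE) _; rewrite /X.
  have AKK : (`[A, K + 1] = `[A, K] `|` `]K, K + 1])%classic.
    by apply: itv_bndbnd_setU; rewrite bnd_simp// lerDl.
  rewrite -(ge0_integral_setU mu (measurable_itv _) (measurable_itv _) (mg _) (fun r _ => g0 r) (dis _ _ _)).
  rewrite -AKK [leLHS]integral_mkcond [leRHS]integral_mkcond; apply: le_integral_ge0 => r _.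
    by rewrite patchE; case: ifP.
  rewrite !patchE; case: ifPn => [/set_mem|_].
    rewrite /= in_itv/= => /andP[Ar _]; rewrite mem_set; last by rewrite /= in_itv/= Ar.
    by rewrite /g fE ?div1r//; exact: le_trans (ltW A0) Ar.
  case: ifPn => [/set_mem|//]; rewrite /= in_itv/= andbT => Ar.
  by rewrite lee_fin divr_ge0//; apply: f0; exact: le_trans (ltW A0) Ar.
have lo : (\int[mu]_(r in `[a x, K]%classic) g r <= (D / 2)%:E + X)%E.
  have AAK : (`[A', K] = `[A', A[ `|` `[A, K])%classic.
    by apply: itv_bndbnd_setU; rewrite bnd_simp// ltW.
  apply: (@le_trans _ _ (\int[mu]_(r in `[A', K]%classic) g r)%E).
    apply: (ge0_subset_integral mu (measurable_itv _) (measurable_itv _) (mg _) (fun r _ => g0 r)) => r.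
    rewrite /= !in_itv/= => /andP[ar ->].
    by rewrite andbT (le_trans (ltW xA)).
  rewrite AAK (ge0_integral_setU mu (measurable_itv _) (measurable_itv _) (mg _) (fun r _ => g0 r) (dis _ _ _)).
  apply: leeD2r; apply: (@le_trans _ _ (\int[mu]_(r in `[A', A[%classic) cst (g A') r)%E).
    by apply: le_integral_ge0 => r; rewrite /= in_itv/= => /andP[Ar _]; [exact: g0|exact: gle].
  rewrite integral_cst//= lebesgue_measure_itv/= lte_fin A'A -EFinD -EFinM lee_fin.
  apply: (@le_trans _ _ ((f (A / 2))^-1 * (D * f (A / 2) / 2))).
    apply: ler_pM.
    - by rewrite invr_ge0; exact: fpos_ge0.
    - by rewrite subr_ge0 ltW.
    - by have := gle _ _ A20 A2A'; rewrite lee_fin (fE _ (ltW A20)).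
    - by rewrite lerBlDl -lerBlDr le_max lexx orbT.
  have fA2n : f (A / 2) != 0 by rewrite gt_eqF.
  by rewrite le_eqVlt; apply/orP; left; apply/eqP; field.
have := le_trans up (le_trans ogA (le_trans ogx lo)).
rewrite -(fineK Xfin) -!EFinD lee_fin; lra.
Qed.
End BlowUp.

Theorem theorem3p1 (R : realType) (n : nat) (s : R) (h f : R -> R) :
  (* N = n.+1 >= 1,  0 < s < 1 *)
  0 < s < 1 ->
  (* h : [0,oo) -> [0,oo) continuous *)
  {within `[0%R, +oo[%classic, continuous h} ->
  (forall t, 0 <= t -> 0 <= h t) ->
  (* f : [0,oo) -> [0,oo) continuous, locally Lipschitz, f(0) = 0 *)
  {within `[0%R, +oo[%classic, continuous f} ->
  (forall a, 0 <= a -> 0 <= f a) ->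
  (forall M, 0 < M -> exists L : R, forall a b, 0 <= a <= M -> 0 <= b <= M ->
       `|f a - f b| <= L * `|a - b|) ->
  f 0 = 0 ->
  (* (i) *)
  (forall m : R, 0 < m ->
     (forall a b, 0 < a -> a <= b -> b <= m -> f a <= f b) ->
     (forall a b, 0 < a -> a <= b -> b <= m -> f a / a <= f b / b) ->
     forall v0 : RN R n -> R,
       in_X v0 ->
       (\forall x \ae lebN R n, 0 <= v0 x) ->
       ~ (\forall x \ae lebN R n, v0 x = 0) ->
       (Linf_norm v0 <= m%:E)%E ->
       (\int[@lebesgue_measure R]_(sigma in `]0%R, +oo[%classic)
          (h sigma * f (fine (Linf_norm (semigroup s sigma v0)))
                   / fine (Linf_norm (semigroup s sigma v0)))%:E < 1)%E ->
       exists delta : R, 0 < delta /\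
         exists u : RN R n -> R -> R,
           mild_solution s h f +oo%E (fun x => delta * v0 x) u /\ nontrivial u) /\
  (* (ii) *)
  (forall u0 : RN R n -> R,
     in_X u0 ->
     (\forall x \ae lebN R n, 0 <= u0 x) ->
     ~ (\forall x \ae lebN R n, u0 x = 0) ->
     (forall a b, 0 <= a -> a <= b -> f a <= f b) ->
     (forall a, 0 < a -> 0 < f a) ->
     (forall z0, 0 < z0 ->
        (\int[@lebesgue_measure R]_(sigma in `[z0, +oo[%classic) (1 / f sigma)%:E
           < +oo)%E) ->
     (forall t (w0 : RN R n -> R), 0 < t -> in_X w0 -> (forall x, 0 <= w0 x) ->
        forall x, f (semigroup s t w0 x) <= semigroup s t (fun y => f (w0 y)) x) ->
     forall kappa, 0 < kappa ->
       (\int[@lebesgue_measure R]_(sigma in `[fine (Linf_norm (semigroup s kappa u0)), +oo[%classic)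
           (1 / f sigma)%:E
        <= \int[@lebesgue_measure R]_(sigma in `[0%R, kappa]%classic) (h sigma)%:E)%E ->
       ~ (exists u : RN R n -> R -> R, mild_solution s h f +oo%E u0 u)).
Proof.
move=> s01 hc h0 fc f0 _ f00; split.
  by move=> m m0 f_nd fr_nd v0 v0X v0_ge0 v0_nz v0m v0_small; exact: (global_existence s01 hc h0 fc f0 f00 m0 f_nd fr_nd v0X v0_ge0 v0_nz v0m v0_small).
move=> u0 u0X u0_ge0 u0_nz f_nd f_gt0 _ jensen kappa kappa0 osgood_le [u u_mild].
exact: (mild_solution_not_global s01 hc h0 fc f0 f_nd f_gt0 jensen u0X u0_ge0 u_mild kappa0 u0_nz osgood_le).
Qed.
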